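(* Let $T$ be a locally finite regular tree, i.e. a tree all of whose vertices have the same finite degree $d\geq 3$, and let $G=\mathrm{Aut}(T)$. Let $\mathbb{K}\in\{\mathbb{R},\mathbb{C},\mathbb{H}\}$ and let $\pi$ be a continuous irreducible representation of $G$ into a $\mathbb{K}$-Hilbert space $H$. If $\pi$ preserves a continuous strongly nondegenerate sesquilinear form of finite index $p\geq 0$ on $H$, then $p=0$ or $p=1$.
   Context: $\mathrm{Aut}(T)$ carries the topology of pointwise convergence (on vertices). $\mathbb{H}$ denotes the quaternions; quaternionic vector spaces are right vector spaces. A continuous representation of $G$ on a Hilbert space $H$ is a homomorphism $\pi$ from $G$ to the invertible bounded $\mathbb{K}$-linear operators of $H$ with $g\mapsto\pi(g)v$ continuous for every $v\in H$. It is irreducible if $H\neq\{0\}$ and the only closed $G$-invariant $\mathbb{K}$-subspaces of $H$ are $\{0\}$ and $H$. Sesquilinear forms $B$ are Hermitian, $B(w,v)=\overline{B(v,w)}$ (symmetric bilinear if $\mathbb{K}=\mathbb{R}$). $\pi$ preserves $B$ if $B(\pi(g)v,\pi(g)w)=B(v,w)$ for all $g\in G$, $v,w\in H$. A continuous form $B$ is strongly nondegenerate if there is a $B$-orthogonal decomposition $H=H_+\oplus H_-$ with $B$ positive definite on $H_+$ and negative definite on $H_-$, such that the positive definite form obtained from $B$ by changing its sign on $H_-$ defines a complete norm on $H$. The index of $B$ is the maximal $\mathbb{K}$-dimension of a negative definite subspace. *)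

(* Defs.v *)
From HB Require Import structures.
From mathcomp Require Import all_boot all_order all_algebra.
From mathcomp Require Import ring.
From mathcomp Require Import complex.
From mathcomp Require Import all_classical all_reals all_analysis.

Set Implicit Arguments.
Unset Strict Implicit.
Unset Printing Implicit Defensive.

Import Order.TTheory GRing.Theory Num.Theory.
Import numFieldNormedType.Exports.

Local Open Scope classical_set_scope.
Local Open Scope ring_scope.

(* Hamilton quaternions: Quat a b c d is a + b i + c j + d k, with i j = k. *)
Record quaternion (R : Type) := Quat { quat1 : R; quati : R; quatj : R; quatk : R }.

Section Quaternion.
Variable R : comNzRingType.
Notation quat := (quaternion R).
Implicit Types x y z : quat.

Definition quat_to_prod x := (quat1 x, quati x, quatj x, quatk x).
Definition prod_to_quat (p : R * R * R * R) : quat :=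
  Quat p.1.1.1 p.1.1.2 p.1.2 p.2.
Fact quat_to_prodK : cancel quat_to_prod prod_to_quat. Proof. by case. Qed.
HB.instance Definition _ := Choice.copy quat (can_type quat_to_prodK).

Definition addq x y :=
  let: Quat a b c d := x in let: Quat a' b' c' d' := y in
  Quat (a + a') (b + b') (c + c') (d + d').
Definition oppq x := let: Quat a b c d := x in Quat (- a) (- b) (- c) (- d).

Fact addqA : associative addq.
Proof. by move=> [????] [????] [????] /=; rewrite !addrA. Qed.
Fact addqC : commutative addq.
Proof. by move=> [a b c d] [????] /=; rewrite (addrC a) (addrC b) (addrC c) (addrC d). Qed.
Fact add0q : left_id (Quat 0 0 0 0) addq.
Proof. by move=> [????] /=; rewrite !add0r. Qed.
Fact addNq : left_inverse (Quat 0 0 0 0) oppq addq.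
Proof. by move=> [????] /=; rewrite !addNr. Qed.
HB.instance Definition _ := GRing.isZmodule.Build quat addqA addqC add0q addNq.

Definition mulq x y :=
  let: Quat a b c d := x in let: Quat a' b' c' d' := y in
  Quat (a * a' - b * b' - c * c' - d * d')
       (a * b' + b * a' + c * d' - d * c')
       (a * c' - b * d' + c * a' + d * b')
       (a * d' + b * c' - c * b' + d * a').

Fact mulqA : associative mulq.
Proof. by move=> [????] [????] [????] /=; congr Quat; ring. Qed.
Fact mul1q : left_id (Quat 1 0 0 0) mulq.
Proof. by move=> [????] /=; congr Quat; ring. Qed.
Fact mulq1 : right_id (Quat 1 0 0 0) mulq.
Proof. by move=> [????] /=; congr Quat; ring. Qed.
Fact mulqDl : left_distributive mulq addq.
Proof. by move=> [????] [????] [????] /=; congr Quat; ring. Qed.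
Fact mulqDr : right_distributive mulq addq.
Proof. by move=> [????] [????] [????] /=; congr Quat; ring. Qed.
Fact oneq_neq0 : Quat 1 0 0 0 != 0 :> quat.
Proof. by apply/eqP => -[/eqP]; rewrite oner_eq0. Qed.
HB.instance Definition _ := GRing.Zmodule_isNzRing.Build quat
  mulqA mul1q mulq1 mulqDl mulqDr oneq_neq0.

Definition conjq x : quat :=
  let: Quat a b c d := x in Quat a (- b) (- c) (- d).

End Quaternion.

Inductive scalar_kind := Reals | Complexes | Quaternions.

Section Scalar.
Variable R : realType.

Definition kscalar (k : scalar_kind) : nzRingType :=
  match k with
  | Reals => R
  | Complexes => R[i]%C
  | Quaternions => quaternion R
  end.

Definition kconj (k : scalar_kind) : kscalar k -> kscalar k :=
  match k with
  | Reals => fun x => x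
  | Complexes => fun z => conjc z
  | Quaternions => fun q => conjq q
  end.

Definition kre (k : scalar_kind) : kscalar k -> R :=
  match k with
  | Reals => fun x => x
  | Complexes => fun z => complex.Re z
  | Quaternions => fun q => quat1 q
  end.

Definition kreal (k : scalar_kind) : R -> kscalar k :=
  match k with
  | Reals => fun x => x
  | Complexes => fun x => Complex x 0
  | Quaternions => fun x => Quat x 0 0 0
  end.

Definition kabs (k : scalar_kind) (x : kscalar k) : R :=
  Num.sqrt (kre (kconj x * x)).

End Scalar.

(* A right K-vector space whose underlying real vector space, with the norm
   coming from the K-valued inner product, is a Banach space.  The inner product
   is conjugate-linear in its first variable and linear in the second one. *)
Record hilbertType (R : realType) (k : scalar_kind) := HilbertType {
  hilbert_sort :> completeNormedModType R;
  rmul : hilbert_sort -> kscalar R k -> hilbert_sort;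
  inner : hilbert_sort -> hilbert_sort -> kscalar R k;
  rmulDl : forall u v a, rmul (u + v) a = rmul u a + rmul v a;
  rmulDr : forall v a b, rmul v (a + b) = rmul v a + rmul v b;
  rmulM : forall v a b, rmul v (a * b) = rmul (rmul v a) b;
  rmul_real : forall v (r : R), rmul v (kreal k r) = r *: v;
  innerDr : forall u v w, inner u (v + w) = inner u v + inner u w;
  innerMr : forall u v a, inner u (rmul v a) = inner u v * a;
  inner_conj : forall u v, inner v u = kconj (inner u v);
  inner_norm : forall v, `|v| ^+ 2 = kre (inner v v) }.

Notation "v *> a" := (rmul v a) (at level 40, left associativity) : ring_scope.

Section Linear.
Variables (R : realType) (k : scalar_kind) (H : hilbertType R k).
Local Notation K := (kscalar R k).

Definition ksubspace (W : set H) : Prop :=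
  [/\ W 0, forall u v, W u -> W v -> W (u + v) & forall v (a : K), W v -> W (v *> a)].

Definition kdim (W : set H) (n : nat) : Prop :=
  exists e : 'I_n -> H,
    [/\ forall i, W (e i),
        forall c : 'I_n -> K, \sum_i e i *> c i = 0 -> forall i, c i = 0 &
        forall w, W w -> exists c : 'I_n -> K, w = \sum_i e i *> c i].

Definition klinear (f : H -> H) : Prop :=
  (forall u v, f (u + v) = f u + f v) /\ (forall v (a : K), f (v *> a) = f v *> a).

Definition bounded_op (f : H -> H) : Prop :=
  exists M : R, forall v, `|f v| <= M * `|v|.

Definition in_GL (f : H -> H) : Prop :=
  [/\ klinear f, bounded_op f &
      exists g : H -> H, [/\ klinear g, bounded_op g, cancel f g & cancel g f]].

Implicit Type B : H -> H -> K.

Definition sesquilinear_form B : Prop :=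
  [/\ forall u v w, B (u + v) w = B u w + B v w,
      forall u v w, B u (v + w) = B u v + B u w &
      forall v w (a b : K), B (v *> a) (w *> b) = kconj a * B v w * b].

Definition hermitian_form B : Prop := forall v w, B w v = kconj (B v w).

Definition continuous_form B : Prop :=
  forall v w : H, kabs (B x.1 x.2 - B v w) @[x --> (v, w)] --> (0 : R).

(* For Hermitian B the scalar B v v is real, so nothing is lost by kre. *)
Definition pos_def_on B (W : set H) : Prop :=
  forall v, W v -> v != 0 -> 0 < kre (B v v).
Definition neg_def_on B (W : set H) : Prop :=
  forall v, W v -> v != 0 -> kre (B v v) < 0.

Definition complete_norm (N : H -> R) : Prop :=
  forall u : nat -> H,
    (forall e : R, 0 < e ->
       exists n, forall i j, (n <= i)%N -> (n <= j)%N -> N (u i - u j) < e) ->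
    exists l : H, N (u n - l) @[n --> \oo] --> (0 : R).

(* pp and pm are the components of the decomposition H = Hp (+) Hm; the sum is
   direct because of the definiteness conditions. *)
Definition strongly_nondegenerate B : Prop :=
  exists (Hp Hm : set H) (pp pm : H -> H),
    [/\ ksubspace Hp /\ ksubspace Hm,
        forall v, [/\ Hp (pp v), Hm (pm v) & v = pp v + pm v],
        forall v w, Hp v -> Hm w -> B v w = 0,
        pos_def_on B Hp /\ neg_def_on B Hm &
        complete_norm
          (fun v => Num.sqrt (kre (B (pp v) (pp v) - B (pm v) (pm v))))].

Definition form_index B (p : nat) : Prop :=
  (exists W : set H, [/\ ksubspace W, neg_def_on B W & kdim W p]) /\
  (forall W : set H, ksubspace W -> neg_def_on B W ->
     exists2 n, kdim W n & (n <= p)%N).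

End Linear.

Section Tree.
Variables (V : choiceType) (adj : rel V).

Definition is_tree : Prop :=
  [/\ symmetric adj, irreflexive adj, inhabited V,
      forall x y, exists2 p, path adj x p & last x p = y &
      forall c : seq V, ucycle adj c -> (size c < 3)%N].

Definition regular_graph (d : nat) : Prop :=
  forall v, ([set w | adj v w] #= `I_d)%card.

(* The inverse is stored as data; it is determined by the automorphism. *)
Record tree_aut := Aut {
  aut_fun :> V -> V;
  aut_inv : V -> V;
  aut_funK : cancel aut_fun aut_inv;
  aut_invK : cancel aut_inv aut_fun;
  aut_adj : forall x y, adj (aut_fun x) (aut_fun y) = adj x y }.

HB.instance Definition _ := gen_eqMixin tree_aut.
HB.instance Definition _ := gen_choiceMixin tree_aut.

Lemma aut_eq (g h : tree_aut) : g =1 h -> g = h.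
Proof.
case: g h => [g g' gK g'K ga] [h h' hK h'K ha] /= /funext gh.
move: gK g'K ga; rewrite gh => gK g'K ga.
have g'h' : g' = h' by apply/funext => x; rewrite -{1}(h'K x) gK.
move: gK g'K; rewrite g'h' => gK g'K.
by congr Aut; exact: Prop_irrelevance.
Qed.

Definition aut1 : tree_aut :=
  @Aut id id (fun=> erefl) (fun=> erefl) (fun _ _ => erefl).

Definition autM (g h : tree_aut) : tree_aut :=
  @Aut (g \o h) (aut_inv h \o aut_inv g)
    (can_comp (aut_funK g) (aut_funK h)) (can_comp (aut_invK h) (aut_invK g))
    (fun x y => etrans (aut_adj g (h x) (h y)) (aut_adj h x y)).

Fact aut_inv_adj (g : tree_aut) x y : adj (aut_inv g x) (aut_inv g y) = adj x y.
Proof. by rewrite -(aut_adj g) !aut_invK. Qed.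

Definition autV (g : tree_aut) : tree_aut :=
  @Aut (aut_inv g) g (aut_invK g) (aut_funK g) (aut_inv_adj g).

Fact autMA : associative autM. Proof. by move=> g h l; apply: aut_eq. Qed.
Fact aut1M : left_id aut1 autM. Proof. by move=> g; apply: aut_eq. Qed.
Fact autM1 : right_id aut1 autM. Proof. by move=> g; apply: aut_eq. Qed.
Fact autVM : left_inverse aut1 autV autM.
Proof. by move=> g; apply: aut_eq => x /=; rewrite aut_funK. Qed.
Fact autMV : right_inverse aut1 autV autM.
Proof. by move=> g; apply: aut_eq => x /=; rewrite aut_invK. Qed.
HB.instance Definition _ := isGroup.Build tree_aut autMA aut1M autM1 autVM autMV.

Definition aut_ptws (g : tree_aut) : {ptws V -> discrete_topology V} := aut_fun g.
HB.instance Definition _ := Topological.copy tree_aut (initial_topology aut_ptws).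

End Tree.

Section Representation.
Variables (V : choiceType) (adj : rel V).
Variables (R : realType) (k : scalar_kind) (H : hilbertType R k).
Implicit Type pi : tree_aut adj -> H -> H.

Definition continuous_rep pi : Prop :=
  [/\ forall g, in_GL (pi g),
      forall g h, pi (g * h)%g = pi g \o pi h &
      forall v, continuous (fun g => pi g v)].

Definition irreducible_rep pi : Prop :=
  (exists v : H, v != 0) /\
  forall W : set H, ksubspace W -> closed W ->
    (forall g v, W v -> W (pi g v)) -> W = [set 0] \/ W = setT.

Definition preserves_form pi (B : H -> H -> kscalar R k) : Prop :=
  forall g v w, B (pi g v) (pi g w) = B v w.

End Representation.

(* Main.v *)
(* Let a be a hyperbolic translation of T through an edge e = {o, y}, M the space
   of vectors fixed by the stabilizer of e, and P the averaging projection onto M.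
   If u and w are fixed by the pointwise stabilizer of a ball, then for large n the
   half-tree fixators of T force B(a^n u, w) = B(U^n u', w') with u', w' in M, where
   U = P a is a Hecke operator on M.  If B(a^n u, u) tends to 0 while B(u, u) < 0,
   far translates of u are nearly orthogonal negative vectors, which is impossible
   when the index is finite.  So it suffices to see that, up to a condition of
   codimension one on u', the iterates U^n u' decay.

   M is an irreducible module for the algebra generated by the projection S onto the
   vectors fixed by the stabilizer of o and the involution t given by a flip of e.
   Swapping two branches at o shows that B >= 0 on ker S (otherwise the index is
   infinite).  If B >= 0 on M, then U is a contraction and its iterates decay weakly,
   unless S = 1, when dim M <= 1.  Otherwise Z = S t + t S - t is central,
   B-symmetric, and B(Z y, Z y) <= c B(y, y) on S M holds for c = 1; at the largest
   such c finiteness of the index and irreducibility give Z^2 = c, hence Z is a real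
   scalar with |Z| >= 1, dim S M = 1, and U satisfies a quadratic equation with
   roots z1 z2 = 1/q, |z2| < 1: the vectors with S (U - z2) u' = 0 decay. *)
Require Import Defs.
From mathcomp Require Import all_boot all_order all_algebra all_fingroup.
From mathcomp Require Import ring lra complex.
From mathcomp Require Import all_classical all_reals all_analysis.

Set Implicit Arguments.
Unset Strict Implicit.
Unset Printing Implicit Defensive.

(** * Regular trees and their automorphisms *)

(** The inner product of $H$ is not invariant and $B$ may be indefinite on $M$, so spectral theory
    is not at hand. It is replaced by one inequality, that [b v v] plus finitely many squares
    [b v f ^+ 2] is nonnegative for the real part [b] of $B$, and by Schur's lemma in the form that
    a nonzero invariant subspace of $M$ is dense. The delicate point is $Z^2=c$: vectors of $SM$
    that nearly attain the largest $c$ may be unbounded in norm, so they are normalized by the sum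
    of the squares [b v f ^+ 2]. They then give uniformly bounded functionals that almost vanish on
    the image of $c-Z^2$; were this image dense, every [b v f] would become small, against the
    normalization. Codimension one suffices because an index of at least two provides a negative
    definite plane. Averaging over the fixator of a large ball moves two spanning vectors so little
    that all their combinations stay negative, and some combination meets the one condition. These
    averages are limits of finite sums, since a vertex stabilizer acts on each ball through a finite
    group. *)

Section TreeMetric.
Variables (V : choiceType) (adj : rel V) (hT : is_tree adj).
Implicit Types (x y z u v w : V).

Let adj_sym : symmetric adj. Proof. by case: hT. Qed.
Let adj_irr : irreflexive adj. Proof. by case: hT. Qed.

Let walk x v n := `[< exists p, [/\ path adj x p, last x p = v & size p = n] >].

Fact ex_walk x v : exists n, walk x v n.
Proof.
case: hT => _ _ _ /(_ x v)[p pp pv] _.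
by exists (size p); apply/asboolP; exists p.
Qed.

Definition dist x v : nat := ex_minn (ex_walk x v).

Lemma dist_path x v :
  exists p, [/\ path adj x p, last x p = v & size p = dist x v].
Proof. by rewrite /dist; case: ex_minnP => n /asboolP. Qed.

Lemma dist_leq x p : path adj x p -> (dist x (last x p) <= size p)%N.
Proof.
rewrite /dist; case: ex_minnP => n _ nmin xp.
by apply: nmin; apply/asboolP; exists p.
Qed.

Lemma dist_eq0 x v : (dist x v == 0%N) = (x == v).
Proof.
apply/eqP/eqP => [d0|<-]; last by apply/eqP; rewrite -leqn0 (@dist_leq x [::]).
by have [[|a p] [_ //=]] := dist_path x v; rewrite d0.
Qed.

Lemma distxx x : dist x x = 0%N. Proof. by apply/eqP; rewrite dist_eq0. Qed.

Lemma dist_sym x v : dist x v = dist v x.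
Proof.
suff le a b : (dist a b <= dist b a)%N by apply/eqP; rewrite eqn_leq !le.
have [p [bp pa <-]] := dist_path b a.
have := @dist_leq a (rev (belast b p)).
rewrite -pa rev_path.
have -> : last (last b p) (rev (belast b p)) = b.
  by case: p {bp pa} => //= c p; rewrite rev_cons last_rcons.
rewrite size_rev size_belast; apply.
by rewrite (@eq_path _ _ adj) // => u v'; rewrite /= adj_sym.
Qed.

Lemma dist_adjS x v w : adj v w -> (dist x w <= (dist x v).+1)%N.
Proof.
move=> vw; have [p [xp pv <-]] := dist_path x v.
have := @dist_leq x (rcons p w).
by rewrite last_rcons size_rcons; apply; rewrite rcons_path xp pv.
Qed.

Let geod_notin x v u p : path adj x p -> last x p = u -> size p = dist x u ->
  (dist x u <= dist x v)%N -> u != v -> v \notin x :: p.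
Proof.
move=> xp pu sp le uv; apply/negP => /splitPl vp.
case: vp xp pu sp => p1 p2 p1v; rewrite cat_path last_cat size_cat => /andP[xp1 _].
move=> p2u sp; move: (dist_leq xp1); rewrite p1v => le1.
have p20 : size p2 = 0%N.
  by apply/eqP; rewrite -leqn0 -(leq_add2l (size p1)) sp addn0 (leq_trans le).
by move: uv; rewrite -p2u (size0nil p20) /= p1v eqxx.
Qed.

(** This is where the absence of cycles enters. The geodesics from [x] to [u] and to [u'] avoid [v],
    so they join [u] to [u'] in the graph without [v]; a simple path there closes up through [v] to
    a cycle unless it is trivial. *)
Lemma uniq_near x v u u' : adj v u -> adj v u' ->
  (dist x u <= dist x v)%N -> (dist x u' <= dist x v)%N -> u = u'.
Proof.
move=> vu vu' le le'; apply: contrapT => uu'.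
pose e : rel V := [rel a b | [&& adj a b, a != v & b != v]].
have liftp a p : path adj a p -> v \notin a :: p -> path e a p.
  elim: p a => //= b p IH a /andP[ab bp]; rewrite inE negb_or => /andP[av vbp].
  rewrite {1}/e /= ab eq_sym av /= IH // andbT; apply: contraNneq vbp => <-.
  by rewrite inE eqxx.
have nv w : adj v w -> w != v by apply: contraTneq => ->; rewrite adj_irr.
have [p [xp pu sp]] := dist_path x u.
have [p' [xp' pu' sp']] := dist_path x u'.
have ep := liftp _ _ xp (geod_notin xp pu sp le (nv _ vu)).
have ep' := liftp _ _ xp' (geod_notin xp' pu' sp' le' (nv _ vu')).
have [s us su'] : exists2 s, path e u s & last u s = u'.
  exists (rev (belast x p) ++ p').
    rewrite cat_path -pu rev_path.
    rewrite (@eq_path _ _ e) ?ep /=; last first.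
      by move=> a b; rewrite /e /= adj_sym [(b != v) && _]andbC.
    suff -> : last (last x p) (rev (belast x p)) = x by [].
    by case: (p) => //= c q; rewrite rev_cons last_rcons.
  rewrite last_cat; suff -> : last u (rev (belast x p)) = x by [].
  by rewrite -pu; case: (p) => //= c q; rewrite rev_cons last_rcons.
move: su'; case/shortenP: us => t ut uniqt _ tu'.
have vt : v \notin u :: t.
  have : all (predC1 v) (u :: t).
    rewrite /= nv //=; elim: t u {uniqt tu' vu le uu' pu sp ep} ut => //= b t IH a.
    by case/andP => /and3P[_ _ bv] /IH ->; rewrite bv.
  by move=> /allP tv; apply/negP => /tv /=; rewrite eqxx.
case: hT => _ _ _ _ /(_ (v :: u :: t)); rewrite /ucycle.
have -> : path.cycle adj (v :: u :: t).
  rewrite /= vu rcons_path tu' adj_sym vu' andbT.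
  by apply: sub_path ut => a b /andP[].
rewrite cons_uniq vt uniqt => /(_ isT) /=.
by case: t tu' {ut uniqt vt} => //=.
Qed.

Lemma ex_near x v : v != x -> exists u, adj v u /\ dist x v = (dist x u).+1.
Proof.
move=> vx; have [p [xp pv sp]] := dist_path x v.
case/lastP: p xp pv sp => [_ /= xv|p u].
  by move: vx; rewrite xv eqxx.
rewrite rcons_path last_rcons size_rcons => /andP[xp pu] uv sp.
exists (last x p); rewrite adj_sym -uv; split=> //.
apply/eqP; rewrite eqn_leq dist_adjS // uv -sp ltnS.
exact: dist_leq.
Qed.

(* The neighbour of v nearest to x; meaningful only for v != x. *)
Definition toward x v : V :=
  xget v [set u | adj v u /\ dist x v = (dist x u).+1].

Lemma towardP x v : v != x ->
  adj v (toward x v) /\ dist x v = (dist x (toward x v)).+1.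
Proof. by move=> /ex_near[u hu]; rewrite /toward; case: xgetP => [//|/(_ u)]. Qed.

Lemma toward_eq x v u : adj v u -> (dist x u <= dist x v)%N -> toward x v = u.
Proof.
move=> vu le; have vx : v != x.
  apply: contraTneq vu => vx; move: le; rewrite vx distxx leqn0 dist_eq0.
  by move=> /eqP <-; rewrite adj_irr.
have [vt e] := towardP vx.
by apply: (@uniq_near x v) => //; rewrite e.
Qed.

Lemma dist_near x v u : adj v u -> (dist x u <= dist x v)%N ->
  dist x v = (dist x u).+1.
Proof.
move=> vu le; have tu := toward_eq vu le.
have vx : v != x.
  apply: contraTneq vu => vx; move: le; rewrite vx distxx leqn0 dist_eq0.
  by move=> /eqP <-; rewrite adj_irr.
by have [_] := towardP vx; rewrite tu.
Qed.

Lemma dist_adj x v u : adj v u ->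
  dist x v = (dist x u).+1 \/ dist x u = (dist x v).+1.
Proof.
move=> vu; case: (leqP (dist x u) (dist x v)) => le.
  by left; apply: dist_near.
by right; apply: dist_near; [rewrite adj_sym|exact: ltnW].
Qed.

Lemma dist_adj_far x v u : adj v u -> toward x v != u -> dist x u = (dist x v).+1.
Proof.
move=> vu tu; case: (dist_adj x vu) => // e.
by move: tu; rewrite (toward_eq vu) ?eqxx // e.
Qed.

Lemma toward_adj v u : adj v u -> toward u v = u.
Proof. by move=> vu; apply: toward_eq => //; rewrite distxx. Qed.

Lemma adj_neq v u : adj v u -> v != u.
Proof. by apply: contraTneq => ->; rewrite adj_irr. Qed.

(** The first step from [z] to the nearer of the two vertices also begins the geodesic to the
    farther one, so the label of a branch is constant along edges that avoid [z]. *)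
Lemma toward_branch z v w : adj v w -> v != z -> w != z -> toward v z = toward w z.
Proof.
wlog le : v w / (dist z v <= dist z w)%N => [hw|] vw vz wz.
  case: (leqP (dist z v) (dist z w)) => le; first exact: hw.
  by apply/esym/hw; rewrite // 1?adj_sym // ltnW.
have e : dist z w = (dist z v).+1 by apply: dist_near; rewrite // adj_sym.
apply/esym; have zv : z != v by rewrite eq_sym.
have [zt et] := towardP zv; apply: toward_eq => //.
rewrite [dist w z]dist_sym e dist_sym.
rewrite (leq_trans (dist_adjS _ vw)) // ltnS dist_sym.
by rewrite [dist z v]dist_sym et.
Qed.

Lemma dist_aut (g : tree_aut adj) x v : dist (g x) (g v) = dist x v.
Proof.
have le (h : tree_aut adj) a b : (dist (h a) (h b) <= dist a b)%N.
  have [p [ap pb <-]] := dist_path a b.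
  have := @dist_leq (h a) (map h p); rewrite last_map pb size_map; apply.
  by rewrite path_map (@eq_path _ _ adj) // => s t /=; rewrite aut_adj.
apply/eqP; rewrite eqn_leq le /=.
by have := le (autV g) (g x) (g v); rewrite /= !aut_funK.
Qed.

Lemma toward_aut (g : tree_aut adj) x v : v != x ->
  toward (g x) (g v) = g (toward x v).
Proof.
move=> vx; have [vt e] := towardP vx.
by apply: toward_eq; rewrite ?aut_adj // !dist_aut e.
Qed.

End TreeMetric.

(** * Edge colourings and the automorphisms that permute colours *)

Section Coloring.
Variables (V : choiceType) (adj : rel V) (hT : is_tree adj) (d : nat).
Implicit Types (x y z u v w : V) (i j : 'I_d).

(* nb v i is the neighbour of v along the edge of colour i at v. *)
Definition coloring (nb : V -> 'I_d -> V) : Prop :=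
  [/\ forall v i, adj v (nb v i), forall v, injective (nb v),
      forall v w, adj v w -> exists i, nb v i = w &
      forall v i, nb (nb v i) i = v].

Lemma regular_enum v : regular_graph adj d ->
  exists f : 'I_d -> V, [/\ forall i, adj v (f i), injective f &
    forall w, adj v w -> exists i, f i = w].
Proof.
move=> /(_ v)/card_set_bijP[f [fi finj fsurj]].
pose g (i : 'I_d) := xget v [set w | adj v w /\ f w = i].
have gP (i : 'I_d) : adj v (g i) /\ f (g i) = i.
  rewrite /g; case: xgetP => [w _ //|].
  by have [w aw fw] := fsurj i (ltn_ord i) => /(_ w)[]; split.
exists g; split=> [i|i j gij|w vw]; first by have [] := gP i.
  by apply: val_inj; rewrite /= -(gP i).2 -(gP j).2 gij.
have fw : (f w < d)%N := fi w vw.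
exists (Ordinal fw); have [ag fg] := gP (Ordinal fw).
by apply: finj; rewrite ?inE.
Qed.

(** Neighbours are enumerated arbitrarily by [f]. Going outwards from [o], the enumeration at [v] is
    corrected by one transposition, so that the edge to the parent gets at [v] the colour it already
    has at the parent. *)
Lemma ex_coloring : (0 < d)%N -> regular_graph adj d -> exists nb, coloring nb.
Proof.
move=> d0 hreg; pose i0 : 'I_d := Ordinal d0.
have /choice[f fP] := (fun v => regular_enum v hreg).
case: (hT) => adj_sym _ [ o ] _ _.
pose idx v w : 'I_d := odflt i0 [pick i | f v i == w].
have idxK v w : adj v w -> f v (idx v w) = w.
  have [_ _ fs] := fP v => /fs[i fi]; rewrite /idx; case: pickP => [j /eqP //|].
  by move=> /(_ i); rewrite fi eqxx.
have fK v i : idx v (f v i) = i.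
  by have [fa fi _] := fP v; apply: fi; apply: idxK.
pose par v := toward hT o v.
pose perm v (c : 'I_d) : {perm 'I_d} :=
  if v == o then 1%g else tperm c (idx v (par v)).
(* At [n = dist hT o v] this is the colour that the parent of [v] gives to their edge: [perm] is an
   involution, so applying it to the index of [v] inverts the corrected enumeration. *)
pose fix col n v {struct n} : 'I_d :=
  if n is m.+1 then perm (par v) (col m (par v)) (idx (par v) v) else i0.
pose s v := perm v (col (dist hT o v) v).
have sK v i : s v (s v i) = i.
  by rewrite /s /perm; case: ifP => _; rewrite ?perm1 ?tpermK.
pose nb v i := f v (s v i).
have nbadj v i : adj v (nb v i) by have [fa _ _] := fP v; exact: fa.
have child v w : adj v w -> dist hT o w = (dist hT o v).+1 ->
    par w = v /\ col (dist hT o w) w = s v (idx v w).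
  move=> vw dw; have pw : par w = v.
    by apply: toward_eq; rewrite ?dw // adj_sym.
  by rewrite dw /= pw.
have root v w : dist hT o w = (dist hT o v).+1 -> (w == o) = false.
  by apply: contra_eqF => /eqP ->; rewrite distxx.
exists nb; split=> // [v|v w vw|v i].
- by have [_ fi _] := fP v => i j /fi /perm_inj.
- by exists (s v (idx v w)); rewrite /nb sK idxK.
have vw := nbadj v i; set w := nb v i in vw *.
have wv : adj w v by rewrite adj_sym.
have ivw : idx v w = s v i by rewrite /w /nb fK.
case: (dist_adj hT o wv) => dd.
  have [pw cw] := child _ _ vw dd.
  rewrite ivw sK in cw.
  by rewrite /nb {1}/s /perm (root _ _ dd) cw tpermL pw idxK.
have [pv cv] := child _ _ wv dd.
have -> : i = s w (idx w v).
  apply: (@perm_inj _ (s v)); rewrite -ivw /s /perm (root _ _ dd) cv pv.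
  by rewrite -/(s w) tpermL.
by rewrite /nb sK idxK.
Qed.

End Coloring.

Section ColoredAut.
Variables (V : choiceType) (adj : rel V) (hT : is_tree adj) (d : nat).
Variables (nb : V -> 'I_d -> V) (hnb : coloring adj nb) (hd : (0 < d)%N).
Implicit Types (x y z u v w : V) (i j : 'I_d) (s : {perm 'I_d}).

Lemma nb_adj v i : adj v (nb v i). Proof. by case: hnb. Qed.
Lemma nbK v i : nb (nb v i) i = v. Proof. by case: hnb. Qed.
Lemma nb_inj v : injective (nb v). Proof. by case: hnb. Qed.
Lemma nb_surj v w : adj v w -> exists i, nb v i = w.
Proof. by case: hnb => _ _ + _; apply. Qed.

Lemma adj_ind x (P : V -> Prop) :
  P x -> (forall v i, P v -> P (nb v i)) -> forall v, P v.
Proof.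
move=> Px Pn v; have [n dn] : exists n, dist hT x v = n by exists (dist hT x v).
elim: n v dn => [|n IH] v dn.
  by move/eqP: dn; rewrite dist_eq0 => /eqP <-.
have vx : v != x by apply: contra_eq_neq dn => ->; rewrite distxx.
have [vt] := towardP hT vx; rewrite dn => -[dt].
have [i <-] : exists i, nb (toward hT x v) i = v.
  by apply: nb_surj; have [-> _ _ _ _] := hT.
exact: Pn (IH _ (esym dt)).
Qed.

Lemma colored_ext s x (f g : V -> V) : f x = g x ->
  (forall v i, f (nb v i) = nb (f v) (s i)) ->
  (forall v i, g (nb v i) = nb (g v) (s i)) -> f =1 g.
Proof.
move=> fgx fn gn; apply: (adj_ind fgx) => v i fgv.
by rewrite fn gn fgv.
Qed.

(** The map is built outwards from [x]: once the parent has its image, the colour of the connecting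
    edge, moved by [s], dictates the image of the child. *)
Lemma ex_colored s x y :
  exists2 f : V -> V, f x = y & forall v i, f (nb v i) = nb (f v) (s i).
Proof.
have /choice[col colP] : forall vw : V * V, exists i, adj vw.1 vw.2 -> nb vw.1 i = vw.2.
  move=> [v w] /=; case: (boolP (adj v w)) => [/nb_surj[i ?]|_]; first by exists i.
  by exists (Ordinal hd).
pose fix f n v {struct n} := if n is m.+1 then
  nb (f m (toward hT x v)) (s (col (v, toward hT x v))) else y.
exists (fun v => f (dist hT x v) v); first by rewrite distxx.
have adj_sym : symmetric adj by case: hT.
have step v w i : nb v i = w -> dist hT x w = (dist hT x v).+1 ->
    f (dist hT x w) w = nb (f (dist hT x v) v) (s i).
  move=> vw dw; have wv : adj w v by rewrite adj_sym -vw nb_adj.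
  have tw : toward hT x w = v by apply: toward_eq; rewrite ?dw.
  rewrite dw /= tw; congr (nb _ (s _)); apply: (@nb_inj w).
  by rewrite (colP (w, v)) //= -vw nbK.
move=> v i; case: (dist_adj hT x (nb_adj v i)) => dd; last exact: step.
by rewrite (step (nb v i) v i) // nbK // nbK.
Qed.

Lemma ex_colored_aut s x y :
  exists g : tree_aut adj, g x = y /\ forall v i, g (nb v i) = nb (g v) (s i).
Proof.
have [f fx fn] := ex_colored s x y.
have [h hy hn] := ex_colored s^-1%g y x.
have fK : cancel f h.
  apply: (@colored_ext 1%g x (h \o f) id) => [|v i|v i] /=; first by rewrite fx.
    by rewrite fn hn permK perm1.
  by rewrite perm1.
have hK : cancel h f.
  apply: (@colored_ext 1%g y (f \o h) id) => [|v i|v i] /=; first by rewrite hy.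
    by rewrite hn fn permKV perm1.
  by rewrite perm1.
have fa v w : adj v w -> adj (f v) (f w).
  by move=> /nb_surj[i <-]; rewrite fn nb_adj.
have ha v w : adj v w -> adj (h v) (h w).
  by move=> /nb_surj[i <-]; rewrite hn nb_adj.
have fadj v w : adj (f v) (f w) = adj v w.
  by apply/idP/idP => [/ha|/fa //]; rewrite !fK.
by exists (Defs.Aut fK hK fadj).
Qed.

End ColoredAut.

(** * Cutting and gluing automorphisms along branches *)

Section Glue.
Variables (V : choiceType) (adj : rel V) (hT : is_tree adj).
Implicit Types (x y z u v w : V) (g h k : tree_aut adj) (P : pred V).

Let adj_sym : symmetric adj. Proof. by case: hT. Qed.

Lemma aut_inj g : injective g. Proof. exact: can_inj (@aut_funK _ _ g). Qed.

(* For v != z, toward hT v z names the branch at z that contains v. *)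
Lemma ex_glue g z P : g z = z -> (forall u, adj z u -> P (g u) = P u) ->
  exists h : tree_aut adj, forall v,
    h v = if (v != z) && P (toward hT v z) then g v else v.
Proof.
move=> gz gP; pose gl (k : tree_aut adj) v :=
  if (v != z) && P (toward hT v z) then k v else v.
have br k v : k z = z -> (forall u, adj z u -> P (k u) = P u) ->
    (k v != z) && P (toward hT (k v) z) = (v != z) && P (toward hT v z).
  move=> kz kP; rewrite -{1 2}kz (inj_eq (@aut_inj k)).
  case: (eqVneq v z) => //= vz.
  have zv : z != v by rewrite eq_sym.
  by rewrite toward_aut // kP //; have [] := towardP hT zv.
have glK k k' : k z = z -> (forall u, adj z u -> P (k u) = P u) ->
    cancel k k' -> cancel (gl k) (gl k').
  move=> kz kP kK v; rewrite /gl.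
  case c : ((v != z) && P (toward hT v z)); last by rewrite c.
  by rewrite br // c kK.
have Vz : autV g z = z by rewrite /= -{1}gz aut_funK.
have VP u : adj z u -> P (autV g u) = P u.
  move=> zu; rewrite -[in RHS](aut_invK g u) gP //.
  by rewrite -{1}Vz (aut_inv_adj g).
have glz k : gl k z = z by rewrite /gl eqxx.
have gla k : k z = z -> (forall u, adj z u -> P (k u) = P u) ->
    forall v w, adj v w -> adj (gl k v) (gl k w).
  move=> kz kP v w vw; case: (eqVneq v z) vw => [->|vz] vw.
    rewrite glz /gl; case: ifP => // _.
    by rewrite -kz aut_adj.
  case: (eqVneq w z) vw => [->|wz] vw.
    rewrite glz /gl; case: ifP => // _.
    by rewrite -kz aut_adj.
  rewrite /gl vz wz /= (toward_branch hT vw) //.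
  by case: ifP => //; rewrite aut_adj.
have K1 : cancel (gl g) (gl (autV g)) by apply: glK => // v; rewrite /= aut_funK.
have K2 : cancel (gl (autV g)) (gl g) by apply: glK => // v; rewrite /= aut_invK.
have a1 := gla _ gz gP; have a2 := gla _ Vz VP.
have gadj v w : adj (gl g v) (gl g w) = adj v w.
  by apply/idP/idP => [/a2|/a1 //]; rewrite !K1.
by exists (Defs.Aut K1 K2 gadj).
Qed.

Lemma toward_closer x y v : adj x y ->
  (v != x) && (toward hT v x == y) = (dist hT v y < dist hT v x)%N.
Proof.
move=> xy; apply/idP/idP => [/andP[vx /eqP <-]|le].
  have xv : x != v by rewrite eq_sym.
  by have [_ ->] := towardP hT xv.
apply/andP; split; last by rewrite (toward_eq xy) // ltnW.
by apply: contraTneq le => ->; rewrite distxx.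
Qed.

Lemma closer_adj x y v : adj x y ->
  (dist hT v y < dist hT v x)%N = ~~ (dist hT v x < dist hT v y)%N.
Proof.
by move=> xy; case: (dist_adj hT v xy) => ->; rewrite ltnSn [(_.+1 < _)%N]ltnNge leqnSn.
Qed.

(** Tits' independence property for an edge: the action of [k] is cut at the edge, with one factor
    for each half-tree. *)
Lemma edge_split k x y : adj x y -> k x = x -> k y = y ->
  exists g h, [/\ k = (h * g)%g,
    forall v, (dist hT v x < dist hT v y)%N -> g v = v &
    forall v, (dist hT v y < dist hT v x)%N -> h v = v].
Proof.
move=> xy kx ky.
have [|g gP] := @ex_glue k x (pred1 y) kx.
  by move=> u xu /=; rewrite -{1}ky (inj_eq (@aut_inj k)).
have {}gP v : g v = if (dist hT v y < dist hT v x)%N then k v else v.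
  by rewrite gP /= toward_closer.
exists g, (k * g^-1)%g; rewrite mulgKV; split=> // [v vx|v vy].
  by rewrite gP (closer_adj v xy) vx.
have ginv : (g^-1)%g v = autV k v.
  apply: (@aut_inj g); rewrite [LHS](aut_invK g v) gP.
  have e u : dist hT (autV k v) u = dist hT v (k u).
    by rewrite -[u in LHS](aut_funK k) (dist_aut hT (autV k)).
  by rewrite !e kx ky vy [RHS](aut_invK k v).
by change (k ((g^-1)%g v) = v); rewrite ginv [LHS](aut_invK k v).
Qed.

Variables (d : nat) (nb : V -> 'I_d -> V) (hnb : coloring adj nb).

(** The colour automorphism that fixes [z] and transposes [i] and [j] is kept on these two branches
    and glued to the identity. Its square fixes [z] and all colours, hence is the identity. *)
Lemma ex_swap z (i j : 'I_d) : exists h : tree_aut adj,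
  [/\ h z = z, h (nb z i) = nb z j, h (nb z j) = nb z i, h \o h =1 id &
  forall v, toward hT v z != nb z i -> toward hT v z != nb z j -> h v = v].
Proof.
have hd : (0 < d)%N by apply: leq_ltn_trans (ltn_ord i).
have [g [gz gn]] := ex_colored_aut hT hnb hd (tperm i j) z z.
have nbz l := nb_adj hnb z l.
have gP u : adj z u -> pred2 (nb z i) (nb z j) (g u) = pred2 (nb z i) (nb z j) u.
  move=> /(nb_surj hnb)[l <-] /=; rewrite gn gz !(inj_eq (nb_inj hnb (v:=z))).
  by case: tpermP => [->|->|/eqP/negPf -> /eqP/negPf -> //]; rewrite !eqxx orbT.
have [h hP] := ex_glue gz gP.
have tz l : toward hT (nb z l) z = nb z l by rewrite toward_adj ?nbz.
have nz l : nb z l != z by rewrite eq_sym (adj_neq hT).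
exists h; split.
- by rewrite hP eqxx.
- by rewrite hP tz nz /= eqxx gn gz tpermL.
- by rewrite hP tz nz /= eqxx orbT gn gz tpermR.
- have gg v : g (g v) = v.
    apply: (@colored_ext _ _ hT _ _ hnb 1%g z (g \o g) id) => [|w l|w l] /=.
    + by rewrite !gz.
    + by rewrite !gn tpermK perm1.
    + by rewrite perm1.
  move=> v /=; rewrite (hP v); case: ifP => c; last by rewrite hP c.
  move: c => /andP[vz Pv].
  have zv : z != v by rewrite eq_sym.
  have -> := hP (g v); have -> : (g v != z) by rewrite -gz (inj_eq (@aut_inj g)).
  have -> : toward hT (g v) z = g (toward hT v z) by rewrite -{1}gz toward_aut.
  by rewrite gP ?Pv ?gg //; have [] := towardP hT zv.
by move=> v /negPf vi /negPf vj; rewrite hP /= vi vj andbF.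
Qed.

End Glue.

Section Balls.
Variables (V : choiceType) (adj : rel V) (hT : is_tree adj).
Variables (d : nat) (nb : V -> 'I_d -> V) (hnb : coloring adj nb) (o : V).

Fixpoint tree_ball n : seq V :=
  if n is m.+1 then
    tree_ball m ++ [seq nb v i | v <- tree_ball m, i <- enum 'I_d] else [:: o].

Lemma mem_tree_ball n v : (v \in tree_ball n) = (dist hT o v <= n)%N.
Proof.
elim: n v => [|n IH] v /=; first by rewrite inE leqn0 dist_eq0 eq_sym.
rewrite mem_cat IH; apply/orP/idP => [[le|]|le]; first exact: leqW.
  case/allpairsP => -[w i] /= [+ _ ->]; rewrite IH -ltnS.
  by apply: leq_trans; apply: dist_adjS; exact: (nb_adj hnb).
case: (leqP (dist hT o v) n) => lt; [by left|right].
have vo : v != o.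
  by apply: contraTneq lt => ->; rewrite distxx.
have [vt dt] := towardP hT vo.
have [i iv] : exists i, nb (toward hT o v) i = v.
  by apply: (nb_surj hnb); have [-> _ _ _ _] := hT.
apply/allpairsP; exists (toward hT o v, i) => /=; split=> //.
  by rewrite IH -ltnS -dt.
by rewrite mem_enum.
Qed.

End Balls.

(** * A hyperbolic translation and its two half-trees *)

Section Translation.
Variables (V : choiceType) (adj : rel V) (hT : is_tree adj).
Variables (d : nat) (nb : V -> 'I_d -> V) (hnb : coloring adj nb).
Variables (c0 c1 c2 : 'I_d) (o : V).
Hypotheses (c01 : c0 != c1) (c02 : c0 != c2) (c12 : c1 != c2).
Let y := nb o c0.

Let oy : adj o y. Proof. exact: nb_adj hnb _ _. Qed.

Definition swapping z (i j : 'I_d) (h : tree_aut adj) : Prop :=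
  [/\ h z = z, h (nb z i) = nb z j, h (nb z j) = nb z i, h \o h =1 id &
  forall v, toward hT v z != nb z i -> toward hT v z != nb z j -> h v = v].

Definition flipping (t : tree_aut adj) : Prop :=
  [/\ t o = y, forall v i, t (nb v i) = nb (t v) i & t \o t =1 id].

Lemma ex_flip : exists t, flipping t.
Proof.
have hd : (0 < d)%N by apply: leq_ltn_trans (ltn_ord c0).
have [t [ty tn]] := ex_colored_aut hT hnb hd 1%g o y.
exists t; split=> // [v i|]; first by rewrite tn perm1.
apply: (@colored_ext _ _ hT _ _ hnb 1%g o (t \o t) id) => [|w l|w l] /=.
+ by rewrite ty tn ty perm1 /y (nbK hnb).
+ by rewrite !tn !perm1.
+ by rewrite perm1.
Qed.

Variables (k t : tree_aut adj) (hk : swapping o c0 c1 k) (ht : flipping t).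

Let a := (k * t)%g.

Let aE v : a v = k (t v). Proof. by []. Qed.
Let kK v : k (k v) = v. Proof. by case: hk => _ _ _ /(_ v). Qed.
Let tK v : t (t v) = v. Proof. by case: ht => _ _ /(_ v). Qed.
Let to : t o = y. Proof. by case: ht. Qed.
Let ty : t y = o. Proof. by rewrite -to tK. Qed.
Let ko : k o = o. Proof. by case: hk. Qed.
Let ky : k y = nb o c1. Proof. by case: hk. Qed.
Let ay : a y = o. Proof. by rewrite aE ty ko. Qed.
Let ao : a o = nb o c1. Proof. by rewrite aE to ky. Qed.
Let aV v : a^-1%g v = t (k v).
Proof.
apply: (@aut_inj _ _ a); rewrite [RHS]aE tK kK.
exact: (aut_invK a).
Qed.

(** The half-tree on the side of [o] when the edge to [y] is cut. The translation [a] takes [y] to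
    [o] and [o] to [nb o c1], so it moves towards this side. *)
Definition front v := (dist hT v o < dist hT v y)%N.

Lemma frontN v : ~~ front v = (dist hT v y < dist hT v o)%N.
Proof. by rewrite (closer_adj hT v oy). Qed.

Lemma front_flip v : front (t v) = ~~ front v.
Proof.
have e u : dist hT (t v) u = dist hT v (t u).
  by rewrite -[u in LHS]tK (dist_aut hT t).
by rewrite frontN /front !e to ty.
Qed.

Let c1y : nb o c1 != y.
Proof. by rewrite (inj_eq (nb_inj hnb (v:=o))) eq_sym. Qed.

Lemma front_translate v : front v -> front (a v).
Proof.
rewrite /front -(dist_aut hT a v o) -(dist_aut hT a v y) ao ay => lt.
have oc : adj o (nb o c1) := nb_adj hnb _ _.
have tw : toward hT (a v) o = nb o c1.
  by apply: toward_eq => //; exact: ltnW.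
by rewrite (dist_adj_far oy) // tw.
Qed.

Lemma front_translateX v n : front v -> front (iter n a v).
Proof. by move=> fv; elim: n => //= n; exact: front_translate. Qed.

(** As long as [a v] is still behind the edge, it is nearer to [o] than [v] was: its distance to
    [a o = nb o c1] exceeds its distance to [o] by one. *)
Lemma ex_front v n : (dist hT v o <= n)%N -> front (iter n a v).
Proof.
elim: n v => [|n IH] v le.
  move: le; rewrite leqn0 dist_eq0 => /eqP ->.
  by rewrite /= /front distxx lt0n dist_eq0 (adj_neq hT).
rewrite iterSr; case: (boolP (front (a v))) => [|nf]; first exact: front_translateX.
apply: IH; rewrite -ltnS; apply: leq_trans le.
have oc : adj o (nb o c1) := nb_adj hnb _ _.
rewrite -(dist_aut hT a v o) ao (dist_adj_far oc) //.
have -> : toward hT (a v) o = y by apply: toward_eq => //; rewrite ltnW // -frontN.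
by rewrite eq_sym.
Qed.

(** The flip [t] conjugates [a] to its inverse; statements on forward translation thus yield those
    on backward translation. *)
Lemma iterV v n : iter n (a^-1)%g v = t (iter n a (t v)).
Proof.
elim: n v => [|n IH] v; first by rewrite /= tK.
by rewrite iterS IH aV.
Qed.

Lemma ex_back v n : (dist hT v y <= n)%N -> ~~ front (iter n (a^-1)%g v).
Proof.
move=> le; rewrite iterV front_flip negbK; apply: ex_front.
by rewrite -(dist_aut hT t) tK to.
Qed.

Variables (s : tree_aut adj) (hs : swapping o c1 c2 s).

Let s_back v : ~~ front v -> s v = v.
Proof.
rewrite frontN => lt; case: hs => _ _ _ _; apply.
- by rewrite (toward_eq oy (ltnW lt)) (inj_eq (nb_inj hnb (v:=o))).
by rewrite (toward_eq oy (ltnW lt)) (inj_eq (nb_inj hnb (v:=o))).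
Qed.

(** [s] moves only the branches [c1] and [c2] at [o]. One backward step takes [nb o c1] to [o], [o]
    to [y] and [nb o c2] behind the edge, and further steps stay outside these branches. At [n = 0]
    the claim fails, as [s] exchanges [nb o c1] and [nb o c2]. *)
Lemma swap_shift n v : (0 < n)%N -> [\/ v = o, v = nb o c1 | v = nb o c2] ->
  s (iter n (a^-1)%g v) = iter n (a^-1)%g v.
Proof.
have fy : ~~ front y by rewrite frontN distxx lt0n dist_eq0 eq_sym (adj_neq hT oy).
have back u m : ~~ front u -> ~~ front (iter m (a^-1)%g u).
  by move=> nf; rewrite iterV front_flip negbK front_translateX // front_flip.
have fo m : s (iter m (a^-1)%g o) = iter m (a^-1)%g o.
  case: m => [|m]; first by case: hs.
  by rewrite iterSr aV ko to; apply/s_back/back.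
have oN c : nb o c != o by rewrite eq_sym (adj_neq hT (nb_adj hnb _ _)).
case: n => // n _ [] ->; first exact: fo.
  by rewrite iterSr aV -ky kK ty; exact: fo.
rewrite iterSr aV; apply/s_back/back.
have -> : k (nb o c2) = nb o c2.
  case: hk => _ _ _ _; apply; rewrite toward_adj ?(nb_adj hnb) //.
    by rewrite (inj_eq (nb_inj hnb (v:=o))) eq_sym.
  by rewrite (inj_eq (nb_inj hnb (v:=o))) eq_sym.
rewrite front_flip negbK /front (dist_adj_far oy) //.
by rewrite toward_adj ?(nb_adj hnb) // (inj_eq (nb_inj hnb (v:=o))) eq_sym.
Qed.

End Translation.

Section EdgeMove.
Variables (V : choiceType) (adj : rel V) (hT : is_tree adj).
Variables (d : nat) (nb : V -> 'I_d -> V) (hnb : coloring adj nb).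

(** The branches at [x] through [u] and [w] point away from [o]; swapping them fixes [o], and also
    [y], which is either [x] or in the branch of [o]. *)
Lemma edge_fixing_move o y x u w : adj o y -> x != o -> adj x u -> adj x w ->
  toward hT o x != u -> toward hT o x != w ->
  exists h : tree_aut adj, [/\ h o = o, h y = y, h x = x & h u = w].
Proof.
move=> oy xo /(nb_surj hnb)[i <-] /(nb_surj hnb)[j <-] ti tj.
have [h [hx hi _ _ hfix]] := ex_swap hT hnb x i j.
have ho : h o = o by apply: hfix.
exists h; split=> //.
case: (eqVneq y x) => [-> //|yx].
have yo : adj y o by have [-> _ _ _ _] := hT.
by apply: hfix; rewrite (toward_branch hT yo yx) // eq_sym.
Qed.

End EdgeMove.

Import Order.TTheory GRing.Theory Num.Theory.
Import numFieldNormedType.Exports.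
Local Open Scope classical_set_scope.
Local Open Scope ring_scope.

(** * Real symmetric forms of finite negative index *)

Definition sym_bilinear (R : realType) (H : lmodType R) (b : H -> H -> R) : Prop :=
  (forall v w, b v w = b w v) /\
  (forall r u v w, b (r *: u + v) w = r * b u w + b v w).

Section SymBilinear.
Variables (R : realType) (H : lmodType R) (b : H -> H -> R).
Hypothesis hb : sym_bilinear b.
Implicit Types (u v w : H) (r : R).

Lemma symC v w : b v w = b w v. Proof. by case: hb. Qed.
Lemma sym0l w : b 0 w = 0.
Proof.
by case: hb => _ /(_ 1 0 0 w); rewrite scaler0 addr0 mul1r => /eqP; rewrite -subr_eq0 opprD addNKr oppr_eq0 => /eqP.
Qed.
Lemma symDl u v w : b (u + v) w = b u w + b v w.
Proof. by case: hb => _ /(_ 1 u v w); rewrite scale1r mul1r. Qed.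
Lemma symZl r v w : b (r *: v) w = r * b v w.
Proof. by case: hb => _ /(_ r v 0 w); rewrite addr0 sym0l addr0. Qed.
Lemma symNl v w : b (- v) w = - b v w.
Proof. by rewrite -scaleN1r symZl mulN1r. Qed.
Lemma symBl u v w : b (u - v) w = b u w - b v w.
Proof. by rewrite symDl symNl. Qed.
Lemma sym0r w : b w 0 = 0. Proof. by rewrite symC sym0l. Qed.
Lemma symDr u v w : b w (u + v) = b w u + b w v.
Proof. by rewrite symC symDl !(symC w). Qed.
Lemma symZr r v w : b w (r *: v) = r * b w v.
Proof. by rewrite symC symZl (symC w). Qed.
Lemma symNr v w : b w (- v) = - b w v.
Proof. by rewrite symC symNl (symC w). Qed.
Lemma symBr u v w : b w (u - v) = b w u - b w v.
Proof. by rewrite symDr symNr. Qed.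
Lemma sym_suml I (s : seq I) P (F : I -> H) w :
  b (\sum_(i <- s | P i) F i) w = \sum_(i <- s | P i) b (F i) w.
Proof. by elim/big_rec2: _ => [|i x v _ <-]; rewrite ?sym0l ?symDl. Qed.
Lemma sym_sumr I (s : seq I) P (F : I -> H) w :
  b w (\sum_(i <- s | P i) F i) = \sum_(i <- s | P i) b w (F i).
Proof. by rewrite symC sym_suml; apply: eq_bigr => i _; rewrite symC. Qed.

Definition symE := (symDl, symDr, symNl, symNr, symZl, symZr).

Lemma sym_CS (W : set H) : (forall v, W v -> 0 <= b v v) ->
  (forall r v w, W v -> W w -> W (r *: v + w)) ->
  forall v w, W v -> W w -> b v w ^+ 2 <= b v v * b w w.
Proof.
move=> pos sub v w Wv Ww.
have q r : 0 <= r ^+ 2 * b v v + 2 * r * b v w + b w w.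
  have := pos _ (sub r _ _ Wv Ww); rewrite !symE (symC w v); nra.
have [v0|v0] := eqVneq (b v v) 0.
  rewrite v0 mul0r; have [->|vw0] := eqVneq (b v w) 0; first by rewrite expr0n.
  have := q (- (b w w + 1) / (2 * b v w)); rewrite v0.
  have -> : 2 * (- (b w w + 1) / (2 * b v w)) * b v w = - (b w w + 1) by field.
  lra.
have vp : 0 < b v v by rewrite lt_def v0 pos.
have := q (- (b v w) / b v v).
have -> : (- b v w / b v v) ^+ 2 * b v v + 2 * (- b v w / b v v) * b v w + b w w
  = (b v v * b w w - b v w ^+ 2) / b v v by field.
by rewrite pmulr_lge0 ?invr_gt0 // subr_ge0.
Qed.

(** Nonnegativity on the common kernel of the functionals [b _ f] would express the same idea; as an
    inequality it makes [b] plus a sum of squares positive semidefinite, so that Cauchy-Schwarz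
    applies. *)
Definition finite_negative_index : Prop :=
  exists fs : seq H, forall v, 0 <= b v v + \sum_(f <- fs) b v f ^+ 2.

(** Gram-Schmidt for a negative definite form, dropping dependent vectors. The second clause is
    orthonormality up to sign, tested against an arbitrary [v]: exactly what makes
    [v + \sum_(f <- fs) b v f *: f] orthogonal to every [f]. *)
Lemma neg_orthonormal (N : set H) (gs : seq H) :
  (forall r v w, N v -> N w -> N (r *: v + w)) ->
  (forall v, N v -> v != 0 -> b v v < 0) -> (forall g, g \in gs -> N g) -> N 0 ->
  exists fs : seq H, [/\ forall f, f \in fs -> N f,
    forall v f', f' \in fs -> \sum_(f <- fs) b v f * b f f' = - b v f' &
    forall v, (forall f, f \in fs -> b v f = 0) -> forall g, g \in gs -> b v g = 0].
Proof.
move=> sub neg gsN N0; elim: gs gsN => [|g gs IH] gsN; first by exists [::].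
have {IH}[|fs [fN fO fs_span]] := IH.
  by move=> h hgs; apply: gsN; rewrite inE hgs orbT.
have Nsum (c : H -> R) (s : seq H) : (forall f, f \in s -> N f) ->
    N (\sum_(f <- s) c f *: f).
  elim: s => [|f s IHs] sN; first by rewrite big_nil.
  rewrite big_cons; apply: sub; first by apply: sN; rewrite inE eqxx.
  by apply: IHs => h hs; apply: sN; rewrite inE hs orbT.
pose g' := g + \sum_(f <- fs) b g f *: f.
have g'E v : (forall f, f \in fs -> b v f = 0) -> b v g' = b v g.
  move=> vf; rewrite symDr sym_sumr big_seq big1 ?addr0 // => f ffs.
  by rewrite symZr vf // mulr0.
have g'N : N g'.
  rewrite /g' -[g in g + _]scale1r; apply: sub; first by apply: gsN; rewrite inE eqxx.
  exact: Nsum.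
have g'f f : f \in fs -> b g' f = 0.
  move=> ffs; rewrite symDl sym_suml.
  under eq_bigr do rewrite symZl.
  by rewrite fO // subrr.
have [g'0|g'0] := eqVneq g' 0.
  exists fs; split=> // v vf h; rewrite inE => /orP[/eqP ->|]; last exact: fs_span.
  by rewrite -g'E // g'0 sym0r.
have lt := neg _ g'N g'0.
pose c := Num.sqrt (- b g' g'); have cp : 0 < c by rewrite sqrtr_gt0 oppr_gt0.
pose f0 := c^-1 *: g'.
have f00 : b f0 f0 = -1.
  have : c ^+ 2 = - b g' g' by rewrite sqr_sqrtr // oppr_ge0 ltW.
  move=> c2; have -> : b f0 f0 = c^-1 * (c^-1 * b g' g') by rewrite symZl symZr.
  have -> : b g' g' = - c ^+ 2 by rewrite c2 opprK.
  by field; rewrite gt_eqF.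
have f0f f : f \in fs -> b f0 f = 0 by move=> /g'f e; rewrite symZl e mulr0.
exists (f0 :: fs); split=> [f|v f'|v vf h].
- rewrite inE => /orP[/eqP ->|/fN //].
  by rewrite /f0 -[_ *: _]addr0; exact: sub.
- rewrite inE big_cons => /orP[/eqP ->|f'fs].
    rewrite f00 mulrN1 big_seq big1 ?addr0 // => f ffs.
    by rewrite (symC f) f0f // mulr0.
  by rewrite f0f // mulr0 add0r fO.
have vf' f : f \in fs -> b v f = 0 by move=> ffs; apply: vf; rewrite inE ffs orbT.
rewrite inE => /orP[/eqP ->|]; last exact: fs_span.
have := vf f0; rewrite inE eqxx => /(_ isT) /eqP.
by rewrite symZr mulf_eq0 invr_eq0 gt_eqF //= g'E // => /eqP.
Qed.

Lemma finite_negative_indexI (N : set H) (gs : seq H) :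
  (forall r v w, N v -> N w -> N (r *: v + w)) ->
  (forall v, N v -> v != 0 -> b v v < 0) -> (forall g, g \in gs -> N g) -> N 0 ->
  (forall v, (forall g, g \in gs -> b v g = 0) -> 0 <= b v v) ->
  finite_negative_index.
Proof.
move=> sub neg gsN N0 pos.
have [fs [fN fO fspan]] := neg_orthonormal sub neg gsN N0.
exists fs => v; pose v' := v + \sum_(f <- fs) b v f *: f.
have v'f f : f \in fs -> b v' f = 0.
  move=> ffs; rewrite symDl sym_suml.
  under eq_bigr do rewrite symZl.
  by rewrite fO // subrr.
have := pos v' (fspan _ v'f).
have -> : b v' v' = b v' v.
  rewrite {2}/v' symDr sym_sumr big_seq big1 ?addr0 // => f ffs.
  by rewrite symZr v'f // mulr0.
rewrite symDl sym_suml.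
by under eq_bigr do rewrite symZl (symC _ v) -expr2.
Qed.

(** Diagonal dominance: by $2|x_ix_j|\le x_i^2+x_j^2$ the off-diagonal terms cost at most
    [eps * n%:R] times the sum of the squares. *)
Lemma nearly_orthogonal_neg (n : nat) (v : 'I_n -> H) (eps del : R) (x : 'I_n -> R) :
  (forall i, b (v i) (v i) = - del) ->
  (forall i j, i != j -> `|b (v i) (v j)| <= eps) ->
  0 <= eps -> eps * n%:R < del -> (exists i, x i != 0) ->
  let y := \sum_i x i *: v i in b y y < 0.
Proof.
have aux (D E X m : R) : - D * X + E * ((X * m + X * m) / 2) = (E * m - D) * X.
  by field.
move=> vd vo e0 ed [i0 xi0] /=.
have bE : b (\sum_i x i *: v i) (\sum_i x i *: v i)
    = \sum_i \sum_j x i * x j * b (v i) (v j).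
  rewrite sym_suml; apply: eq_bigr => i _; rewrite symZl sym_sumr mulr_sumr.
  by apply: eq_bigr => j _; rewrite symZr mulrA.
have le i j : x i * x j * b (v i) (v j) <=
    (if j == i then - del * x i ^+ 2 else 0) + eps * ((x i ^+ 2 + x j ^+ 2) / 2).
  case: (eqVneq j i) => [->|]; first by rewrite vd; nra.
  rewrite eq_sym => /vo.
  rewrite ler_norml => /andP[l1 l2]; rewrite add0r.
  have h1 : 0 <= (x i - x j) ^+ 2 by exact: sqr_ge0.
  have h2 : 0 <= (x i + x j) ^+ 2 by exact: sqr_ge0.
  nra.
pose X := \sum_i x i ^+ 2.
have Xp : 0 < X.
  rewrite /X (bigD1 i0) //= ltr_wpDr ?sumr_ge0 // => [i _|]; first exact: sqr_ge0.
  by rewrite exprn_even_gt0.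
rewrite bE; apply: (@le_lt_trans _ _ ((eps * n%:R - del) * X)); last first.
  by rewrite nmulr_rlt0 // subr_lt0.
apply: (le_trans (ler_sum _ (fun i _ => ler_sum _ (fun j _ => le i j)))).
under eq_bigr do rewrite big_split /= -big_mkcond /= big_pred1_eq -mulr_sumr.
rewrite big_split /= -!mulr_sumr.
under [X in _ + _ * X]eq_bigr do rewrite -mulr_suml big_split /= sumr_const card_ord.
rewrite -mulr_suml big_split /= sumr_const card_ord.
by rewrite sumrMnl -/X -!(mulr_natr X) aux.
Qed.

(** With [r] functionals in the index inequality, [r.+1] widely spaced translates of [u] are nearly
    orthogonal and negative. Some nonzero combination is killed by all the functionals, so its
    square would be both negative and nonnegative. *)
Lemma no_decay_of_neg (T : H -> H) (u : H) :
  finite_negative_index -> (forall v w, b (T v) (T w) = b v w) -> b u u < 0 ->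
  ~ (b (iter n T u) u @[n --> \oo] --> (0 : R)).
Proof.
move=> [fs FI] TB uneg /cvgrPdist_le lim.
(* The denominator [r.+2] gives [eps * r.+1 < del], as required for [r.+1] vectors. *)
pose r := size fs; pose del := - b u u; pose eps := del / (r.+2)%:R.
have del0 : 0 < del by rewrite oppr_gt0.
have eps0 : 0 < eps by rewrite divr_gt0.
have [N _ limN] := lim _ eps0.
have TiB n v w : b (iter n T v) (iter n T w) = b v w.
  by elim: n => //= n IH; rewrite TB.
pose v (i : 'I_r.+1) := iter (N.+1 * i) T u.
have vo i j : i != j -> `|b (v i) (v j)| <= eps.
  wlog lt : i j / (j < i)%N => [hw|] ij.
    case: (ltngtP i j) => [lt|lt|e]; first by rewrite symC hw // eq_sym.
      exact: hw.
    by move: ij; rewrite -val_eqE /= e eqxx.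
  rewrite /v -(subnKC (ltnW lt)) mulnDr iterD TiB.
  have := limN (N.+1 * (i - j))%N; rewrite /= sub0r normrN; apply.
  by rewrite (leq_trans (leqnSn N)) // leq_pmulr // subn_gt0.
pose A : 'M[R]_(r.+1, r) := \matrix_(i, j) b (v i) (fs`_j).
have : kermx A != 0.
  rewrite -mxrank_eq0 mxrank_ker -lt0n subn_gt0.
  by rewrite (leq_ltn_trans (rank_leq_col A)).
case/rowV0Pn => x /sub_kermxP xA x0.
have [i0 xi0] : exists i, x 0 i != 0.
  apply/existsP; apply: contraNT x0; rewrite negb_exists => /forallP x0.
  by apply/eqP/rowP => i; rewrite mxE; apply/eqP; rewrite -[_ == _]negbK x0.
have /= := @nearly_orthogonal_neg r.+1 v eps del (x 0).
move=> /(_ _ vo (ltW eps0)); set y := \sum_i _ => yneg.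
have : b y y < 0.
  apply: yneg; last by exists i0.
    by move=> i; rewrite /v TiB /del opprK.
  by rewrite /eps mulrAC -mulrA gtr_pMr // ltr_pdivrMr // mul1r ltr_nat.
apply/negP; rewrite -leNgt; have := FI y.
rewrite big_seq big1 ?addr0 // => f ffs.
have fj : (index f fs < r)%N by rewrite index_mem.
have := congr1 (fun M : 'rV_r => M 0 (Ordinal fj)) xA.
rewrite !mxE => e; have -> : b y f = 0; last by rewrite expr0n.
rewrite /y sym_suml -[RHS]e; apply: eq_bigr => i _.
by rewrite symZl mxE /= nth_index.
Qed.

End SymBilinear.

(** * Hermitian forms over the reals, complexes and quaternions *)

Section ScalarTheory.
Variables (R : realType) (k : scalar_kind).
Local Notation K := (kscalar R k).
Implicit Types (x y : K) (r : R).

Lemma kreD x y : kre (x + y) = kre x + kre y.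
Proof. by case: k x y => [x y|[? ?] [? ?]|[? ? ? ?] [? ? ? ?]]. Qed.

Lemma kre0 : kre (0 : K) = 0. Proof. by case: k. Qed.

Lemma kconjK : involutive (@kconj R k).
Proof.
case: k => [//|[a b]|[a b c e]] /=; first by rewrite opprK.
by rewrite !opprK.
Qed.

Lemma kconjD x y : kconj (x + y) = kconj x + kconj y.
Proof.
case: k x y => [//|[a b] [a' b']|[a b c e] [a' b' c' e']].
  by rewrite /kconj /=; simpc.
by congr Quat; rewrite ?opprD.
Qed.

Lemma kconjM x y : kconj (x * y) = kconj y * kconj x.
Proof.
case: k x y => [x y|[a b] [a' b']|[a b c e] [a' b' c' e']].
- exact: mulrC.
- by rewrite /kconj /=; simpc; congr Complex; ring.
by congr Quat; ring.
Qed.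

Lemma kconj_real r : kconj (kreal k r) = kreal k r.
Proof. by case: k; rewrite //= oppr0. Qed.

Lemma kre_conj x : kre (kconj x) = kre x.
Proof. by case: k x => [x|[? ?]|[? ? ? ?]]. Qed.

Lemma kconj_id x : kconj x = x -> x = kreal k (kre x).
Proof.
case: k x => [//|[a b] [bb]|[a b c e] [bb cc ee]] /=.
  by congr Complex; lra.
by congr Quat; lra.
Qed.

Lemma kreal_mulC r x : kreal k r * x = x * kreal k r.
Proof.
case: k x => [x|[a b]|[a b c e]].
- exact: mulrC.
- by rewrite /kreal /=; simpc; congr Complex; ring.
by congr Quat; ring.
Qed.

Lemma kre_realM r x : kre (kreal k r * x) = r * kre x.
Proof.
case: k x => [//|[a b]|[a b c e]] /=; first by rewrite mul0r subr0.
by ring.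
Qed.

Lemma krealM r s : kreal k (r * s) = kreal k r * kreal k s.
Proof.
case: k => [//||] /=; first by simpc; congr Complex; ring.
by congr Quat; ring.
Qed.

Lemma kreal1 : kreal k (1 : R) = 1. Proof. by case: k. Qed.

Lemma kre_mulC x y : kre (x * y) = kre (y * x).
Proof.
case: k x y => [x y|[a b] [a' b']|[a b c e] [a' b' c' e']] /=; last by ring.
  exact: mulrC.
by ring.
Qed.

Lemma kabs_ge0 x : 0 <= kabs x. Proof. exact: sqrtr_ge0. Qed.

Lemma sqr_kabs x : kabs x ^+ 2 = kre (kconj x * x).
Proof.
rewrite sqr_sqrtr //; case: k x => [x|[a b]|[a b c e]] /=.
- by rewrite -expr2 sqr_ge0.
- nra.
- nra.
Qed.

Lemma kre_le_kabs x : `|kre x| <= kabs x.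
Proof.
rewrite -[X in X <= _]sqrtr_sqr; apply: ler_wsqrtr.
case: k x => [x|[a b]|[a b c e]] /=.
- by rewrite expr2.
- nra.
- nra.
Qed.

Lemma kmul_conj x : x * kconj x = kreal k (kabs x ^+ 2).
Proof.
rewrite sqr_kabs kre_mulC; apply: kconj_id; rewrite kconjM kconjK //.
Qed.

Lemma kabs_eq0 x : kabs x = 0 -> x = 0.
Proof.
move=> x0; have : kabs x ^+ 2 = 0 by rewrite x0 expr0n.
rewrite sqr_kabs; case: k x {x0} => [x|[a b]|[a b c e]] /=.
- by move/eqP; rewrite mulf_eq0 orbb => /eqP.
- move=> e0; have -> : a = 0 by nra.
  by have -> : b = 0 by nra.
move=> e0.
have -> : a = 0 by nra.
have -> : b = 0 by nra.
have -> : c = 0 by nra.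
by have -> : e = 0 by nra.
Qed.

Lemma kinv x : x != 0 -> exists y, x * y = 1.
Proof.
move=> x0; exists (kconj x * kreal k (kabs x ^- 2)).
have a0 : kabs x != 0 by apply: contra_neq x0 => /kabs_eq0.
by rewrite mulrA kmul_conj -krealM divff ?kreal1 // expf_neq0.
Qed.

(* A real basis of K that is orthonormal for the form Re (conj x * y). *)
Definition kunits : seq K :=
  match k return seq (kscalar R k) with
  | Reals => [:: 1]
  | Complexes => [:: 1; Complex 0 1]
  | Quaternions => [:: 1; Quat 0 1 0 0; Quat 0 0 1 0; Quat 0 0 0 1]
  end.

Lemma kunits_span x : x = \sum_(c <- kunits) c * kreal k (kre (kconj c * x)).
Proof.
rewrite /kunits; case: k x => [x|[a b]|[a b c e]].
- by rewrite big_seq1 /= !mul1r.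
- rewrite big_cons big_seq1 /kre /kconj /kreal; simpc => /=.
  by congr Complex; ring.
by rewrite !big_cons big_nil; congr Quat; rewrite /=; ring.
Qed.

End ScalarTheory.

(** * Closed subspaces and Cauchy-Schwarz over the three kinds of scalars *)

Section Closed.
Variables (R : realType) (H : normedModType R).

Lemma closure_approx (A : set H) v :
  closure A v <-> forall e : R, 0 < e -> exists2 w, A w & `|v - w| < e.
Proof.
split=> [cl e e0|app B].
  have [w [Aw /= vw]] := cl _ (nbhsx_ballx v _ e0).
  by exists w => //; move: vw; rewrite -ball_normE.
rewrite -nbhs_ballE => -[e /= e0 eB]; have [w Aw vw] := app e e0.
by exists w; split => //; apply: eB; rewrite -ball_normE.
Qed.

Lemma closed_approx (A : set H) :
  (forall v, (forall e : R, 0 < e -> exists2 w, A w & `|v - w| < e) -> A v) ->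
  closed A.
Proof. by move=> cA v /closure_approx; exact: cA. Qed.

Lemma norm_small_eq0 (v : H) (C : R) : (forall e : R, 0 < e -> `|v| <= C * e) -> v = 0.
Proof.
move=> small; apply/eqP; rewrite -normr_eq0; apply/negP => /negP v0.
have vp : 0 < `|v| by rewrite lt_def v0 normr_ge0.
have C0 : 0 < C.
  by have := small 1 ltr01; rewrite mulr1; exact: lt_le_trans.
have := small (`|v| / (2 * C)); rewrite divr_gt0 ?mulr_gt0 // => /(_ isT).
have -> : C * (`|v| / (2 * C)) = `|v| / 2 by field; rewrite gt_eqF.
lra.
Qed.

Lemma closed_zero (A : set H) (f : H -> H) (C : R) : closed A ->
  (forall u v, f (u - v) = f u - f v) -> (forall v, `|f v| <= C * `|v|) ->
  closed [set v | A v /\ f v = 0].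
Proof.
move=> cA fB fC; apply: closed_approx => v app; split.
  apply: cA; apply/closure_approx => e /app[w [Aw _] ?]; by exists w.
apply: (@norm_small_eq0 _ (`|C|)) => e /app[w [_ fw] vw].
rewrite -[f v]subr0 -fw -fB (le_trans (fC _)) //.
rewrite (le_trans (ler_wpM2r (normr_ge0 _) (ler_norm C))) //.
by rewrite ler_wpM2l // ltW.
Qed.

End Closed.

Section Hilbert.
Variables (R : realType) (k : scalar_kind) (H : hilbertType R k).
Local Notation K := (kscalar R k).
Implicit Types (u v w f : H) (a c : K) (r : R).

Lemma rmulZ r v a : (r *: v) *> a = r *: (v *> a).
Proof. by rewrite -!rmul_real -!rmulM kreal_mulC. Qed.

Lemma rmul1 v : v *> (1 : K) = v.
Proof. by rewrite -kreal1 rmul_real scale1r. Qed.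

Lemma rmul0 v : v *> (0 : K) = 0.
Proof.
have /eqP := rmulDr v (0 : K) 0.
by rewrite addr0 -subr_eq0 opprD addNKr oppr_eq0 => /eqP.
Qed.

Lemma rmul0l a : (0 : H) *> a = 0.
Proof.
have /eqP := rmulDl (0 : H) 0 a.
by rewrite addr0 -subr_eq0 opprD addNKr oppr_eq0 => /eqP.
Qed.

Lemma rmulNr v a : v *> (- a) = - (v *> a).
Proof. by apply/eqP; rewrite -addr_eq0 -rmulDr addNr rmul0. Qed.

Lemma rmulNl v a : (- v) *> a = - (v *> a).
Proof. by apply/eqP; rewrite -addr_eq0 -rmulDl addNr rmul0l. Qed.

Lemma innerBr u v w : inner u (v - w) = inner u v - inner u w :> K.
Proof.
have inner0 : inner u 0 = 0 :> K by rewrite -(rmul0l 0) innerMr mulr0.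
rewrite innerDr; congr (_ + _); apply/eqP.
by rewrite -addr_eq0 -innerDr addNr inner0.
Qed.

Lemma innerDl u v w : inner (u + v) w = inner u w + inner v w :> K.
Proof. by rewrite !(inner_conj w) -kconjD -innerDr. Qed.

Lemma innerMl v w a : inner (v *> a) w = kconj a * inner v w :> K.
Proof. by rewrite !(inner_conj w) -kconjM -innerMr. Qed.

Lemma inner_self v : inner v v = kreal k (`|v| ^+ 2).
Proof. by rewrite inner_norm; apply: kconj_id; rewrite -inner_conj. Qed.

Lemma norm_rmul v a : `|v *> a| = `|v| * kabs a.
Proof.
apply/eqP; rewrite -(eqrXn2 (n := 2)) ?mulr_ge0 ?kabs_ge0 //; apply/eqP.
rewrite inner_norm innerMl innerMr inner_self mulrA -kreal_mulC.
by rewrite -mulrA kre_realM -sqr_kabs exprMn.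
Qed.

Lemma inner_sym : sym_bilinear (fun v w => kre (inner v w) : R).
Proof.
split=> [v w|r u v w]; first by rewrite inner_conj kre_conj.
by rewrite innerDl kreD -rmul_real innerMl kconj_real kre_realM.
Qed.

Lemma inner_CS v w : kre (inner v w) <= `|v| * `|w|.
Proof.
have sq := @sym_CS _ _ _ inner_sym setT.
have {}sq : kre (inner v w) ^+ 2 <= (`|v| * `|w|) ^+ 2.
  by rewrite exprMn !inner_norm; apply: sq => // u _; rewrite -inner_norm sqr_ge0.
by rewrite (le_trans (ler_norm _)) // -(ler_pXn2r (n := 2)) ?nnegrE ?mulr_ge0 // real_normK ?num_real.
Qed.

(** The real inequality [inner_CS], applied after multiplying [v] by the scalar [inner v w], which
    makes the product real. *)
Lemma kabs_inner v w : kabs (inner v w : K) <= `|v| * `|w|.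
Proof.
have [->|x0] := eqVneq (kabs (inner v w : K)) 0; first by rewrite mulr_ge0.
have xp : 0 < kabs (inner v w : K) by rewrite lt_def x0 kabs_ge0.
rewrite -(ler_pM2r xp) -expr2 sqr_kabs -inner_conj -innerMr.
by rewrite (le_trans (inner_CS _ _)) // norm_rmul mulrA (mulrC `|w|).
Qed.

Lemma closed_line f : closed [set v | exists c : K, v = f *> c].
Proof.
have [->|f0] := eqVneq f 0.
  apply: closed_approx => v app; exists 0; rewrite rmul0l.
  apply: (@norm_small_eq0 _ _ _ 1) => e /app[w [c ->]].
  by rewrite rmul0l subr0 mul1r => /ltW.
have fp : 0 < `|f| by rewrite normr_gt0.
pose p v := `|f| ^- 2 *: (f *> (inner f v : K)).
have pf c : p (f *> c) = f *> c.
  by rewrite /p innerMr inner_self rmulM rmul_real rmulZ scalerA mulVf ?scale1r // expf_neq0 ?gt_eqF.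
have pB u v : p (u - v) = p u - p v.
  by rewrite /p innerBr rmulDr rmulNr scalerBr.
have ple v : `|p v| <= `|v|.
  rewrite normrZ norm_rmul normrV ?unitfE ?expf_neq0 ?gt_eqF // normrX normr_id.
  rewrite ler_pdivrMl ?exprn_gt0 // expr2 -mulrA ler_pM2l //.
  exact: kabs_inner.
apply: closed_approx => v app; exists (kreal k (`|f| ^- 2) * inner f v).
rewrite rmulM rmul_real rmulZ; apply/eqP; rewrite -subr_eq0; apply/eqP.
apply: (@norm_small_eq0 _ _ _ 2) => e /app[w [c wE] vw].
have -> : v - `|f| ^- 2 *: (f *> (inner f v : K)) = (v - w) - p (v - w).
  by rewrite pB /p -/(p w) wE pf opprB addrA subrK.
rewrite (le_trans (ler_normB _ _)) // mulr_natl mulr2n lerD ?ltW //.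
exact: le_lt_trans (ple _) vw.
Qed.

Section Subspace.
Variables (W : set H) (hW : ksubspace W).

Lemma ksub0 : W 0. Proof. by case: hW. Qed.
Lemma ksubD u v : W u -> W v -> W (u + v). Proof. by case: hW => _ + _; apply. Qed.
Lemma ksubM v a : W v -> W (v *> a). Proof. by case: hW => _ _; apply. Qed.
Lemma ksubZ r v : W v -> W (r *: v). Proof. by rewrite -rmul_real; exact: ksubM. Qed.
Lemma ksubN v : W v -> W (- v). Proof. by rewrite -scaleN1r; exact: ksubZ. Qed.
Lemma ksubB u v : W u -> W v -> W (u - v).
Proof. by move=> Wu Wv; apply: ksubD => //; exact: ksubN. Qed.
End Subspace.

Lemma closure_ksubspace (W : set H) : ksubspace W -> ksubspace (closure W).
Proof.
move=> hW; split.
- by apply: subset_closure; exact: ksub0.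
- move=> u v /closure_approx cu /closure_approx cv; apply/closure_approx => e e0.
  have e20 : 0 < e / 2 by rewrite divr_gt0.
  have [[u' Wu' uu'] [v' Wv' vv']] := (cu _ e20, cv _ e20).
  exists (u' + v'); first exact: ksubD.
  by rewrite opprD addrACA (splitr e) (le_lt_trans (ler_normD _ _)) // ltrD.
move=> v a /closure_approx cv; apply/closure_approx => e e0.
have ap : 0 < kabs a + 1 by rewrite ltr_wpDl ?kabs_ge0.
have [w Ww vw] := cv (e / (kabs a + 1)) (divr_gt0 e0 ap).
exists (w *> a); first exact: ksubM.
rewrite -rmulNl -rmulDl norm_rmul.
rewrite ltr_pdivlMr // in vw; apply: le_lt_trans vw.
by rewrite ler_wpM2l // lerDl.
Qed.

Lemma closure_stable (W : set H) (f : H -> H) : klinear f -> bounded_op f ->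
  (forall v, W v -> W (f v)) -> forall v, closure W v -> closure W (f v).
Proof.
move=> [fD fM] [C fC] fW v /closure_approx cv; apply/closure_approx => e e0.
have C0 : 0 < `|C| + 1 by rewrite ltr_wpDl.
have [w Ww vw] := cv (e / (`|C| + 1)) (divr_gt0 e0 C0).
exists (f w); first exact: fW.
have -> : f v - f w = f (v - w).
  by rewrite fD -[in RHS]scaleN1r -rmul_real fM rmul_real scaleN1r.
rewrite ltr_pdivlMr // mulrC in vw; apply: le_lt_trans vw.
rewrite (le_trans (fC _)) // ler_wpM2r //.
by rewrite (le_trans (ler_norm C)) // lerDl.
Qed.

Section KLinear.
Variables (f : H -> H) (hf : klinear f).

Lemma klinD u v : f (u + v) = f u + f v. Proof. by case: hf. Qed.
Lemma klinM v a : f (v *> a) = f v *> a. Proof. by case: hf. Qed.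
Lemma klinZ r v : f (r *: v) = r *: f v.
Proof. by rewrite -!rmul_real klinM. Qed.
Lemma klinN v : f (- v) = - f v. Proof. by rewrite -scaleN1r klinZ scaleN1r. Qed.
Lemma klinB u v : f (u - v) = f u - f v. Proof. by rewrite klinD klinN. Qed.
Lemma klin0 : f 0 = 0. Proof. by rewrite -(scale0r 0) klinZ !scale0r. Qed.
Lemma klin_sum I (s : seq I) P (F : I -> H) :
  f (\sum_(i <- s | P i) F i) = \sum_(i <- s | P i) f (F i).
Proof. by elim/big_rec2: _ => [|i x y _ <-]; rewrite ?klin0 ?klinD. Qed.

End KLinear.

End Hilbert.

(** * From Hermitian forms to their real parts *)

Definition bounded_form (R : realType) (H : normedModType R) (b : H -> H -> R) : Prop :=
  exists2 C : R, 0 <= C & forall v w, `|b v w| <= C * (`|v| * `|w|).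

Section HermitianForm.
Variables (R : realType) (k : scalar_kind) (H : hilbertType R k).
Local Notation K := (kscalar R k).
Variable B : H -> H -> K.
Hypotheses (hBs : sesquilinear_form B) (hBh : hermitian_form B).
Implicit Types (u v w f : H) (a c : K) (r : R).

Definition re_form v w : R := kre (B v w).

Lemma formDl u v w : B (u + v) w = B u w + B v w. Proof. by case: hBs. Qed.
Lemma formDr u v w : B u (v + w) = B u v + B u w. Proof. by case: hBs. Qed.
Lemma formM v w a c : B (v *> a) (w *> c) = kconj a * B v w * c.
Proof. by case: hBs. Qed.
Lemma formMr v w a : B v (w *> a) = B v w * a.
Proof. by rewrite -[in LHS](rmul1 v) formM -kreal1 kconj_real kreal1 mul1r. Qed.
Lemma formMl v w a : B (v *> a) w = kconj a * B v w.
Proof. by rewrite -[in LHS](rmul1 w) formM mulr1. Qed.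

Lemma re_form_sym : sym_bilinear re_form.
Proof.
split=> [v w|r u v w]; first by rewrite /re_form hBh kre_conj.
by rewrite /re_form formDl kreD -rmul_real formMl kconj_real kre_realM.
Qed.
Let bs := re_form_sym.

Lemma form_self v : B v v = kreal k (re_form v v).
Proof. by apply: kconj_id; rewrite -hBh. Qed.

Lemma re_form_scale v a : re_form (v *> a) (v *> a) = kabs a ^+ 2 * re_form v v.
Proof.
by rewrite {1}/re_form formM form_self -kreal_mulC -mulrA kre_realM -sqr_kabs mulrC.
Qed.

Lemma re_form_orthogonal v w : (forall c : K, c \in kunits R k -> re_form v (w *> c) = 0) ->
  B v w = 0.
Proof.
have kreal0 : kreal k 0 = 0 :> K by case: (k).
move=> vw; rewrite -[LHS]kconjK [X in kconj X]kunits_span big_seq big1; last first.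
  move=> c /vw; rewrite /re_form formMr -kconjM kre_conj => ->.
  by rewrite kreal0 mulr0.
by rewrite -kreal0 kconj_real.
Qed.

(** Continuity at the origin bounds the form by 1 on a ball of radius [d]; scaling both arguments to
    norm [d / 2] gives the constant [(2 / d) ^+ 2]. *)
Lemma re_form_bounded : continuous_form B -> bounded_form re_form.
Proof.
move=> /(_ 0 0); have -> : B 0 0 = 0.
  by rewrite -[0 in X in B _ X](rmul0 0) formMr mulr0.
move=> /cvgrPdist_lt/(_ 1 ltr01); rewrite /nbhs /= => -[[A1 A2] /= [n1 n2] sub].
have [d [d0 dA1 dA2]] : exists d : R, [/\ 0 < d, forall v : H, `|v| < d -> A1 v &
    forall v : H, `|v| < d -> A2 v].
  move: n1 n2; rewrite -!nbhs_ballE => -[d1 /= d10 s1] [d2 /= d20 s2].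
  exists (Num.min d1 d2); split; first by rewrite lt_min d10.
    move=> v; rewrite lt_min => /andP[vd _]; apply: s1.
    by rewrite -ball_normE /= sub0r normrN.
  move=> v; rewrite lt_min => /andP[_ vd]; apply: s2.
  by rewrite -ball_normE /= sub0r normrN.
have small v w : `|v| < d -> `|w| < d -> `|re_form v w| <= 1.
  move=> vd wd; have := sub (v, w) (conj (dA1 _ vd) (dA2 _ wd)).
  rewrite /= subr0 sub0r normrN => lt1.
  by rewrite (le_trans (kre_le_kabs _)) // (le_trans (ler_norm _)) // ltW.
exists ((2 / d) ^+ 2) => [|v w]; first exact: sqr_ge0.
have [->|v0] := eqVneq v 0; first by rewrite (sym0l bs) !normr0 mul0r mulr0.
have [->|w0] := eqVneq w 0; first by rewrite (sym0r bs) !normr0 !mulr0.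
have scale (x : H) : x != 0 -> `|(d / 2 / `|x|) *: x| < d.
  move=> x0; have xp : 0 < `|x| by rewrite normr_gt0.
  rewrite normrZ normrM normfV normr_id gtr0_norm ?divr_gt0 //.
  by rewrite -mulrA mulVf ?gt_eqF // mulr1 ltr_pdivrMr // ltr_pMr // ltr1n.
have := small _ _ (scale v v0) (scale w w0).
rewrite (symZl bs) (symZr bs) !normrM !normfV !normr_id.
have vp : 0 < `|v| by rewrite normr_gt0.
have wp : 0 < `|w| by rewrite normr_gt0.
rewrite (gtr0_norm d0) (ger0_norm (_ : 0 <= 2)) // => le1.
rewrite -subr_ge0; have -> : (2 / d) ^+ 2 * (`|v| * `|w|) - `|re_form v w| =
  (1 - d / 2 / `|v| * (d / 2 / `|w| * `|re_form v w|)) *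
  ((2 / d) ^+ 2 * (`|v| * `|w|)) by field; rewrite !gt_eqF.
by rewrite mulr_ge0 ?subr_ge0 // mulr_ge0 ?sqr_ge0 ?mulr_ge0.
Qed.

(** [Hm] is finite-dimensional by [form_index], and its basis vectors times [kunits] span it over
    the reals. A vector orthogonal to [Hm] has [pm v = 0], because
    [B v (pm v) = B (pm v) (pm v)]. *)
Lemma re_form_finite_index p : strongly_nondegenerate B -> form_index B p ->
  finite_negative_index re_form.
Proof.
move=> [Hp [Hm [pp [pm [[hp hm] dec orth [pos neg] _]]]]] [_ /(_ Hm hm neg)[n + _]].
move=> [e [eHm _ span]].
pose gs := [seq e i *> c | i <- enum 'I_n, c <- kunits R k].
apply: (@finite_negative_indexI _ _ _ bs Hm gs).
- by move=> r v w Hv Hw; apply: ksubD => //; exact: ksubZ.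
- exact: neg.
- by move=> g /allpairsP[[i c] /= [_ _ ->]]; exact: ksubM.
- exact: ksub0.
move=> v vgs; have [Hpv Hmv vE] := dec v.
have vm w : Hm w -> B v w = 0.
  move=> /span[c ->]; apply: (big_ind (fun x => B v x = 0)) => [|x y|i _].
  - by rewrite -(rmul0 0) formMr mulr0.
  - by rewrite formDr => -> ->; rewrite addr0.
  rewrite formMr -[RHS](mul0r (c i)); congr (_ * _).
  apply: re_form_orthogonal => a au; apply: vgs.
  by apply/allpairsP; exists (i, a); rewrite mem_enum.
have pm0 : pm v = 0.
  apply/eqP; apply: contrapT => /negP /(neg _ Hmv).
  have := vm _ Hmv; rewrite {1}vE formDl orth // add0r => ->.
  by rewrite kre0 ltxx.
have [->|v0] := eqVneq v 0; first by rewrite (sym0l bs).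
apply: ltW; apply: pos => //; rewrite vE pm0 addr0 //.
Qed.

Lemma negative_orthogonal_pair p : form_index B p -> (1 < p)%N ->
  exists e0 e1, [/\ re_form e0 e0 < 0, re_form e1 e1 < 0 & B e0 e1 = 0].
Proof.
move=> [[W [hW neg [e [eW free _]]]] _]; case: p e eW free => [//|[//|p]] e eW free _.
pose f0 := e ord0; pose f1 := e (lift ord0 ord0).
have indep a0 a1 : f0 *> a0 + f1 *> a1 = 0 -> a0 = 0 /\ a1 = 0.
  pose c (i : 'I_p.+2) : K := if i == ord0 then a0 else if i == lift ord0 ord0 then a1 else 0.
  move=> sum0; have {}free := free c.
  have cs : \sum_i e i *> c i = 0.
    rewrite big_ord_recl big_ord_recl /c /= big1 ?addr0 // => i _.
    by rewrite rmul0.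
  by move: (free cs ord0) (free cs (lift ord0 ord0)); rewrite /c.
have one0 : (1 : K) != 0 by exact: oner_neq0.
have f00 : f0 != 0.
  apply: contraNneq one0 => z; have [|-> //] := indep 1 0.
  by rewrite z rmul0l rmul0 addr0.
have neg0 : re_form f0 f0 < 0 by apply: neg => //; exact: eW.
pose c := kreal k ((re_form f0 f0)^-1) * B f0 f1.
exists f0, (f1 - f0 *> c); split=> //.
  apply: neg; first by apply: ksubB => //; [exact: eW|apply: ksubM => //; exact: eW].
  apply: contraNneq one0 => z; have [|_ -> //] := indep (- c) 1.
  by rewrite rmulNr rmul1 addrC.
rewrite formDr -rmulNr formMr form_self /c -mulrN mulrA -krealM divff ?lt_eqF //.
by rewrite kreal1 mul1r subrr.
Qed.

(** Negativity of a plane must survive the replacement of [e0] and [e1] by nearby vectors fixed by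
    the fixator of a ball. *)
Lemma negative_pair_perturbation e0 e1 : bounded_form re_form ->
  re_form e0 e0 < 0 -> re_form e1 e1 < 0 -> B e0 e1 = 0 ->
  exists2 eps : R, 0 < eps & forall f0 f1, `|f0 - e0| <= eps -> `|f1 - e1| <= eps ->
    forall a0 a1, 0 < kabs a0 + kabs a1 ->
    re_form (f0 *> a0 + f1 *> a1) (f0 *> a0 + f1 *> a1) < 0.
Proof.
move=> [C C0 bC] n0 n1 o01.
have kreal0 : kreal k 0 = 0 :> K by case: (k).
have o10 : B e1 e0 = 0 by rewrite hBh o01 -kreal0 kconj_real.
pose del := Num.min (- re_form e0 e0) (- re_form e1 e1).
have del0 : 0 < del by rewrite lt_min !oppr_gt0 n0.
pose E := `|e0| + `|e1|; have E0 : 0 <= E by rewrite addr_ge0.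
(* With [s = kabs a0 + kabs a1] and [eps <= 1], the error is at most
   [C * (eps * (2 * E + 1) * s ^+ 2)], hence at most [eps * X / 4 * s ^+ 2]. The denominator
   [X + del] of [eps] gives both [eps <= 1] and [eps * X < del]. *)
pose X := 4 * (C + 1) * (2 * E + 1).
have X0 : 0 < X by rewrite !mulr_gt0 ?ltr_wpDl ?mulr_ge0.
pose eps := del / (X + del); have XD : 0 < X + del by rewrite addr_gt0.
have eps0 : 0 < eps by rewrite divr_gt0.
have eps1 : eps <= 1 by rewrite ler_pdivrMr // mul1r lerDr ltW.
have epsX : eps * X < del.
  by rewrite mulrAC ltr_pdivrMr // ltr_pM2l // ltrDl.
exists eps => // f0 f1 fe0 fe1 a0 a1 a01.
pose u0 := e0 *> a0 + e1 *> a1; pose w := (f0 - e0) *> a0 + (f1 - e1) *> a1.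
have -> : f0 *> a0 + f1 *> a1 = u0 + w.
  by rewrite addrACA -!rmulDl !(addrC _ (_ - _)) !subrK.
have [A0 A1] := (kabs_ge0 a0, kabs_ge0 a1).
have b00 : re_form u0 u0 <= - del * (kabs a0 ^+ 2 + kabs a1 ^+ 2).
  rewrite /u0 (symDl bs) !(symDr bs) !re_form_scale.
  have -> : re_form (e0 *> a0) (e1 *> a1) = 0 by rewrite /re_form formM o01 mulr0 mul0r kre0.
  have -> : re_form (e1 *> a1) (e0 *> a0) = 0 by rewrite /re_form formM o10 mulr0 mul0r kre0.
  have d0 : re_form e0 e0 <= - del by rewrite lerNr ge_min lexx.
  have d1 : re_form e1 e1 <= - del by rewrite lerNr ge_min lexx orbT.
  have := ler_wpM2l (sqr_ge0 (kabs a0)) d0; have := ler_wpM2l (sqr_ge0 (kabs a1)) d1.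
  lra.
pose s := kabs a0 + kabs a1.
have ws : `|w| <= eps * s.
  rewrite (le_trans (ler_normD _ _)) // !norm_rmul mulrDr.
  by rewrite lerD // ler_wpM2r.
have us : `|u0| <= E * s.
  rewrite (le_trans (ler_normD _ _)) // !norm_rmul mulrDr.
  by rewrite lerD // ler_wpM2r // ?lerDl ?lerDr.
have b1 : re_form w u0 <= C * (eps * s * (E * s)).
  rewrite (le_trans (ler_norm _)) // (le_trans (bC _ _)) // ler_wpM2l //.
  by rewrite ler_pM.
have b2 : re_form w w <= C * (eps * s * (1 * s)).
  rewrite (le_trans (ler_norm _)) // (le_trans (bC _ _)) // ler_wpM2l //.
  rewrite ler_pM // (le_trans ws) // ler_wpM2r //; exact: addr_ge0.
have s2 : s ^+ 2 <= 2 * (kabs a0 ^+ 2 + kabs a1 ^+ 2).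
  by have := sqr_ge0 (kabs a0 - kabs a1); rewrite /s; lra.
have s0 : 0 < s ^+ 2 by rewrite exprn_gt0.
rewrite (symDl bs u0 w) !(symDr bs u0 w) (symC bs u0 w).
move: (kabs a0 ^+ 2 + kabs a1 ^+ 2) b00 s2 => Y b00 s2.
have h1 : C * (eps * s * (E * s)) + C * (eps * s * (E * s)) + C * (eps * s * (1 * s))
    <= eps * X / 4 * s ^+ 2.
  have -> : eps * X / 4 * s ^+ 2 = (C + 1) * (eps * (2 * E + 1) * s ^+ 2) by rewrite /X; field.
  rewrite [X in X <= _](_ : _ = C * (eps * (2 * E + 1) * s ^+ 2)); last by ring.
  rewrite ler_wpM2r ?lerDl // mulr_ge0 ?ltW // mulr_gt0 //.
  by rewrite ltr_wpDl // mulr_ge0.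
have h2 : eps * X / 4 * s ^+ 2 <= del / 4 * s ^+ 2.
  by rewrite ler_wpM2r ?(ltW s0) // ler_pM2r ?invr_gt0 // ltW.
have h3 : del / 4 * s ^+ 2 <= del / 4 * (2 * Y).
  by rewrite ler_wpM2l // divr_ge0 // ltW.
have Y0 : 0 < del * Y by rewrite mulr_gt0 // -(pmulr_rgt0 Y (_ : 0 < 2)) // (lt_le_trans s0).
lra.
Qed.

End HermitianForm.

(** * The module of an edge over its Hecke algebra *)

Section LinComb.
Variables (R : realType) (H : lmodType R) (w1 w2 w3 w4 : H).

(* Reduces identities in a module to ring identities between coefficients. *)
Definition lincomb (a b c d : R) : H := a *: w1 + b *: w2 + c *: w3 + d *: w4.

Lemma lincombD a b c d a' b' c' d' : lincomb a b c d + lincomb a' b' c' d' =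
  lincomb (a + a') (b + b') (c + c') (d + d').
Proof.
rewrite /lincomb addrACA [X in X + _]addrACA [X in X + _ + _]addrACA.
by rewrite !scalerDl.
Qed.

Lemma lincombZ r a b c d : r *: lincomb a b c d =
  lincomb (r * a) (r * b) (r * c) (r * d).
Proof. by rewrite /lincomb !scalerDr !scalerA. Qed.

Lemma lincombN a b c d : - lincomb a b c d = lincomb (- a) (- b) (- c) (- d).
Proof. by rewrite -scaleN1r lincombZ !mulN1r. Qed.

Lemma lincomb1 : w1 = lincomb 1 0 0 0.
Proof. by rewrite /lincomb !scale0r scale1r !addr0. Qed.
Lemma lincomb2 : w2 = lincomb 0 1 0 0.
Proof. by rewrite /lincomb !scale0r scale1r add0r !addr0. Qed.
Lemma lincomb3 : w3 = lincomb 0 0 1 0.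
Proof. by rewrite /lincomb !scale0r scale1r !add0r addr0. Qed.
Lemma lincomb4 : w4 = lincomb 0 0 0 1.
Proof. by rewrite /lincomb !scale0r scale1r !add0r. Qed.

(** When [center] is the scalar [lam] and [p = q^-1], this is the quadratic relation of [hecke]: the
    four vectors are [S (t v)], [S v], [t v] and [v], while [X] is [t (S (t v))] and [Y] is
    [S (t (hecke v))]. *)
Lemma hecke_identity (p lam : R) :
  let X := lam *: w3 + w4 - w2 in let Y := lam *: w1 - p *: (w2 - lam *: w1) in
  Y - p *: ((X - p *: (w4 - X)) - Y) =
  ((1 + p) * lam) *: (w1 - p *: (w3 - w1)) - p *: w4.
Proof.
move: lincombD lincombZ lincombN lincomb1 lincomb2 lincomb3 lincomb4.
move: lincomb => L LD LZ LN -> -> -> ->; rewrite /= !(LN, LZ, LD).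
by congr (L _ _ _ _); ring.
Qed.

End LinComb.

(** * Estimates for forms of finite negative index *)

Section FiniteIndexBound.
Variables (R : realType) (H : normedModType R) (b : H -> H -> R).
Hypotheses (bs : sym_bilinear b) (bb : bounded_form b).

Lemma sum_sqr_sym (fs : seq H) : sym_bilinear (fun v w => \sum_(f <- fs) b v f * b w f).
Proof.
split=> [v w|r u v w]; first by apply: eq_bigr => f _; rewrite mulrC.
rewrite mulr_sumr -big_split /=; apply: eq_bigr => f _.
by rewrite (symDl bs) (symZl bs) mulrDl mulrA.
Qed.

(** With [m] the form of the sum of squares, [b + 2 m] is positive semidefinite and at most 2 at
    [y]. Cauchy-Schwarz for it and for [m] bounds [b y w], although [y] itself may have large
    norm. *)
Lemma negative_functional_bound (fs : seq H) :
  (forall v, 0 <= b v v + \sum_(f <- fs) b v f ^+ 2) ->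
  exists2 A : R, 0 <= A & forall y, b y y <= 0 -> \sum_(f <- fs) b y f ^+ 2 = 1 ->
    forall w, b y w ^+ 2 <= A * `|w| ^+ 2.
Proof.
move=> FI; case: bb => C C0 bC.
pose m v w := \sum_(f <- fs) b v f * b w f.
have ms : sym_bilinear m := sum_sqr_sym fs.
have mE v : m v v = \sum_(f <- fs) b v f ^+ 2 by apply: eq_bigr => f _; rewrite expr2.
have m0 v : 0 <= m v v by rewrite mE sumr_ge0 // => f _; rewrite sqr_ge0.
pose n v w := b v w + 2 * m v w.
have ns : sym_bilinear n.
  split=> [v w|r u v w]; first by rewrite /n (symC bs) (symC ms).
  rewrite /n (symDl bs) (symZl bs) (symDl ms) (symZl ms); ring.
have n0 v : 0 <= n v v.
  by have := FI v; rewrite -mE /n => h; have := m0 v; lra.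
pose D := \sum_(f <- fs) (C * `|f|) ^+ 2.
have D0 : 0 <= D by rewrite sumr_ge0 // => f _; rewrite sqr_ge0.
have mD w : m w w <= D * `|w| ^+ 2.
  rewrite mE /D mulr_suml; apply: ler_sum => f _.
  rewrite -[X in X <= _]real_normK ?num_real // -exprMn.
  rewrite ler_pXn2r // ?nnegrE ?mulr_ge0 //.
  by rewrite (le_trans (bC _ _)) // -mulrA (mulrC `|f|).
have bD w : b w w <= C * `|w| ^+ 2.
  by rewrite (le_trans (ler_norm _)) // (le_trans (bC _ _)) // expr2.
have CS (c : H -> H -> R) : sym_bilinear c -> (forall v, 0 <= c v v) ->
    forall v w, c v w ^+ 2 <= c v v * c w w.
  by move=> cs c0 v w; apply: (@sym_CS _ _ _ cs setT).
(* From $(n-2m)^2\le 2n^2+8m^2$ with $n^2\le 2(C+2D)|w|^2$ and $m^2\le D|w|^2$. *)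
exists (4 * (C + 2 * D) + 8 * D) => [|y yneg y1 w]; first lra.
have h1 := CS n ns n0 y w; have h2 := CS m ms m0 y w.
rewrite mE y1 mul1r in h2.
have ny : n y y <= 2 by rewrite /n mE y1; lra.
have nw : n w w <= (C + 2 * D) * `|w| ^+ 2.
  by have := mD w; have := bD w; rewrite /n; lra.
have h3 : n y w ^+ 2 <= 2 * ((C + 2 * D) * `|w| ^+ 2).
  apply: (le_trans h1); apply: (@le_trans _ _ (2 * n w w)); first exact: ler_wpM2r.
  by rewrite ler_wpM2l.
have := mD w; have -> : b y w = n y w - 2 * m y w by rewrite /n; ring.
move: h2 h3 (sqr_ge0 (n y w + 2 * m y w)); nra.
Qed.

End FiniteIndexBound.

(** For $\lambda\ge1$ the polynomial $z^2-(1+1/q)\lambda z+1/q$ is nonpositive at 1, so $z_1\ge1$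
    and $z_2\le z_1z_2=1/q$; the other sign of $\lambda$ reduces to this one. The last clause will
    exclude [z1]-eigenvectors killed by [S]. *)
Lemma hecke_roots (R : realType) (q lam : R) : 1 < q -> 1 <= lam ^+ 2 ->
  exists z1 z2, [/\ z1 + z2 = (1 + q^-1) * lam, z1 * z2 = q^-1, `|z2| < 1 & 1 < (q * z1) ^+ 2].
Proof.
move=> q1 lam1.
wlog lam0 : lam lam1 / 0 <= lam => [hw|].
  have [l0|l0] := leP 0 lam; first exact: hw.
  have nl : 0 <= - lam by rewrite oppr_ge0 ltW.
  have [|z1 [z2 [h1 h2 h3 h4]]] := hw (- lam) _ nl; first by rewrite sqrrN.
  exists (- z1), (- z2); rewrite normrN mulrNN mulrN sqrrN; split=> //.
  by rewrite -opprD h1 mulrN opprK.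
have {lam1}lam1 : 1 <= lam by nra.
have q0 : 0 < q by lra.
have : 0 < q^-1 by rewrite invr_gt0.
have : q * q^-1 = 1 by rewrite divff ?gt_eqF.
move: q^-1 => p qp p0.
have p1 : p < 1 by nra.
have : 1 + p <= (1 + p) * lam by nra.
move: ((1 + p) * lam) => t tp.
have D0 : (1 - p) ^+ 2 <= t ^+ 2 - 4 * p by nra.
have sD : Num.sqrt (t ^+ 2 - 4 * p) ^+ 2 = t ^+ 2 - 4 * p.
  by rewrite sqr_sqrtr // (le_trans _ D0) // sqr_ge0.
have := sqrtr_ge0 (t ^+ 2 - 4 * p); move: (Num.sqrt _) sD => s sD s0.
have p10 : 0 <= 1 - p by lra.
have sp : 1 - p <= s by rewrite -(ler_pXn2r (n := 2)) ?nnegrE ?sD.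
exists ((t + s) / 2), ((t - s) / 2); split.
- by field.
- have -> : (t + s) / 2 * ((t - s) / 2) = (t ^+ 2 - s ^+ 2) / 4 by field.
  by rewrite sD; field.
- have t0 : 0 <= t by lra.
  have h : s <= t by rewrite -(ler_pXn2r (n := 2)) ?nnegrE // sD; lra.
  rewrite ger0_norm; last lra.
  have : (t - s) * (t + s) = 4 * p by rewrite -subr_sqr sD; ring.
  have : 0 <= (t - s) * (t + s - 2) by apply: mulr_ge0; lra.
  lra.
have : 1 <= (t + s) / 2 by lra.
move: ((t + s) / 2) => z z1; have qz : 1 < q * z by nra.
by rewrite exprn_egt1.
Qed.

Lemma cvg0_of_sqr_le (R : realType) (u g : nat -> R) (c : R) :
  (forall n, u n ^+ 2 <= c * g n) -> 0 <= c -> g n @[n --> \oo] --> (0 : R) ->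
  u n @[n --> \oo] --> (0 : R).
Proof.
move=> ug c0 /cvgr0Pnorm_le g0; apply/cvgr0Pnorm_le => e e0.
have c1 : 0 < c + 1 by rewrite ltr_wpDl.
have [N _ gN] := g0 (e ^+ 2 / (c + 1)) (divr_gt0 (exprn_gt0 2 e0) c1).
exists N => // n /gN /= gn; rewrite -(ler_pXn2r (n := 2)) ?nnegrE ?(ltW e0) //.
rewrite real_normK ?num_real // (le_trans (ug n)) //.
have := le_trans (ler_norm _) gn; rewrite ler_pdivlMr // => h.
have e2 : 0 <= e ^+ 2 by rewrite sqr_ge0.
have [gp|gp] := leP 0 (g n); nra.
Qed.

(** * An irreducible module over the algebra of [S] and [t] *)

Section HeckeModule.
Variables (R : realType) (k : scalar_kind) (H : hilbertType R k).
Local Notation K := (kscalar R k).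
Variables (b : H -> H -> R) (M : set H) (P S t : H -> H) (q : R).
Hypotheses (bs : sym_bilinear b) (bb : bounded_form b) (FI : finite_negative_index b).
Hypotheses (q1 : 1 < q) (hM : ksubspace M) (cM : closed M).
Hypotheses (PM : forall v, M (P v)) (bP : forall v w, M v -> b v (P w) = b v w).
Hypotheses (Slin : klinear S) (Sbnd : bounded_op S) (SM : forall v, M v -> M (S v)).
Hypotheses (tlin : klinear t) (tbnd : bounded_op t) (tM : forall v, M v -> M (t v)).
Hypotheses (SS : forall v, M v -> S (S v) = S v) (tt : forall v, M v -> t (t v) = v).
Hypotheses (bS : forall v w, M v -> M w -> b (S v) w = b v (S w)).
Hypotheses (bt : forall v w, M v -> M w -> b (t v) w = b v (t w)).
Hypothesis pos : forall v, M v -> S v = 0 -> 0 <= b v v.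
Hypothesis irr : forall L : set H, ksubspace L -> closed L -> L `<=` M ->
  (forall v, L v -> L (S v)) -> (forall v, L v -> L (t v)) ->
  (exists2 v, L v & v != 0) -> M `<=` L.

(* edge_avg \o pi a on the vectors fixed by an edge stabilizer, by edge_avg_step. *)
Definition hecke v : H := S (t v) - q^-1 *: (t v - S (t v)).
Definition center v : H := S (t v) + t (S v) - t v.
Let U := hecke.
Let Z := center.

Let MB u v : M u -> M v -> M (u - v). Proof. exact: ksubB. Qed.
Let MD u v : M u -> M v -> M (u + v). Proof. exact: ksubD. Qed.
Let MZ r v : M v -> M (r *: v). Proof. exact: ksubZ. Qed.

Let UM v : M v -> M (U v).
Proof. by move=> Mv; apply: MB; [exact/SM/tM|apply/MZ/MB; [exact: tM|exact/SM/tM]]. Qed.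
Let ZM v : M v -> M (Z v).
Proof. by move=> Mv; apply: MB; [apply: MD; [exact/SM/tM|exact/tM/SM]|exact: tM]. Qed.
Let UnM n v : M v -> M (iter n U v). Proof. by move=> Mv; elim: n => //= n; exact: UM. Qed.

Let Zlin : klinear Z.
Proof.
split=> [u v|v a]; rewrite /Z /center.
  by rewrite !(klinD tlin, klinD Slin) (addrACA (S (t u))) opprD [LHS]addrACA.
by rewrite !(klinM tlin, klinM Slin) -rmulNl -!rmulDl.
Qed.

Let ZS v : M v -> Z (S v) = S (Z v).
Proof.
move=> Mv; transitivity (S (t (S v))).
  by rewrite /Z /center (SS Mv) addrK.
by rewrite /Z /center (klinB Slin) (klinD Slin) (SS (tM Mv)) (addrC (S (t v))) addrK.
Qed.

Let Zt v : M v -> Z (t v) = t (Z v).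
Proof.
move=> Mv; rewrite /Z /center (klinB tlin) (klinD tlin) (tt Mv) (tt (SM Mv)).
by rewrite (addrC (S v)).
Qed.

Let Zb v w : M v -> M w -> b (Z v) w = b v (Z w).
Proof.
move=> Mv Mw; have [Mtv MSv Mtw MSw] := And4 (tM Mv) (SM Mv) (tM Mw) (SM Mw).
rewrite /Z /center (symBl bs) (symDl bs) (symBr bs) (symDr bs).
by rewrite !bS // !bt // ?bS // [X in X - _]addrC.
Qed.

Let split_norm w : M w -> b w w = b (S w) (S w) + b (w - S w) (w - S w).
Proof.
move=> Mw; have MSw := SM Mw.
rewrite !(symBl bs, symBr bs) (symC bs w (S w)) !(bS Mw) // !SS //; ring.
Qed.

Let pos_compl w : M w -> 0 <= b (w - S w) (w - S w).
Proof.
move=> Mw; apply: pos; first by apply: MB => //; exact: SM.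
by rewrite (klinB Slin) SS // subrr.
Qed.

Let compl_orth w m : M w -> M m -> b (S w) (m - S m) = 0.
Proof.
move=> Mw Mm; rewrite bS //; last by apply: MB => //; exact: SM.
by rewrite (klinB Slin) SS // subrr (sym0r bs).
Qed.

(** [U] is the isometry [t] followed by multiplication by [- q^-1] on the complement of [S]. *)
Let hecke_norm v : M v -> b (U v) (U v) =
  b v v - (1 - q ^- 2) * b (t v - S (t v)) (t v - S (t v)).
Proof.
move=> Mv; have Mt := tM Mv; have -> : b v v = b (t v) (t v) by rewrite bt // tt.
rewrite (split_norm Mt) /U /hecke; set x := t v - S (t v).
have o : b (S (t v)) x = 0 by exact: compl_orth.
clearbody x.
rewrite (symBl bs) !(symBr bs) !(symZl bs) !(symZr bs) (symC bs x (S (t v))) o.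
by rewrite -exprVn; ring.
Qed.

(** On [S M] the operator [Z] is [S t]: an isometry followed by a projection with nonnegative
    complement. *)
Let center_le y : M y -> S y = y -> b (Z y) (Z y) <= b y y.
Proof.
move=> My Sy; have Mt := tM My; have -> : Z y = S (t y) by rewrite /Z /center Sy addrK.
have -> : b y y = b (t y) (t y) by rewrite bt // tt.
by rewrite (split_norm Mt) lerDl pos_compl.
Qed.

(** Schur's lemma: [Z] commutes with [S] and [t], so its eigenspace is a closed submodule. *)
Let kernel_center (lam : R) : (exists2 v, M v /\ Z v = lam *: v & v != 0) ->
  forall v, M v -> Z v = lam *: v.
Proof.
move=> [v0 [Mv0 Zv0] v00]; pose L := [set v | M v /\ Z v - lam *: v = 0].
suff sub : M `<=` L by move=> v /sub[_ /eqP]; rewrite subr_eq0 => /eqP.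
apply: irr => //.
- split.
  + by split; [exact: ksub0|rewrite (klin0 Zlin) scaler0 subrr].
  + move=> u v [Mu Zu] [Mv Zv]; split; first exact: ksubD.
    by rewrite (klinD Zlin) scalerDr opprD addrACA Zu Zv addr0.
  + move=> v a [Mv Zv]; split; first exact: ksubM.
    by rewrite (klinM Zlin) -rmulZ -rmulNl -rmulDl Zv rmul0l.
- case: Sbnd tbnd => [CS hS] [Ct ht].
  apply: (@closed_zero _ _ _ _ (`|CS| * `|Ct| + `|Ct| * `|CS| + `|Ct| + `|lam|)) => // [u v|v].
    rewrite (klinB Zlin) scalerBr !opprB (addrC (lam *: v) (- (lam *: u))).
    by rewrite [LHS]addrACA; congr (_ + _); exact: addrC.
  have hS' u : `|S u| <= `|CS| * `|u|.
    by rewrite (le_trans (hS u)) // ler_wpM2r // ler_norm.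
  have ht' u : `|t u| <= `|Ct| * `|u|.
    by rewrite (le_trans (ht u)) // ler_wpM2r // ler_norm.
  rewrite !mulrDl (le_trans (ler_normB _ _)) // normrZ lerD //.
  rewrite (le_trans (ler_normB _ _)) // lerD //.
  rewrite (le_trans (ler_normD _ _)) // lerD //.
    by rewrite (le_trans (hS' _)) // -mulrA ler_wpM2l.
  by rewrite (le_trans (ht' _)) // -mulrA ler_wpM2l.
- by move=> v [].
- move=> v [Mv Zv]; split; first exact: SM.
  by rewrite ZS // -(klinZ Slin) -(klinB Slin) Zv (klin0 Slin).
- move=> v [Mv Zv]; split; first exact: tM.
  by rewrite Zt // -(klinZ tlin) -(klinB tlin) Zv (klin0 tlin).
by exists v0; rewrite //; split => //; rewrite Zv0 subrr.
Qed.

Let full_closure (Q : set H) : ksubspace Q -> Q `<=` M ->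
  (forall v, Q v -> Q (S v)) -> (forall v, Q v -> Q (t v)) ->
  (exists2 v, Q v & v != 0) -> M `<=` closure Q.
Proof.
move=> hQ QM QS Qt [v Qv v0]; apply: irr.
- exact: closure_ksubspace.
- exact: closed_closure.
- by move=> u cu; apply: cM; exact: closureS cu.
- exact: closure_stable.
- exact: closure_stable.
by exists v => //; exact: subset_closure.
Qed.

(** The squares of the iterates are nonincreasing and bounded below, so their decrements,
    proportional to [b (x n) (x n)], tend to zero. By Cauchy-Schwarz the iterates decay against the
    complement of [S] and its image under [t]. These span the submodule [Q], dense since [S] is not
    the identity, and boundedness of the squares extends the decay to all [w]. *)
Let decay_nonneg : (forall v, M v -> 0 <= b v v) -> (exists2 m, M m & m - S m != 0) ->
  forall v w, M v -> M w -> b (iter n U v) w @[n --> \oo] --> (0 : R).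
Proof.
move=> b0 [m0 Mm0 m00] v w Mv Mw.
have CS x y : M x -> M y -> b x y ^+ 2 <= b x x * b y y.
  by apply: (sym_CS bs) => // r x' y' Mx My; apply: MD => //; exact: MZ.
pose x n := t (iter n U v) - S (t (iter n U v)).
have Mx n : M (x n) by apply: MB; [|apply: SM]; apply/tM/UnM.
pose nu n := b (iter n U v) (iter n U v).
have nu0 n : 0 <= nu n by apply: b0; exact: UnM.
have q2 : 0 < 1 - q ^- 2.
  by rewrite subr_gt0 invf_lt1 ?exprn_egt1 // exprn_gt0 // (lt_trans _ q1).
have nuS n : nu n - nu n.+1 = (1 - q ^- 2) * b (x n) (x n).
  rewrite /nu /= hecke_norm; last exact: UnM.
  by rewrite opprB addrCA subrr addr0.
have nu_cvg : cvgn nu.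
  apply: nonincreasing_is_cvgn; last by exists 0 => _ [n _ <-].
  apply/nonincreasing_seqP => n; rewrite -subr_ge0 nuS; apply: mulr_ge0; [exact: ltW|exact: b0].
have x0 : b (x n) (x n) @[n --> \oo] --> (0 : R).
  have -> : (fun n => b (x n) (x n)) = (fun n => (1 - q ^- 2)^-1 * (nu n - nu n.+1)).
    by apply/funext => n; rewrite nuS mulKf // gt_eqF.
  rewrite -[X in _ --> X](mulr0 (1 - q ^- 2)^-1); apply: cvgMl_tmp.
  by rewrite -(subrr (limn nu)); apply: cvgB => //; rewrite cvg_shiftS.
have xm m : M m -> b (t (iter n U v)) (m - S m) @[n --> \oo] --> (0 : R).
  move=> Mm; have Mm' : M (m - S m) by apply: MB => //; exact: SM.
  apply: (@cvg0_of_sqr_le _ _ (fun n => b (x n) (x n)) (b (m - S m) (m - S m))) => [n||//].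
    have Mt := tM (UnM n Mv); rewrite mulrC.
    have -> : b (t (iter n U v)) (m - S m) = b (x n) (m - S m).
      by rewrite /x (symBl bs) compl_orth // subr0.
    exact: CS.
  exact: b0.
have Um m : M m -> b (iter n U v) (m - S m) @[n --> \oo] --> (0 : R).
  move=> Mm; rewrite -cvg_shiftS.
  have -> : [sequence b (iter n.+1 U v) (m - S m)]_n =
      (fun n => - q^-1 * b (t (iter n U v)) (m - S m)).
    apply/funext => n /=; have Mt := tM (UnM n Mv).
    rewrite /U /hecke (symBl bs) (symZl bs) (symBl bs) compl_orth //; ring.
  have := @cvgMl_tmp _ _ _ _ _ (- q^-1) _ (xm m Mm); rewrite mulr0; exact.
pose Q := [set z | exists m m', [/\ M m, M m' & z = (m - S m) + t (m' - S m')]].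
have QM : Q `<=` M.
  move=> _ [m [m' [Mm Mm' ->]]]; apply: MD; first by apply: MB => //; exact: SM.
  by apply/tM/MB => //; exact: SM.
have cSD u u' : (u + u') - S (u + u') = (u - S u) + (u' - S u').
  by rewrite (klinD Slin) opprD addrACA.
have cSM u a : u *> a - S (u *> a) = (u - S u) *> a.
  by rewrite (klinM Slin) rmulDl rmulNl.
have cS0 m : M m -> S (m - S m) = 0 by move=> Mm; rewrite (klinB Slin) SS // subrr.
have hQ : ksubspace Q.
  split.
  - exists 0, 0; split; [exact: ksub0|exact: ksub0|].
    by rewrite (klin0 Slin) subrr (klin0 tlin) addr0.
  - move=> _ _ [m [m' [Mm Mm' ->]]] [l [l' [Ml Ml' ->]]].
    exists (m + l), (m' + l'); split; [exact: MD|exact: MD|].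
    by rewrite !cSD (klinD tlin (m' - S m')) addrACA.
  move=> _ a [m [m' [Mm Mm' ->]]]; exists (m *> a), (m' *> a).
  split; [exact: ksubM|exact: ksubM|].
  by rewrite !cSM (klinM tlin) rmulDl.
have QS z : Q z -> Q (S z).
  move=> [m [m' [Mm Mm' ->]]]; have Mx' : M (m' - S m') by apply: MB => //; exact: SM.
  (* From [S u = u - (u - S u)] with [u = t (m' - S m')]. *)
  exists (- t (m' - S m')), m'; split=> //; first by apply: (ksubN hM); exact: tM.
  rewrite (klinD Slin) cS0 // add0r (klinN Slin).
  by rewrite opprK [RHS]addrAC addNr add0r.
have Qt z : Q z -> Q (t z).
  move=> [m [m' [Mm Mm' ->]]]; exists m', m; split=> //.
  rewrite (klinD tlin) tt; first exact: addrC.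
  by apply: MB => //; exact: SM.
have Q0 : exists2 z, Q z & z != 0.
  exists (m0 - S m0) => //; exists m0, 0; split=> //; first exact: ksub0.
  by rewrite (klin0 Slin) subrr (klin0 tlin) addr0.
have Qw : forall z, Q z -> b (iter n U v) z @[n --> \oo] --> (0 : R).
  move=> _ [m [m' [Mm Mm' ->]]].
  have -> : (fun n => b (iter n U v) (m - S m + t (m' - S m'))) =
      (fun n => b (iter n U v) (m - S m) + b (t (iter n U v)) (m' - S m')).
    apply/funext => n; have Mn := UnM n Mv.
    rewrite (symDr bs) bt //; apply: MB => //; exact: SM.
  by rewrite -[X in _ --> X](addr0 0); apply: cvgD; [exact: Um|exact: xm].
have [C C0 bC] := bb.
have numono n : nu n <= nu 0%N.
  elim: n => // n; apply: le_trans; rewrite -subr_ge0 nuS; apply: mulr_ge0; [exact: ltW|exact: b0].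
have bound n z : M z -> b (iter n U v) z ^+ 2 <= nu 0%N * C * `|z| ^+ 2.
  move=> Mz; rewrite (le_trans (CS _ _ (UnM n Mv) Mz)) // -mulrA.
  apply: ler_pM; [exact/b0/UnM|exact: b0|exact: numono|].
  by rewrite (le_trans (ler_norm _)) // (le_trans (bC _ _)) // expr2.
have /closure_approx wQ := full_closure hQ QM QS Qt Q0 Mw.
apply/cvgr0Pnorm_le => e e0.
pose A := nu 0%N * C; have A0 : 0 <= A by rewrite mulr_ge0.
have A1 : 0 < A + 1 by rewrite ltr_wpDl.
have [z Qz wz] := wQ (e / (2 * (A + 1))) (divr_gt0 e0 (mulr_gt0 (ltr0Sn _ 1) A1)).
have [N _ zN] := (cvgr0Pnorm_le _).1 (Qw z Qz) (e / 2) (divr_gt0 e0 (ltr0Sn _ 1)).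
exists N => // n /zN /= zn.
have -> : b (iter n U v) w = b (iter n U v) (w - z) + b (iter n U v) z.
  by rewrite -(symDr bs) subrK.
rewrite (le_trans (ler_normD _ _)) // (splitr e) lerD //.
rewrite -(ler_pXn2r (n := 2)) ?nnegrE ?divr_ge0 ?(ltW e0) //.
rewrite real_normK ?num_real // (le_trans (bound _ _ _)) //.
  by apply: MB => //; exact: QM.
rewrite -/A; move: wz; rewrite ltr_pdivlMr ?mulr_gt0 // => wz.
have h0 := normr_ge0 (w - z); move: (`|w - z|) h0 wz => y y0 wz.
have h1 : (y * (2 * (A + 1))) ^+ 2 <= e ^+ 2.
  by rewrite ler_pXn2r ?nnegrE ?mulr_ge0 ?(ltW e0) ?(ltW A1) ?(ltW wz).
have h2 : 0 <= y ^+ 2 * (4 * (A ^+ 2 + A + 1)).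
  by rewrite mulr_ge0 ?sqr_ge0 // mulr_ge0 // !addr_ge0 // sqr_ge0.
move: h1 h2; have -> : (y * (2 * (A + 1))) ^+ 2 = y ^+ 2 * (4 * (A ^+ 2 + A + 1)) + 4 * (A * y ^+ 2) by ring.
have -> : (e / 2) ^+ 2 = e ^+ 2 / 4 by field.
lra.
Qed.

(** On [S M] the form [C] represents $c-Z^2$ with respect to [b], and it is positive semidefinite by
    the choice of [c]. Each [b x f] splits into [C x (S (z f))], bounded through the small number
    [C x x], and an approximation error, bounded by [negative_functional_bound]. *)
Let not_dense (y0 : H) : M y0 -> S y0 = y0 -> b y0 y0 < 0 -> exists2 c : R, 1 <= c &
  ~ (forall w, M w -> forall e : R, 0 < e -> exists2 x, M x & `|w - (c *: x - Z (Z x))| < e).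
Proof.
move=> My0 Sy0 y0neg.
pose good c := 1 <= c /\ forall y, M y -> S y = y -> b (Z y) (Z y) <= c * b y y.
have good1 : good 1 by split=> // y My Sy; rewrite mul1r; exact: center_le.
(* A negative [y] reverses the inequality into an upper bound for [c]; this is why the supremum is
   finite. *)
have ub y : M y -> S y = y -> b y y < 0 -> ubound good (b (Z y) (Z y) / b y y).
  by move=> My Sy yneg c [_ /(_ y My Sy)]; rewrite ler_ndivlMr.
have supg : has_sup good by split; [exists 1|exists (b (Z y0) (Z y0) / b y0 y0); exact: ub].
pose c := sup good; have c1 : 1 <= c by exact: (ub_le_sup supg.2).
have cgood y : M y -> S y = y -> b (Z y) (Z y) <= c * b y y.
  move=> My Sy; have [yp|yn] := leP 0 (b y y).
    by rewrite (le_trans (center_le My Sy)) // ler_peMl.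
  by rewrite -ler_ndivlMr //; apply: ge_sup; [exists 1|exact: ub].
exists c => // dense; have [fs fsP] := FI.
have [A A0 bA] := negative_functional_bound bs bb fsP.
pose C v w := c * b v w - b (Z v) (Z w).
have Cs : sym_bilinear C.
  split=> [v w|r u v w]; first by rewrite /C (symC bs) (symC bs (Z v)).
  by rewrite /C (klinD Zlin) (klinZ Zlin) !(symDl bs (_ *: _)) !(symZl bs); ring.
pose Y := [set y | M y /\ S y = y].
have CCS x y : Y x -> Y y -> C x y ^+ 2 <= C x x * C y y.
  apply: (sym_CS Cs) => [z [Mz Sz]|r z z' [Mz Sz] [Mz' Sz']].
    by rewrite /C subr_ge0 cgood.
  by split; [apply: MD => //; exact: MZ|rewrite (klinD Slin) (klinZ Slin) Sz Sz'].
pose r : R := (size fs)%:R; have r0 : 0 <= r by exact: ler0n.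
(* [del] and, below, [e] make the two errors, summed over [fs], at most 1/4 and 1/2, against a total
   of 1. *)
pose del := Num.sqrt (8 * (A + 1) * (r + 1))^-1.
have X0 : 0 < 8 * (A + 1) * (r + 1) by rewrite !mulr_gt0 // ltr_wpDl.
have del0 : 0 < del by rewrite sqrtr_gt0 invr_gt0.
have del2 : del ^+ 2 = (8 * (A + 1) * (r + 1))^-1 by rewrite sqr_sqrtr // invr_ge0 ltW.
have /choice[z zP] : forall f, exists x, M x /\ `|S (P f) - (c *: x - Z (Z x))| < del.
  by move=> f; have [x Mx fx] := dense _ (SM (PM f)) _ del0; exists x.
pose G := \sum_(f <- fs) C (S (z f)) (S (z f)).
have YS x : M x -> Y (S x) by move=> Mx; split; [exact: SM|exact: SS].
have C0 x : Y x -> 0 <= C x x by case=> Mx Sx; rewrite subr_ge0 cgood.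
have G0 : 0 <= G by apply: sumr_ge0 => f _; apply/C0/YS; have [] := zP f.
pose e := (4 * (G + 1))^-1; have e0 : 0 < e by rewrite invr_gt0 mulr_gt0 // ltr_wpDl.
(* Otherwise [c + e] would be good as well. Since [C y y] is nonnegative, such a [y] is negative. *)
have [y [My Sy yn]] : exists y, [/\ M y, S y = y & C y y < - e * b y y].
  apply: contrapT => nex; have : good (c + e).
    split=> [|y My Sy]; first by rewrite (le_trans c1) // lerDl ltW.
    rewrite leNgt; apply/negP => lt; apply: nex; exists y; split=> //.
    by rewrite /C; move: lt; rewrite mulrDl mulNr; lra.
  by move/(ub_le_sup supg.2); rewrite leNgt ltrDl e0.
have yneg : b y y < 0.
  have := C0 _ (conj My Sy : Y y) => /le_lt_trans/(_ yn).
  by rewrite mulNr oppr_gt0 pmulr_rlt0.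
pose s := \sum_(f <- fs) b y f ^+ 2.
have s0 : 0 < s by have := fsP y; rewrite -/s; lra.
pose g := (Num.sqrt s)^-1; have g0 : 0 < g by rewrite invr_gt0 sqrtr_gt0.
have g2 : g ^+ 2 * s = 1 by rewrite exprVn sqr_sqrtr ?ltW // mulVf ?gt_eqF.
pose x := g *: y; have Mx : M x by exact: MZ.
have Sx : S x = x by rewrite (klinZ Slin) Sy.
have xE : b x x = g ^+ 2 * b y y by rewrite (symZl bs) (symZr bs); ring.
have x1 : \sum_(f <- fs) b x f ^+ 2 = 1.
  rewrite -g2 mulr_sumr; apply: eq_bigr => f _.
  by rewrite (symZl bs) exprMn.
have xneg : b x x <= 0 by rewrite xE nmulr_lle0 // sqr_ge0.
have Cx : C x x <= e.
  have -> : C x x = g ^+ 2 * C y y.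
    by rewrite /C xE (klinZ Zlin) (symZl bs) (symZr bs); ring.
  have xb : - b x x <= 1 by have := fsP x; rewrite x1; lra.
  have : g ^+ 2 * C y y <= g ^+ 2 * (- e * b y y).
    by rewrite ler_wpM2l ?sqr_ge0 // ltW.
  have -> : g ^+ 2 * (- e * b y y) = e * - b x x by rewrite xE; ring.
  by move=> /le_trans; apply; rewrite ler_piMr // ltW.
have bf f : b x f ^+ 2 <= 2 * A * del ^+ 2 + 2 * e * C (S (z f)) (S (z f)).
  have [Mz zf] := zP f; set w := c *: z f - Z (Z (z f)) in zf.
  have Mw : M w by apply: MB; [exact: MZ|exact/ZM/ZM].
  have -> : b x f = b x (S (P f) - w) + C x (S (z f)).
    have -> : C x (S (z f)) = b x w.
      have Sw : S w = c *: S (z f) - Z (Z (S (z f))).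
        by rewrite /w (klinB Slin) (klinZ Slin) (ZS Mz) (ZS (ZM Mz)).
      rewrite -[in RHS]Sx bS // Sw (symBr bs) (symZr bs) /C Zb //.
      exact/ZM/SM.
    by rewrite -(symDr bs) subrK -bS // Sx bP.
  have h1 := bA x xneg x1 (S (P f) - w).
  have h2 : `|S (P f) - w| ^+ 2 <= del ^+ 2 by rewrite ler_pXn2r ?nnegrE ?(ltW del0) // ltW.
  have h3 := CCS x (S (z f)) (conj Mx Sx) (YS _ Mz).
  have h4 : C x x * C (S (z f)) (S (z f)) <= e * C (S (z f)) (S (z f)).
    by apply: ler_wpM2r => //; exact/C0/YS.
  have h5 : A * `|S (P f) - w| ^+ 2 <= A * del ^+ 2 by rewrite ler_wpM2l.
  move: (b x (S (P f) - w)) (C x (S (z f))) h1 h3 => p1 p2 h1 h3.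
  have h6 := sqr_ge0 (p1 - p2).
  have -> : (p1 + p2) ^+ 2 = 2 * p1 ^+ 2 + 2 * p2 ^+ 2 - (p1 - p2) ^+ 2 by ring.
  lra.
have : \sum_(f <- fs) b x f ^+ 2 <= 2 * A * del ^+ 2 * r + 2 * e * G.
  rewrite /G mulr_sumr /r.
  have -> : 2 * A * del ^+ 2 * (size fs)%:R = \sum_(f <- fs) 2 * A * del ^+ 2.
    by rewrite big_const_seq count_predT iter_addr_0 mulr_natr.
  by rewrite -big_split; apply: ler_sum => f _; exact: bf.
rewrite x1 del2.
have -> : 2 * A * (8 * (A + 1) * (r + 1))^-1 * r = (A / (A + 1)) * (r / (r + 1)) / 4.
  by field; rewrite !gt_eqF // ltr_wpDl.
have -> : 2 * e * G = (G / (G + 1)) / 2 by rewrite /e; field; rewrite gt_eqF // ltr_wpDl.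
have frac (a : R) : 0 <= a -> 0 <= a / (a + 1) <= 1.
  move=> a0; have a1 : 0 < a + 1 by rewrite ltr_wpDl.
  by rewrite divr_ge0 ?(ltW a1) //= ler_pdivrMr // mul1r lerDl.
have /andP[l1 u1] := frac _ A0; have /andP[l2 u2] := frac _ r0; have /andP[l3 u3] := frac _ G0.
have u4 : A / (A + 1) * (r / (r + 1)) <= 1 by rewrite mulr_ile1.
lra.
Qed.

(** The image of $c-Z^2$ is a submodule that is not dense, hence zero. Thus
    $(Z-\lambda)(Z+\lambda)=0$ for $\lambda=\sqrt c$, and by irreducibility one factor vanishes. *)
Let center_scalar (y0 : H) : M y0 -> S y0 = y0 -> b y0 y0 < 0 ->
  exists2 lam : R, 1 <= lam ^+ 2 & forall v, M v -> Z v = lam *: v.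
Proof.
move=> My0 Sy0 y0neg; have [c c1 ndense] := not_dense My0 Sy0 y0neg.
pose F x := c *: x - Z (Z x).
have Flin : klinear F.
  split=> [u v|v a]; rewrite /F.
    by rewrite scalerDr !(klinD Zlin) opprD addrACA.
  by rewrite -rmulZ !(klinM Zlin) -rmulNl -rmulDl.
pose Q := [set z | exists2 x, M x & z = F x].
have FM x : M x -> M (F x) by move=> Mx; apply: MB; [exact: MZ|exact/ZM/ZM].
have FS x : M x -> S (F x) = F (S x).
  by move=> Mx; rewrite /F (klinB Slin) (klinZ Slin) (ZS Mx) (ZS (ZM Mx)).
have Ft x : M x -> t (F x) = F (t x).
  by move=> Mx; rewrite /F (klinB tlin) (klinZ tlin) (Zt Mx) (Zt (ZM Mx)).
have F0 x : M x -> F x = 0.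
  move=> Mx; apply: contrapT => /eqP Fx; apply: ndense => w Mw e e0.
  have /closure_approx/(_ e e0)[_ [z Mz ->]] : closure Q w; last by exists z.
  apply: full_closure Mw.
  - split.
    + by exists 0; [exact: ksub0|rewrite (klin0 Flin)].
    + by move=> _ _ [u Mu ->] [v Mv ->]; exists (u + v); [exact: MD|rewrite (klinD Flin)].
    + by move=> _ a [u Mu ->]; exists (u *> a); [exact: ksubM|rewrite (klinM Flin)].
  - by move=> _ [u Mu ->]; exact: FM.
  - by move=> _ [u Mu ->]; exists (S u); [exact: SM|exact: FS].
  - by move=> _ [u Mu ->]; exists (t u); [exact: tM|exact: Ft].
  by exists (F x) => //; exists x.
have ZZ x : M x -> Z (Z x) = c *: x by move=> /F0/eqP; rewrite subr_eq0 => /eqP.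
pose lam := Num.sqrt c.
have lam2 : lam ^+ 2 = c by rewrite sqr_sqrtr // (le_trans ler01).
have [ex|nex] := pselect (exists2 v, M v /\ Z v = lam *: v & v != 0).
  by exists lam; [rewrite lam2|exact: kernel_center].
exists (- lam) => [|v Mv]; first by rewrite sqrrN lam2.
have : Z v + lam *: v = 0.
  apply: contrapT => /eqP u0; apply: nex; exists (Z v + lam *: v) => //.
  split; first by apply: MD; [exact: ZM|exact: MZ].
  rewrite (klinD Zlin) (klinZ Zlin) ZZ // [RHS]scalerDr addrC; congr (_ + _).
  by rewrite scalerA -expr2 lam2.
by move/eqP; rewrite addr_eq0 scaleNr => /eqP.
Qed.

(** Since [S t S = lam S], the vectors whose images under [S] and [S t] lie on the line of [f] form
    a closed submodule, which contains [f]. *)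
Let sphere_line (lam : R) (f : H) : (forall v, M v -> Z v = lam *: v) ->
  M f -> S f = f -> f != 0 -> forall v, M v -> exists c : K, S v = f *> c.
Proof.
move=> Zl Mf Sf f0 v Mv.
have Stf x : M x -> S (t (S x)) = lam *: S x.
  by move=> Mx; rewrite -(Zl _ (SM Mx)) /Z /center (SS Mx) addrK.
pose L := [set v | [/\ M v, exists c : K, S v = f *> c & exists c : K, S (t v) = f *> c]].
suff /(_ v Mv)[] : M `<=` L by [].
have [CS hS] := Sbnd; have [Ct ht] := tbnd.
apply: irr => //.
- split.
  + split; first exact: ksub0.
      by exists 0; rewrite (klin0 Slin) rmul0.
    by exists 0; rewrite (klin0 tlin) (klin0 Slin) rmul0.
  + move=> x y [Mx [c xc] [c' xc']] [My [d yd] [d' yd']]; split; first exact: MD.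
      by exists (c + d); rewrite (klinD Slin) xc yd rmulDr.
    by exists (c' + d'); rewrite (klinD tlin) (klinD Slin) xc' yd' rmulDr.
  + move=> x a [Mx [c xc] [c' xc']]; split; first exact: ksubM.
      by exists (c * a); rewrite (klinM Slin) xc rmulM.
    by exists (c' * a); rewrite (klinM tlin) (klinM Slin) xc' rmulM.
- have cpre (F : H -> H) (C : R) : (forall u v, F (u - v) = F u - F v) ->
      (forall u, `|F u| <= C * `|u|) -> forall x,
      (forall e : R, 0 < e -> exists2 w, (exists c : K, F w = f *> c) & `|x - w| < e) ->
      exists c : K, F x = f *> c.
    move=> FB FC x app; apply: (@closed_line _ _ _ f); apply/closure_approx => e e0.
    have C1 : 0 < `|C| + 1 by rewrite ltr_wpDl.
    have [w Fw xw] := app _ (divr_gt0 e0 C1); exists (F w) => //.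
    rewrite -FB (le_lt_trans (FC _)) //; move: xw; rewrite ltr_pdivlMr //.
    apply: le_lt_trans; rewrite mulrC ler_wpM2l //.
    by rewrite (le_trans (ler_norm C)) // lerDl.
  apply: closed_approx => x app; split.
  + by apply: cM; apply/closure_approx => e /app[w [Mw _ _] ?]; exists w.
  + apply: (cpre S CS) => //; first exact: klinB.
    by move=> e /app[w [_ ? _] ?]; exists w.
  apply: (cpre (S \o t) (`|CS| * Ct)) => /=.
  + by move=> u u'; rewrite (klinB tlin) (klinB Slin).
  + move=> u; rewrite (le_trans (hS _)) //.
    rewrite (le_trans (ler_wpM2r _ (ler_norm CS))) // -mulrA ler_wpM2l //.
  by move=> e /app[w [_ _ ?] ?]; exists w.
- by move=> x [].
- move=> x [Mx [c xc] _]; split; first exact: SM.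
    by exists c; rewrite SS.
  by exists (c * kreal k lam); rewrite Stf // xc rmulM rmul_real.
- move=> x [Mx xc xc']; split; [exact: tM|exact: xc'|by rewrite tt].
exists f => //; split=> //; first by exists 1; rewrite rmul1.
by exists (kreal k lam); rewrite -{1}Sf Stf // Sf rmul_real.
Qed.

Let Ulin : klinear U.
Proof.
split=> [u v|v a]; rewrite /U /hecke.
  rewrite !(klinD tlin, klinD Slin) [in LHS]opprD [X in q^-1 *: X]addrACA.
  by rewrite scalerDr opprD addrACA.
by rewrite (klinM tlin) (klinM Slin) -rmulNl -rmulDl -rmulZ -rmulNl -rmulDl.
Qed.

Let hecke_quadratic (lam : R) : (forall v, M v -> Z v = lam *: v) -> forall v, M v ->
  U (U v) = ((1 + q^-1) * lam) *: U v - q^-1 *: v.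
Proof.
move=> Zl v Mv; have Mt := tM Mv; have MSt := SM Mt.
have tSt : t (S (t v)) = lam *: t v + v - S v.
  have := Zl _ Mt; rewrite /Z /center (tt Mv) => <-.
  by rewrite (addrC (S v)) subrK addrK.
have StSt : S (t (S (t v))) = lam *: S (t v).
  by rewrite tSt (klinB Slin) (klinD Slin) (klinZ Slin) (SS Mv) addrK.
rewrite -(hecke_identity (S (t v)) (S v) (t v) v).
have tU : t (U v) = (lam *: t v + v - S v) - q^-1 *: (v - (lam *: t v + v - S v)).
  by rewrite /U /hecke (klinB tlin) (klinZ tlin) (klinB tlin) (tt Mv) tSt.
have StU : S (t (U v)) = lam *: S (t v) - q^-1 *: (S v - lam *: S (t v)).
  by rewrite /U /hecke (klinB tlin) (klinZ tlin) (klinB tlin) (tt Mv)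
    (klinB Slin) (klinZ Slin) (klinB Slin) StSt.
by rewrite {1}/U /hecke StU tU.
Qed.

(** By the quadratic relation [v'] satisfies [U v' = z1 *: v']. As [S] kills it,
    [S (t v') = S (U v') = 0], so [U] acts on [v'] as [- q^-1 t]. Hence [t v'] is [- (q * z1)] times
    [v'], which [t (t v') = v'] allows only for [v' = 0]. *)
Let eigen_decay (lam z1 z2 : R) v : (forall v, M v -> Z v = lam *: v) ->
  z1 + z2 = (1 + q^-1) * lam -> z1 * z2 = q^-1 -> 1 < (q * z1) ^+ 2 ->
  M v -> S (U v - z2 *: v) = 0 -> U v = z2 *: v.
Proof.
move=> Zl zD zM qz Mv; set v' := U v - z2 *: v => Sv'.
have Mv' : M v' by apply: MB; [exact: UM|exact: MZ].
have q0 : q != 0 by rewrite gt_eqF // (lt_trans _ q1).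
have Uv' : U v' = z1 *: v'.
  rewrite (klinB Ulin) (klinZ Ulin) (hecke_quadratic Zl) // -zD -zM.
  by rewrite scalerDl addrAC addrK /v' [RHS]scalerBr scalerA.
have SU w : M w -> S (U w) = S (t w).
  move=> Mw; have Mt := tM Mw.
  by rewrite /U /hecke (klinB Slin) (klinZ Slin) (klinB Slin) (SS Mt) subrr scaler0 subr0.
have Stv' : S (t v') = 0 by rewrite -SU // Uv' (klinZ Slin) Sv' scaler0.
have tv' : t v' = (- (q * z1)) *: v'.
  have : U v' = - (q^-1 *: t v') by rewrite /U /hecke Stv' subr0 sub0r.
  rewrite Uv' => /(congr1 (fun x => - (q *: x))).
  by rewrite scalerN opprK !scalerA divff // scale1r scaleNr => <-.
have : v' = (q * z1) ^+ 2 *: v'.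
  by rewrite -[LHS]tt // tv' (klinZ tlin) tv' scalerA mulrNN.
move/eqP; rewrite -[X in X == _]scale1r -subr_eq0 -scalerBl scaler_eq0 subr_eq0.
by rewrite lt_eqF //= subr_eq0 => /eqP.
Qed.

Lemma hecke_decay : exists (f : H) (L : H -> H), [/\ klinear L,
  forall v, M v -> exists c : K, L v = f *> c &
  forall v, M v -> L v = 0 -> forall w, M w ->
    b (iter n hecke v) w @[n --> \oo] --> (0 : R)].
Proof.
have [b0|] := pselect (forall v, M v -> 0 <= b v v).
  have [m0|nm] := pselect (exists2 m, M m & m - S m != 0).
    exists 0, (fun=> 0); split.
    - by split=> *; rewrite ?addr0 ?rmul0l.
    - by move=> v _; exists 0; rewrite rmul0.
    by move=> v Mv _ w Mw; exact: decay_nonneg.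
  (* Here [Z = t] on [M], so [t] is 1 or -1, and [sphere_line] with [S] the identity shows that [M]
     is at most a line; [L] is then the identity. *)
  have S1 v : M v -> S v = v.
    move=> Mv; apply/eqP; rewrite eq_sym -subr_eq0; apply/negP => /negP mS.
    by apply: nm; exists v.
  have Zt1 v : M v -> Z v = t v by move=> Mv; rewrite /Z /center !S1 ?addrK //; exact: tM.
  suff [f fP] : exists f : H, forall v, M v -> exists c : K, v = f *> c.
    exists f, id; split=> // v Mv -> w Mw.
    have -> : (fun n => b (iter n hecke 0) w) = (fun=> 0); last exact: cvg_cst.
    apply/funext => n; suff -> : iter n hecke 0 = 0 by rewrite (sym0l bs).
    by elim: n => //= n ->; exact: (klin0 Ulin).
  have [[v0 Mv0 v00]|nv] := pselect (exists2 v, M v & v != 0); last first.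
    exists 0 => v Mv; exists 0; rewrite rmul0; apply: contrapT => /eqP v0.
    by apply: nv; exists v.
  have [lam Zl] : exists lam : R, forall v, M v -> Z v = lam *: v.
    have [ex|nex] := pselect (exists2 v, M v /\ Z v = 1 *: v & v != 0).
      by exists 1; exact: kernel_center.
    exists (-1) => v Mv; have : v + t v = 0.
      apply: contrapT => /eqP u0; apply: nex; exists (v + t v) => //.
      have Mu : M (v + t v) by apply: MD => //; exact: tM.
      by split=> //; rewrite Zt1 // (klinD tlin) tt // scale1r addrC.
    by rewrite Zt1 // scaleN1r => /eqP; rewrite addrC addr_eq0 => /eqP.
  exists v0 => v Mv; rewrite -[v]S1 //.
  by apply: sphere_line Zl _ _ _ _ Mv => //; exact: S1.
move=> nb0; have [v Mv vneg] : exists2 v, M v & b v v < 0.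
  apply: contrapT => nex; apply: nb0 => v Mv; rewrite leNgt; apply/negP => vneg.
  by apply: nex; exists v.
have Mf := SM Mv; have Sf := SS Mv.
have fneg : b (S v) (S v) < 0.
  by move: vneg; rewrite split_norm //; have := pos_compl Mv; lra.
have f0 : S v != 0 by apply: contraTneq fneg => ->; rewrite (sym0l bs) ltxx.
have [lam lam1 Zl] := center_scalar Mf Sf fneg.
have [z1 [z2 [zD zM z2lt qz]]] := hecke_roots q1 lam1.
exists (S v), (fun u => S (U u - z2 *: u)); split.
- split=> [x y|x a].
    by rewrite (klinD Ulin) scalerDr opprD addrACA; exact: (klinD Slin).
  by rewrite (klinM Ulin) -rmulZ -rmulNl -rmulDl; exact: (klinM Slin).
- move=> x Mx; apply: sphere_line Zl Mf Sf f0 _ _.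
  by apply: MB; [exact: UM|exact: MZ].
move=> x Mx Lx w Mw; have Ux := eigen_decay Zl zD zM qz Mx Lx.
have -> : (fun n => b (iter n hecke x) w) = (fun n => z2 ^+ n * b x w).
  apply/funext => n; rewrite -(symZl bs); congr (b _ w).
  elim: n => [|n IH]; first by rewrite scale1r.
  by rewrite iterS IH -/U (klinZ Ulin) Ux scalerA exprSr.
have := @cvgMr_tmp _ _ _ _ _ 0 (b x w) (cvg_expr z2lt); rewrite mul0r; exact.
Qed.

End HeckeModule.

(** * Averages over subgroups of a vertex stabilizer *)

Lemma nbhs_tree_aut (V : choiceType) (adj : rel V) (g0 : tree_aut adj)
  (A : set (tree_aut adj)) : nbhs g0 A ->
  exists F : seq V, forall g : tree_aut adj, (forall x, x \in F -> g x = g0 x) -> A g.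
Proof.
rewrite nbhsE => -[B [[D oD <-] Bg0] BA].
pose base (F : seq V) : set (V -> discrete_topology V) :=
  [set f | forall x, x \in F -> f x = g0 x].
pose FF := filter_from [set: seq V] base.
have FFf : Filter FF.
  apply: filter_from_filter; first by exists [::].
  move=> F1 F2 _ _; exists (F1 ++ F2) => // f fF.
  by split=> x xF; apply: fF; rewrite mem_cat xF ?orbT.
have cv : {ptws, FF --> (g0 : V -> discrete_topology V)}.
  apply/cvg_sup => x A'; rewrite nbhsE => -[C [[D' _ <-] D'g0] CA'].
  exists [:: x] => // f /= ff; apply: CA'.
  by rewrite /preimage /= /proj ff ?inE.
have [F _ FD] := cv D (open_nbhs_nbhs (conj oD Bg0)).
by exists F => g gF; apply: BA; apply: FD.
Qed.

(** * Uniform boundedness on a vertex stabilizer *)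

Section Representation.
Variables (V : choiceType) (adj : rel V) (hT : is_tree adj).
Variables (d : nat) (nb : V -> 'I_d -> V) (hnb : coloring adj nb) (o : V).
Variables (R : realType) (k : scalar_kind) (H : hilbertType R k).
Variables (pi : tree_aut adj -> H -> H) (hpi : continuous_rep pi).
Implicit Types (g h : tree_aut adj) (v w : H).

Lemma rep_linear g : klinear (pi g). Proof. by case: hpi => /(_ g)[]. Qed.
Lemma rep_bounded g : bounded_op (pi g). Proof. by case: hpi => /(_ g)[]. Qed.
Lemma repM g h v : pi (g * h)%g v = pi g (pi h v).
Proof. by case: hpi => _ -> _. Qed.
Lemma rep1 v : pi 1%g v = v.
Proof.
case: hpi => /(_ 1%g)[_ _ [f [_ _ K1 _]]] _ _.
by rewrite -[RHS]K1 -{2}(mulg1 1%g) repM K1.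
Qed.
Lemma repKV g v : pi g (pi g^-1%g v) = v. Proof. by rewrite -repM mulgV rep1. Qed.

Lemma rep_near v g0 (e : R) : 0 < e -> exists F : seq V, forall g,
  (forall x, x \in F -> g x = g0 x) -> `|pi g v - pi g0 v| < e.
Proof.
move=> e0; case: hpi => _ _ /(_ v g0) /cvgrPdist_lt /(_ e e0) /nbhs_tree_aut [F FP].
by exists F => g /FP /=; rewrite distrC.
Qed.

Let ball := tree_ball nb o.
Let mem_ball n x : (x \in ball n) = (dist hT o x <= n)%N := mem_tree_ball hT hnb o n x.

Definition agree n g h : Prop := forall x, (dist hT o x <= n)%N -> g x = h x.

Lemma seq_in_ball (F : seq V) : exists n, forall x, x \in F -> (dist hT o x <= n)%N.
Proof.
elim: F => [|x F [n nF]]; first by exists 0%N.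
exists (maxn n (dist hT o x)) => z; rewrite inE => /orP[/eqP ->|/nF zn].
  exact: leq_maxr.
exact: leq_trans (leq_maxl _ _).
Qed.

Lemma stab_dist g x : g o = o -> dist hT o (g x) = dist hT o x.
Proof. by move=> {1}<-; rewrite dist_aut. Qed.

(* The restriction of g to a ball, coded by positions in the list tree_ball; the
   out-of-range index never occurs when g fixes o. *)
Definition ball_code n g : {ffun 'I_(size (ball n)) -> 'I_(size (ball n)).+1} :=
  [ffun i => inord (index (g (tnth (in_tuple (ball n)) i)) (ball n))].

Lemma ball_codeP n g h : g o = o -> h o = o ->
  ball_code n g = ball_code n h <-> agree n g h.
Proof.
move=> go ho; split=> [/ffunP gh x xn|gh]; last first.
  apply/ffunP => i; rewrite !ffunE gh //.
  by rewrite -mem_ball mem_tnth.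
have xb : x \in ball n by rewrite mem_ball.
have ib : (index x (ball n) < size (ball n))%N by rewrite index_mem.
move: (gh (Ordinal ib)); rewrite !ffunE (tnth_nth x) /= nth_index //.
have inb (f : tree_aut adj) : f o = o -> f x \in ball n.
  by move=> fo; rewrite mem_ball stab_dist.
move=> /(congr1 val); rewrite /= !inordK ?ltnS ?index_size // => e.
by rewrite -[LHS](nth_index x (inb g go)) e nth_index // inb.
Qed.

(** Compactness of the stabilizer of [o] as a diagonal argument: an unbounded orbit is unbounded on
    nested classes of automorphisms agreeing on growing balls. These converge to some [g], and
    continuity at [g] bounds the orbit on a small enough class. *)
Lemma orbit_bounded v : exists C : R, forall g, g o = o -> `|pi g v| <= C.
Proof.
apply: contrapT => nb_; pose bad n g := g o = o /\
  forall C : R, exists h, [/\ h o = o, agree n g h & C < `|pi h v|].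
have bad0 : bad 0%N 1%g.
  split=> // C; apply: contrapT => nex; apply: nb_; exists C => g go.
  rewrite leNgt; apply/negP => lt; apply: nex; exists g; split=> // x.
  by rewrite leqn0 dist_eq0 => /eqP <-; rewrite go.
have step n g : bad n g -> exists h, agree n g h /\ bad n.+1 h.
  move=> [go badg]; apply: contrapT => nex.
  (* Only finitely many codes occur on the next ball; if no refinement were bad, the sum of their
     bounds would bound the whole class of [g]. *)
  have /choice[C CP] : forall c, exists C : R, forall h, h o = o -> agree n g h ->
      ball_code n.+1 h = c -> `|pi h v| <= C.
    move=> c; have [[h [ho gh hc]]|nh] :=
        pselect (exists h, [/\ h o = o, agree n g h & ball_code n.+1 h = c]); last first.
      by exists 0 => h ho gh hc; case: nh; exists h.
    apply: contrapT => nC; apply: nex; exists h; split=> //; split=> // C.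
    apply: contrapT => nh; apply: nC; exists C => h' ho' gh' hc'.
    rewrite leNgt; apply/negP => lt; apply: nh; exists h'; split=> //.
    by apply/ball_codeP => //; rewrite hc hc'.
  have [h [ho gh]] := badg (\sum_c `|C c|); apply/negP; rewrite -leNgt.
  apply: (le_trans (CP _ h ho gh erefl)).
  rewrite (bigD1 (ball_code n.+1 h)) //= (le_trans (ler_norm _)) // lerDl.
  by apply: sumr_ge0.
have /choice[f fP] : forall ng : nat * tree_aut adj, exists h,
    bad ng.1 ng.2 -> agree ng.1 ng.2 h /\ bad ng.1.+1 h.
  move=> [n g] /=; have [bg|nbg] := pselect (bad n g); last by exists 1%g.
  by have [h hP] := step n g bg; exists h.
pose ks := fix ks n := if n is m.+1 then f (m, ks m) else 1%g.
have ksbad n : bad n (ks n) by elim: n => //= n /(fP (n, ks n))[].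
have kso n : ks n o = o by have [] := ksbad n.
have ksS n : agree n (ks n) (ks n.+1) by have [] := fP (n, ks n) (ksbad n).
have kslim m n x : (dist hT o x <= m)%N -> (m <= n)%N -> ks n x = ks m x.
  move=> xm; elim: n => [|n IH]; first by rewrite leqn0 => /eqP ->.
  rewrite leq_eqVlt => /orP[/eqP -> //|]; rewrite ltnS => mn.
  by rewrite -ksS ?IH // (leq_trans xm).
(* The maps [ks n] stabilize on each ball, so [x] may be evaluated at stage [dist hT o x]; as they
   preserve the distance to [o], the same stage serves for the inverse. *)
pose l x := ks (dist hT o x) x; pose l' x := aut_inv (ks (dist hT o x)) x.
have lK : cancel l l' by move=> x; rewrite /l' stab_dist // aut_funK.
have l'K : cancel l' l.
  move=> x; rewrite /l; have -> : dist hT o (l' x) = dist hT o x.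
    by rewrite -[in RHS](aut_invK (ks (dist hT o x)) x) stab_dist.
  by rewrite /l' aut_invK.
have ladj x y : adj (l x) (l y) = adj x y.
  pose n := maxn (dist hT o x) (dist hT o y).
  by rewrite /l -(@kslim _ n) ?leq_maxl // -(@kslim _ n y) ?leq_maxr // aut_adj.
pose g := Defs.Aut lK l'K ladj.
have [F FP] := @rep_near v g 1 ltr01.
have [n nF] := seq_in_ball F.
have [_ /(_ (`|pi g v| + 1))[h [ho gh]]] := ksbad n.
apply/negP; rewrite -leNgt.
have := FP h; have hF x : x \in F -> h x = g x.
  by move=> xF; rewrite -gh ?nF // /= /l (@kslim (dist hT o x) n) // nF.
move=> /(_ hF) /ltW; rewrite -lerBlDl; apply: le_trans.
exact: lerB_dist.
Qed.

Lemma stab_uniform : exists2 C : R, 0 <= C &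
  forall g, g o = o -> forall v, `|pi g v| <= C * `|v|.
Proof.
pose F : set (H -> H) := [set pi g | g in [set g : tree_aut adj | g o = o]].
have [||C CP] := @Banach_Steinhauss R H H F _ _ 1.
- move=> _ [g _ <-]; split.
    have [C gC] := rep_bounded g => r; exists (`|C| * `|r|) => x xr.
    rewrite (le_trans (gC x)) // (le_trans (ler_wpM2r _ (ler_norm _))) //.
    by rewrite ler_wpM2l // (le_trans xr) // ler_norm.
  by move=> r u w; rewrite (klinD (rep_linear g)) (klinZ (rep_linear g)).
- move=> x; have [C CP] := orbit_bounded x.
  by exists C => _ [g go <-]; exact: CP.
have C0 : 0 <= C.
  have F1 : F (pi 1%g) by exists 1%g.
  by have := CP _ F1 0; rewrite normr0 => /(_ ler01); apply: le_trans.
exists C => // g go v; have [->|v0] := eqVneq v 0.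
  by rewrite (klin0 (rep_linear g)) normr0 mulr0.
have vp : 0 < `|v| by rewrite normr_gt0.
have := CP (pi g) (ex_intro2 _ _ g go erefl) (`|v|^-1 *: v).
rewrite (klinZ (rep_linear g)) !normrZ normfV normr_id mulVf ?gt_eqF // => /(_ (lexx _)).
by rewrite mulrC ler_pdivrMr.
Qed.

End Representation.

(** * Invariant averages as limits of finite sums *)

Section Average.
Variables (V : choiceType) (adj : rel V) (hT : is_tree adj).
Variables (d : nat) (nb : V -> 'I_d -> V) (hnb : coloring adj nb) (o : V).
Variables (R : realType) (k : scalar_kind) (H : hilbertType R k).
Variables (pi : tree_aut adj -> H -> H) (hpi : continuous_rep pi).
Variable Q : set (tree_aut adj).
Hypotheses (Q1 : Q 1%g) (QM : forall g h, Q g -> Q h -> Q (g * h)%g).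
Hypotheses (Qo : forall g, Q g -> g o = o).
Implicit Types (g h : tree_aut adj) (v w : H).

Let code n := @ball_code V adj d nb o n.
Let codeP n g h : Q g -> Q h -> code n g = code n h <-> agree hT o n g h.
Proof. by move=> Qg Qh; apply: ball_codeP => //; exact: Qo. Qed.

Let codes n := [set c | `[< exists2 g, Q g & code n g = c >]]%SET.

Let lift n (c : {ffun 'I_(size (tree_ball nb o n)) -> 'I_(size (tree_ball nb o n)).+1}) :
  tree_aut adj := xget 1%g [set g | Q g /\ code n g = c].

Let liftP n c : c \in codes n -> Q (lift c) /\ code n (lift c) = c.
Proof.
rewrite inE => /asboolP[g Qg gc]; rewrite /lift; case: xgetP => [h _ //|].
by move=> /(_ g)[].
Qed.

Let code_in n g : Q g -> code n g \in codes n.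
Proof. by move=> Qg; rewrite inE; apply/asboolP; exists g. Qed.

Let codes_gt0 n : (0 : R) < #|codes n|%:R.
Proof.
rewrite ltr0n; apply/card_gt0P; exists (code n 1%g); exact: code_in.
Qed.

(* Riemann sums of the orbit map g |-> pi g v on Q, one term for each
   restriction to the ball of radius n. *)
Definition finite_average n v : H :=
  (#|codes n|%:R)^-1 *: \sum_(c in codes n) pi (lift c) v.

Let S := finite_average.

Let Slin n : klinear (S n).
Proof.
split=> [u v|v a]; rewrite /S /finite_average.
  rewrite -scalerDr -big_split /=; congr (_ *: _); apply: eq_bigr => c _.
  by rewrite (klinD (rep_linear hpi _)).
rewrite rmulZ; congr (_ *: _); elim/big_rec2: _ => [|c x y _ ->].
  by rewrite rmul0l.
by rewrite (klinM (rep_linear hpi _)) rmulDl.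
Qed.

Let avg_le n (F : _ -> H) (x : H) (e : R) :
  (forall c, c \in codes n -> `|F c - x| <= e) ->
  `|(#|codes n|%:R)^-1 *: (\sum_(c in codes n) F c) - x| <= e.
Proof.
move=> Fx; have n0 := codes_gt0 n.
have -> : (#|codes n|%:R)^-1 *: (\sum_(c in codes n) F c) - x =
    (#|codes n|%:R)^-1 *: (\sum_(c in codes n) (F c - x)).
  rewrite sumrB scalerBr sumr_const -(scaler_nat _ x) scalerA mulVf ?gt_eqF //.
  by rewrite scale1r.
rewrite normrZ gtr0_norm ?invr_gt0 // ler_pdivrMl //.
rewrite (le_trans (ler_norm_sum _ _ _)) // (le_trans (ler_sum _ Fx)) //.
by rewrite sumr_const mulr_natl.
Qed.

Let close n v (e : R) := forall g h, Q g -> Q h -> agree hT o n g h ->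
  `|pi g v - pi h v| <= e.

(** [phi] induces an injective self-map of the finite set [codes n], hence a permutation. The sum is
    only reordered, up to a change of representatives that costs [e]. *)
Let avg_shift n v (e : R) (phi : tree_aut adj -> tree_aut adj) :
  (forall g, Q g -> Q (phi g)) ->
  (forall g h, Q g -> Q h -> agree hT o n (phi g) (phi h) -> agree hT o n g h) ->
  close n v e ->
  `|(#|codes n|%:R)^-1 *: (\sum_(c in codes n) pi (phi (lift c)) v) - S n v| <= e.
Proof.
move=> Qphi phi_inj ce; have n0 := codes_gt0 n.
pose psi c := code n (phi (@lift n c)).
have psi_in c : c \in codes n -> psi c \in codes n.
  by move=> /liftP[Qc _]; apply/code_in/Qphi.
have psi_inj : {in codes n &, injective psi}.
  move=> c c' /liftP[Qc cc] /liftP[Qc' cc'] /codeP-/(_ (Qphi _ Qc) (Qphi _ Qc')).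
  by move=> /(phi_inj _ _ Qc Qc') /codeP-/(_ Qc Qc'); rewrite cc cc'.
have psi_im : [set psi c | c in codes n]%SET = codes n.
  apply/eqP; rewrite eqEcard card_in_imset // leqnn andbT.
  by apply/fintype.subsetP => _ /imsetP[c cn ->]; exact: psi_in.
have -> : S n v = (#|codes n|%:R)^-1 *: \sum_(c in codes n) pi (lift (psi c)) v.
  rewrite /S /finite_average; congr (_ *: _).
  by rewrite -[in LHS]psi_im big_imset.
rewrite -scalerBr -sumrB -[X in `|X|]subr0; apply: avg_le => c cn.
rewrite subr0; have [Qc _] := liftP cn; have [Qp cp] := liftP (psi_in _ cn).
apply: ce => //; first exact: Qphi.
by apply/codeP => //; exact: Qphi.
Qed.

Let avg_left n v e h : Q h -> close n v e -> `|pi h (S n v) - S n v| <= e.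
Proof.
move=> Qh ce.
have -> : pi h (S n v) = (#|codes n|%:R)^-1 *: (\sum_(c in codes n) pi (h * lift c)%g v).
  rewrite /S /finite_average (klinZ (rep_linear hpi _)) (klin_sum (rep_linear hpi _)).
  by congr (_ *: _); apply: eq_bigr => c _; rewrite (repM hpi).
apply: avg_shift => // [g Qg|g g' Qg Qg' hgg x xn]; first exact: QM.
exact: (@aut_inj _ _ h) (hgg x xn).
Qed.

Let avg_right n v e h : Q h -> close n v e -> `|S n (pi h v) - S n v| <= e.
Proof.
move=> Qh ce.
have -> : S n (pi h v) = (#|codes n|%:R)^-1 *: (\sum_(c in codes n) pi (lift c * h)%g v).
  rewrite /S /finite_average.
  by congr (_ *: _); apply: eq_bigr => c _; rewrite (repM hpi).
apply: (@avg_shift n v e (fun g => (g * h)%g)) => // [g Qg|g g' Qg Qg' hgg x xn]; first exact: QM.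
have := hgg (aut_inv h x); rewrite -(stab_dist hT _ (Qo Qh)) aut_invK => /(_ xn).
by rewrite -[(g * h)%g _]/(g (h _)) -[(g' * h)%g _]/(g' (h _)) aut_invK.
Qed.

(** Both sums are compared with [S m (S n v)], through left invariance of the inner average and
    right invariance of the outer one. *)
Let avg_cauchy n m v e e' : close n v e -> close m v e' -> `|S n v - S m v| <= e + e'.
Proof.
move=> cn cm.
have h1 : `|S m (S n v) - S n v| <= e.
  by apply: avg_le => c /liftP[Qc _]; exact: avg_left.
have h2 : `|S m (S n v) - S m v| <= e'.
  have -> : S m (S n v) = (#|codes n|%:R)^-1 *: (\sum_(c in codes n) S m (pi (lift c) v)).
    by rewrite {2}/S /finite_average (klinZ (Slin m)) (klin_sum (Slin m)).
  by apply: avg_le => c /liftP[Qc _]; exact: avg_right.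
rewrite -(subrK (S m (S n v)) (S n v)) -addrA (le_trans (ler_normD _ _)) //.
by rewrite lerD // distrC.
Qed.

Let ex_close v (e : R) : 0 < e -> exists N, forall n, (N <= n)%N -> close n v e.
Proof.
move=> e0; have [C C0 CP] := stab_uniform hT hnb o hpi.
have C1 : 0 < C + 1 by rewrite ltr_wpDl.
have [F FP] := rep_near hpi v 1%g (divr_gt0 e0 C1).
have [N NF] := seq_in_ball hT o F.
exists N => n Nn g h Qg Qh gh.
have -> : pi g v - pi h v = - pi g (pi (g^-1 * h)%g v - v).
  rewrite (klinB (rep_linear hpi g)) -!(repM hpi) mulVKg opprB //.
rewrite normrN (le_trans (CP _ (Qo Qg) _)) //.
have /FP : forall x, x \in F -> (g^-1 * h)%g x = (1%g : tree_aut adj) x.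
  move=> x xF; change (aut_inv g (h x) = x).
  by rewrite -gh ?aut_funK // (leq_trans (NF x xF)).
rewrite (rep1 hpi) ltr_pdivlMr // mulrC => lt.
apply: le_trans (ltW lt); by rewrite ler_wpM2r // lerDl.
Qed.

Fact ex_average v : exists l : H, forall e : R, 0 < e ->
  exists N, forall n, (N <= n)%N -> `|S n v - l| <= e.
Proof.
have cv : cvg (S n v @[n --> \oo]).
  apply/cauchy_cvgP/cauchyP => e e0; have e2 : 0 < e / 3 by rewrite divr_gt0.
  have [N NP] := ex_close v e2.
  exists (S N v); exists N => // n /= Nn; rewrite -ball_normE /=.
  rewrite (le_lt_trans (avg_cauchy (NP N (leqnn _)) (NP n Nn))) //; lra.
exists (limn (fun n => S n v)) => e e0.
move/cvgrPdist_le : cv => /(_ e e0)[N _ NP]; exists N => n /NP.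
by rewrite distrC.
Qed.

Definition average v : H := xget 0 [set l : H | forall e : R, 0 < e ->
  exists N, forall n, (N <= n)%N -> `|S n v - l| <= e].

Let P := average.

Let averageP v (e : R) : 0 < e -> exists N, forall n, (N <= n)%N -> `|S n v - P v| <= e.
Proof.
by rewrite /P /average; case: xgetP => [l _|]; [exact|have [l lP] := ex_average v => /(_ l)].
Qed.

Let average_eq v l : (forall e : R, 0 < e -> exists n : nat, `|S n v - P v| <= e /\ `|S n v - l| <= e) ->
  P v = l.
Proof.
move=> ap; apply/eqP; rewrite -subr_eq0; apply/eqP.
apply: (@norm_small_eq0 _ _ _ 2) => e /ap[n [h1 h2]].
rewrite -(subrK (S n v) (P v)) -addrA (le_trans (ler_normD _ _)) //.
by rewrite mulr_natl mulr2n lerD // distrC.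
Qed.

Lemma average_fixed h v : Q h -> pi h (P v) = P v.
Proof.
move=> Qh; have [C C0 CP] := stab_uniform hT hnb o hpi.
apply/eqP; rewrite -subr_eq0; apply/eqP.
apply: (@norm_small_eq0 _ _ _ (C + 2)) => e e0.
have [N1 N1P] := averageP v e0; have [N2 N2P] := ex_close v e0.
pose n := maxn N1 N2.
have h1 := N1P n (leq_maxl _ _); have h2 := avg_left Qh (N2P n (leq_maxr _ _)).
have -> : pi h (P v) - P v = - pi h (S n v - P v) + (pi h (S n v) - S n v) + (S n v - P v).
  by rewrite (klinB (rep_linear hpi h)) opprB !subrKA.
have -> : (C + 2) * e = C * e + e + e by ring.
rewrite (le_trans (ler_normD _ _)) // lerD //.
rewrite (le_trans (ler_normD _ _)) // lerD // normrN (le_trans (CP _ (Qo Qh) _)) //.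
by rewrite ler_wpM2l.
Qed.

Lemma average_shift h v : Q h -> P (pi h v) = P v.
Proof.
move=> Qh; apply: average_eq => e e0; have e2 : 0 < e / 2 by rewrite divr_gt0.
have [N1 N1P] := averageP (pi h v) e0; have [N2 N2P] := averageP v e2.
have [N3 N3P] := ex_close v e2; pose n := maxn N1 (maxn N2 N3).
have n1 : (N1 <= n)%N by exact: leq_maxl.
have n2 : (N2 <= n)%N by rewrite !leq_max leqnn orbT.
have n3 : (N3 <= n)%N by rewrite !leq_max leqnn !orbT.
exists n; split; first exact: N1P.
rewrite -(subrKA (S n v)) (le_trans (ler_normD _ _)) // (splitr e) lerD ?N2P //.
exact: avg_right Qh (N3P n n3).
Qed.

Lemma average_id v : (forall h, Q h -> pi h v = v) -> P v = v.
Proof.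
move=> vfix; apply: average_eq => e e0; have [N NP] := averageP v e0.
exists N; split; first exact: NP.
by apply: avg_le => c /liftP[Qc _]; rewrite vfix // subrr normr0 ltW.
Qed.

Lemma average_linear : klinear P.
Proof.
split=> [u v|v a]; apply: average_eq => e e0.
  have e3 : 0 < e / 2 by rewrite divr_gt0.
  have [N1 h1] := averageP (u + v) e0; have [N2 h2] := averageP u e3.
  have [N3 h3] := averageP v e3; pose n := maxn N1 (maxn N2 N3).
  have n1 : (N1 <= n)%N by exact: leq_maxl.
  have n2 : (N2 <= n)%N by rewrite !leq_max leqnn orbT.
  have n3 : (N3 <= n)%N by rewrite !leq_max leqnn !orbT.
  exists n; split; first exact: h1.
  rewrite (klinD (Slin n)) opprD addrACA (le_trans (ler_normD _ _)) //.
  by rewrite (splitr e) lerD ?h2 ?h3.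
have a1 : 0 < kabs a + 1 by rewrite ltr_wpDl // kabs_ge0.
have [N1 h1] := averageP (v *> a) e0; have [N2 h2] := averageP v (divr_gt0 e0 a1).
pose n := maxn N1 N2; exists n; split; first by apply: h1; exact: leq_maxl.
rewrite (klinM (Slin n)) -rmulNl -rmulDl norm_rmul.
have := h2 n (leq_maxr _ _); rewrite ler_pdivlMr //; apply: le_trans.
by rewrite ler_wpM2l // lerDl.
Qed.

(** The finite averages of [pi h v - v] lie in [L]. With [L] the kernel of a functional or an
    operator, an identity for single group elements passes to the average. *)
Lemma average_sub (L : set H) v : closed L -> L 0 -> (forall u w, L u -> L w -> L (u + w)) ->
  (forall (r : R) u, L u -> L (r *: u)) ->
  (forall h, Q h -> L (pi h v - v)) -> L (P v - v).
Proof.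
move=> cL L0 LD LZ Lv; apply: cL; apply/closure_approx => e e0.
have e2 : 0 < e / 2 by rewrite divr_gt0.
have [N NP] := averageP v e2; exists (S N v - v).
  have -> : S N v - v = (#|codes N|%:R)^-1 *: \sum_(c in codes N) (pi (lift c) v - v).
    have n0 := codes_gt0 N.
    rewrite sumrB scalerBr sumr_const -(scaler_nat _ v) scalerA mulVf ?gt_eqF //.
    by rewrite scale1r.
  apply: LZ; apply: (big_ind L) => // c /liftP[Qc _]; exact: Lv.
rewrite opprB addrA subrK distrC (le_lt_trans (NP N (leqnn _))) //; lra.
Qed.

Lemma average_near v (C : R) : (forall h, Q h -> `|pi h v - v| <= C) -> `|P v - v| <= C.
Proof.
move=> vC; apply/ler_addgt0Pl => e e0; have [N NP] := averageP v e0.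
rewrite -(subrK (S N v) (P v)) -addrA (le_trans (ler_normD _ _)) // lerD //.
  by rewrite distrC; exact: NP.
by apply: avg_le => c /liftP[Qc _]; exact: vC.
Qed.

Lemma average_bounded : bounded_op P.
Proof.
have [C C0 CP] := stab_uniform hT hnb o hpi; exists (C + 2) => v.
have : `|P v - v| <= (C + 1) * `|v|.
  apply: average_near => h Qh; rewrite (le_trans (ler_normB _ _)) // mulrDl mul1r lerD //.
  exact: CP (Qo Qh) _.
move=> h; rewrite -(subrK v (P v)) (le_trans (ler_normD _ _)) //.
have -> : (C + 2) * `|v| = (C + 1) * `|v| + `|v| by ring.
by rewrite lerD.
Qed.

End Average.

(** * Vectors fixed by an edge stabilizer *)

Section EdgeModule.
Variables (V : choiceType) (adj : rel V) (hT : is_tree adj).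
Variables (d : nat) (nb : V -> 'I_d -> V) (hnb : coloring adj nb) (o : V).
Variables (c0 c1 c2 : 'I_d).
Hypotheses (c01 : c0 != c1) (c02 : c0 != c2) (c12 : c1 != c2).
Variables (kk : 'I_d -> tree_aut adj) (t s : tree_aut adj).
Hypotheses (hkk : forall i, swapping hT nb o c0 i (kk i)) (ht : flipping nb c0 o t).
Hypothesis hs : swapping hT nb o c1 c2 s.
Variables (R : realType) (k : scalar_kind) (H : hilbertType R k).
Variables (pi : tree_aut adj -> H -> H) (hpi : continuous_rep pi).
Variable b : H -> H -> R.
Hypotheses (bs : sym_bilinear b) (bb : bounded_form b) (FI : finite_negative_index b).
Hypothesis binv : forall g v w, b (pi g v) (pi g w) = b v w.
Implicit Types (g h : tree_aut adj) (v w u : H).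

Let y := nb o c0.
Let a := (kk c1 * t)%g.
Let q : R := d.-1%:R.

Definition edge_stab : set (tree_aut adj) := [set g | g o = o /\ g y = y].
Definition edge_fixed : set H := [set v | forall g, edge_stab g -> pi g v = v].
Let M := edge_fixed.

Lemma edge_stab1 : edge_stab 1%g. Proof. by []. Qed.
Lemma edge_stabM g h : edge_stab g -> edge_stab h -> edge_stab (g * h)%g.
Proof.
move=> [go gy] [ho hy].
by split; [change (g (h o) = o); rewrite ho | change (g (h y) = y); rewrite hy].
Qed.
Lemma edge_stabo g : edge_stab g -> g o = o. Proof. by case. Qed.

Definition edge_avg : H -> H := average nb o pi edge_stab.
Let P := edge_avg.

Let pl g : klinear (pi g) := rep_linear hpi g.
Let Plin : klinear P := average_linear hT hnb hpi edge_stab1 edge_stabM edge_stabo.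
Let PM v : M (P v).
Proof. by move=> g Qg; exact: (average_fixed hT hnb hpi edge_stab1 edge_stabM edge_stabo). Qed.
Let Pid v : M v -> P v = v.
Proof. exact: (average_id hT hnb hpi edge_stab1 edge_stabM edge_stabo). Qed.
Let Pshift g v : edge_stab g -> P (pi g v) = P v.
Proof. exact: (average_shift hT hnb hpi edge_stab1 edge_stabM edge_stabo). Qed.
Let Pbnd : bounded_op P := average_bounded hT hnb hpi edge_stab1 edge_stabM edge_stabo.

Lemma closed_null (f : H -> R) (C : R) :
  (forall u v, f (u - v) = f u - f v) -> (forall v, `|f v| <= C * `|v|) ->
  closed [set v | f v = 0].
Proof.
move=> fB fC; apply: closed_approx => v app.
apply: (@norm_small_eq0 _ R^o _ (`|C|)) => e /app[w fw vw].
rewrite -[f v]subr0 -fw -fB (le_trans (fC _)) //.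
rewrite (le_trans (ler_wpM2r (normr_ge0 _) (ler_norm C))) //.
by rewrite ler_wpM2l // ltW.
Qed.

Lemma closed_form_null w : closed [set u | b w u = 0].
Proof.
have [C C0 bC] := bb; apply: (@closed_null _ (C * `|w|)) => [u v|v].
  exact: symBr.
by rewrite -mulrA; exact: bC.
Qed.

Let binvV g v w : b (pi g v) w = b v (pi (g^-1)%g w).
Proof. by rewrite -(binv g v) (repKV hpi). Qed.

Lemma edge_avg_form v w : M v -> b v (P w) = b v w.
Proof.
move=> Mv; apply/eqP; rewrite -subr_eq0 -(symBr bs); apply/eqP.
apply: (@average_sub _ _ hT _ _ hnb _ _ _ _ _ hpi _ edge_stab1 edge_stabM edge_stabo
  [set u | b v u = 0]).
- exact: closed_form_null.
- exact: sym0r.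
- by move=> u u' /= vu vu'; rewrite (symDr bs) vu vu' addr0.
- by move=> r u /= vu; rewrite (symZr bs) vu mulr0.
by move=> h Qh /=; rewrite (symBr bs) -{1}(Mv h Qh) binv subrr.
Qed.

Lemma edge_fixed_sub : ksubspace M.
Proof.
split=> [g _|u v Mu Mv g Qg|v c Mv g Qg]; first exact: klin0.
  by rewrite (klinD (pl g)) Mu // Mv.
by rewrite (klinM (pl g)) Mv.
Qed.

Lemma edge_fixed_closed : closed M.
Proof.
apply: closed_approx => v app g Qg; apply/eqP; rewrite -subr_eq0; apply/eqP.
have [C gC] := rep_bounded hpi g.
apply: (@norm_small_eq0 _ _ _ (`|C| + 1)) => e /app[w Mw /ltW vw].
have -> : pi g v - v = pi g (v - w) - (v - w).
  by rewrite (klinB (pl g)) (Mw g Qg) opprB addrA subrK.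
rewrite (le_trans (ler_normB _ _)) // mulrDl mul1r lerD //.
rewrite (le_trans (gC _)) // (le_trans (ler_wpM2r (normr_ge0 _) (ler_norm C))) //.
by rewrite ler_wpM2l.
Qed.

(** It makes [v] a function on oriented edges, [pi g v] being its value at the edge from [g o] to
    [g y]; Hecke identities reduce to counting edges. *)
Lemma edge_coset g h v : M v -> g o = h o -> g y = h y -> pi g v = pi h v.
Proof.
move=> Mv go gy; rewrite -[in LHS](mulVKg h g) (repM hpi) Mv //.
split; [change (aut_inv h (g o) = o); rewrite go|change (aut_inv h (g y) = y); rewrite gy];
exact: aut_funK.
Qed.

Let kko i : kk i o = o. Proof. by case: (hkk i). Qed.
Let kky i : kk i y = nb o i. Proof. by case: (hkk i). Qed.
Let kkK i v : pi (kk i) (pi (kk i) v) = v.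
Proof.
rewrite -(repM hpi); have -> : (kk i * kk i)%g = 1%g; last exact: (rep1 hpi).
by apply: aut_eq => x; case: (hkk i) => _ _ _ /(_ x).
Qed.
Let to : t o = y. Proof. by case: ht. Qed.
Let ty : t y = o. Proof. by case: ht => _ _ /(_ o) /=; rewrite to. Qed.
Let tgK : (t * t)%g = 1%g.
Proof. by apply: aut_eq => x; case: ht => _ _ /(_ x). Qed.
Let tK v : pi t (pi t v) = v.
Proof. by rewrite -(repM hpi) tgK (rep1 hpi). Qed.

(* On M this is the projection onto the vectors fixed by the stabilizer of o. *)
Definition vertex_avg v : H := d%:R^-1 *: \sum_(i < d) pi (kk i) v.
Let S := vertex_avg.

Let d0 : (0 : R) < d%:R. Proof. by rewrite ltr0n (leq_ltn_trans _ (ltn_ord c0)). Qed.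

Lemma vertex_avg_linear : klinear S.
Proof.
split=> [u v|v c]; rewrite /S /vertex_avg.
  rewrite -scalerDr -big_split /=; congr (_ *: _); apply: eq_bigr => i _.
  by rewrite (klinD (pl _)).
rewrite rmulZ; congr (_ *: _); elim/big_rec2: _ => [|i x z _ ->].
  by rewrite rmul0l.
by rewrite (klinM (pl _)) rmulDl.
Qed.

Lemma vertex_avg_bounded : bounded_op S.
Proof.
have /choice[C CP] : forall i, exists C, forall v, `|pi (kk i) v| <= C * `|v|.
  by move=> i; exact: rep_bounded.
exists (d%:R^-1 * \sum_i C i) => v.
rewrite normrZ gtr0_norm ?invr_gt0 // -mulrA ler_pM2l ?invr_gt0 //.
by rewrite (le_trans (ler_norm_sum _ _ _)) // mulr_suml ler_sum.
Qed.

Lemma vertex_avg_fixed h v : M v -> h o = o -> pi h (S v) = S v.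
Proof.
move=> Mv ho; rewrite /S /vertex_avg (klinZ (pl h)) (klin_sum (pl h)); congr (_ *: _).
have /choice[f fP] : forall i, exists j, nb o j = h (nb o i).
  by move=> i; apply: (nb_surj hnb); rewrite -{1}ho aut_adj (nb_adj hnb).
have finj : injective f.
  move=> i j ij; apply: (nb_inj hnb (v := o)); apply: (@aut_inj _ _ h).
  by rewrite -!fP ij.
rewrite [RHS](reindex_inj finj); apply: eq_bigr => i _.
rewrite -(repM hpi); apply: edge_coset => //.
  by change (h (kk i o) = kk (f i) o); rewrite !kko.
by change (h (kk i y) = kk (f i) y); rewrite !kky fP.
Qed.

Let SM v : M v -> M (S v).
Proof. by move=> Mv g [go _]; exact: vertex_avg_fixed. Qed.

Let SS v : M v -> S (S v) = S v.
Proof.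
move=> Mv; rewrite {1}/S /vertex_avg; under eq_bigr do rewrite vertex_avg_fixed //.
by rewrite sumr_const card_ord -(scaler_nat _ (S v)) scalerA mulVf ?gt_eqF // scale1r.
Qed.

Let bS v w : b (S v) w = b v (S w).
Proof.
rewrite /S /vertex_avg (symZl bs) (symZr bs) (sym_suml bs) (sym_sumr bs).
by congr (_ * _); apply: eq_bigr => i _; rewrite -(binv (kk i)) kkK.
Qed.

Let bt v w : b (pi t v) w = b v (pi t w).
Proof. by rewrite -(binv t) tK. Qed.

Let tM v : M v -> M (pi t v).
Proof.
move=> Mv g [go gy]; rewrite -(repM hpi); apply: edge_coset => //.
  by change (g (t o) = t o); rewrite to gy.
by change (g (t y) = t y); rewrite ty go.
Qed.

(** Swapping the branches [c1] and [i] at [o] fixes the edge and is absorbed by [P]. *)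
Lemma edge_avg_swap i v : M v -> i != c0 -> P (pi (kk i) v) = P (pi (kk c1) v).
Proof.
move=> Mv ic0; have [h [ho hi hi' _ hfix]] := ex_swap hT hnb o c1 i.
have Qh : edge_stab h.
  split=> //; apply: hfix; rewrite toward_adj ?(nb_adj hnb) //.
    by rewrite (inj_eq (nb_inj hnb (v := o))).
  by rewrite (inj_eq (nb_inj hnb (v := o))) eq_sym.
rewrite -[RHS](Pshift _ Qh) -(repM hpi); congr P; apply: edge_coset => //.
  by change (kk i o = h (kk c1 o)); rewrite !kko.
by change (kk i y = h (kk c1 y)); rewrite !kky.
Qed.

Let q0 : 0 < q.
Proof.
rewrite ltr0n -subn1 subn_gt0 ltnNge; apply/negP => d1; case/eqP: c01; apply: val_inj.
have /= h0 := leq_trans (ltn_ord c0) d1; have /= h1 := leq_trans (ltn_ord c1) d1.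
by move: h0 h1; rewrite !ltnS !leqn0 => /eqP -> /eqP ->.
Qed.

(** Apply [P] to the sum defining [S v]: colour [c0] contributes [v], the other [q] colours
    contribute the same vector each, and one solves for it. *)
Lemma edge_avg_step v : M v -> P (pi (kk c1) v) = S v - q^-1 *: (v - S v).
Proof.
move=> Mv; have dq : d%:R = q + 1 :> R.
  by rewrite /q natr1 prednK // (leq_ltn_trans _ (ltn_ord c0)).
have : S v = d%:R^-1 *: (v + q *: P (pi (kk c1) v)).
  rewrite -[LHS](Pid (SM Mv)) {1}/S /vertex_avg (klinZ Plin) (klin_sum Plin).
  rewrite (bigD1 c0) //= (eq_bigr (fun=> P (pi (kk c1) v))); last first.
    by move=> i; exact: edge_avg_swap.
  rewrite sumr_const cardC1 card_ord -(scaler_nat _ (P _)) -/q.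
  congr (_ *: (_ + _)); rewrite -[RHS](Pid Mv); congr P.
  by rewrite -[RHS](rep1 hpi); exact: edge_coset.
have qn0 : q != 0 by rewrite gt_eqF.
move: (P (pi (kk c1) v)) => x e.
have qP : q *: x = (q + 1) *: S v - v.
  by rewrite e -dq scalerA mulfV ?gt_eqF // scale1r addrAC subrr add0r.
rewrite -[LHS]scale1r -(mulVf qn0) -scalerA qP scalerBr (scalerDl (S v)) scale1r scalerDr.
by rewrite scalerA mulVf // scale1r [in RHS]scalerBr opprB addrA.
Qed.

Lemma rep_iter g n : exists h, (forall x, h x = iter n g x) /\
  forall v, iter n (pi g) v = pi h v.
Proof.
elim: n => [|n [h [hx hv]]]; first by exists 1%g; split=> // v; rewrite (rep1 hpi).
exists (g * h)%g; split=> [x|v]; first by change (g (h x) = iter n.+1 g x); rewrite hx.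
by rewrite (repM hpi) -hv.
Qed.

Lemma conj_fix g h v : pi (h^-1 * g * h)%g v = v -> pi g (pi h v) = pi h v.
Proof. by move=> e; rewrite -[in RHS]e -!(repM hpi) !mulgA mulgV mul1g. Qed.

(** If [b v v < 0], the difference [w] of the copies of [v] at the edges [c1] and [c2] is negative,
    because [S v = 0] makes their product [- q^-1 * b v v]. The swap [s] negates [w] but fixes its
    backward translates, so these are exactly orthogonal to [w], against [no_decay_of_neg]. *)
Lemma vertex_kernel_nonneg v : M v -> S v = 0 -> 0 <= b v v.
Proof.
move=> Mv Sv; rewrite leNgt; apply/negP => vneg.
pose w := pi (kk c1) v - pi (kk c2) v.
have [sso ss1 ss2 _ _] := hs.
have sw : pi s w = - w.
  rewrite /w (klinB (pl s)) opprB -!(repM hpi); congr (_ - _); apply: edge_coset => //.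
  - by change (s (kk c1 o) = kk c2 o); rewrite !kko.
  - by change (s (kk c1 y) = kk c2 y); rewrite !kky.
  - by change (s (kk c2 o) = kk c1 o); rewrite !kko.
  - by change (s (kk c2 y) = kk c1 y); rewrite !kky.
have wfix g : g o = o -> g (nb o c1) = nb o c1 -> g (nb o c2) = nb o c2 -> pi g w = w.
  move=> go g1 g2; rewrite /w (klinB (pl g)) -!(repM hpi); congr (_ - _); apply: edge_coset => //.
  - by change (g (kk c1 o) = kk c1 o); rewrite !kko.
  - by change (g (kk c1 y) = kk c1 y); rewrite !kky.
  - by change (g (kk c2 o) = kk c2 o); rewrite !kko.
  - by change (g (kk c2 y) = kk c2 y); rewrite !kky.
have wneg : b w w < 0.
  have k12 : b (pi (kk c1) v) (pi (kk c2) v) = - q^-1 * b v v.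
    have -> : b (pi (kk c1) v) (pi (kk c2) v) = b v (pi (kk c1 * kk c2)%g v).
      by rewrite -(binv (kk c1)) kkK (repM hpi).
    have -> : pi (kk c1 * kk c2)%g v = pi (kk c2) v.
      apply: edge_coset => //; first by change (kk c1 (kk c2 o) = kk c2 o); rewrite !kko.
      change (kk c1 (kk c2 y) = kk c2 y); rewrite !kky.
      case: (hkk c1) => _ _ _ _; apply; rewrite toward_adj ?(nb_adj hnb) //.
        by rewrite (inj_eq (nb_inj hnb (v := o))) eq_sym.
      by rewrite (inj_eq (nb_inj hnb (v := o))) eq_sym.
    rewrite -edge_avg_form // edge_avg_swap 1?eq_sym // edge_avg_step //.
    by rewrite Sv subr0 sub0r (symNr bs) (symZr bs) mulNr.
  rewrite /w (symBl bs) !(symBr bs) !binv (symC bs (pi (kk c2) v)) k12.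
  have qi : 0 < q^-1 by rewrite invr_gt0.
  by nra.
apply: (no_decay_of_neg bs FI (binv a^-1%g) wneg).
rewrite -cvg_shiftS.
have -> : [sequence b (iter n.+1 (pi a^-1%g) w) w]_n = (fun=> 0); last exact: cvg_cst.
apply/funext => n /=; rewrite -iterS.
have [h [hx hv]] := rep_iter a^-1%g n.+1; rewrite hv.
have sh : pi s (pi h w) = pi h w.
  apply: conj_fix; have e x : [\/ x = o, x = nb o c1 | x = nb o c2] ->
      (h^-1 * s * h)%g x = x.
    move=> xE; change (aut_inv h (s (h x)) = x).
    by rewrite !hx (swap_shift hnb c01 c02 c12 (hkk c1) ht hs) // -hx aut_funK.
  by apply: wfix; apply: e; [constructor 1|constructor 2|constructor 3].
have := binv s (pi h w) w; rewrite sh sw (symNr bs).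
by move: (b (pi h w) w) => z; lra.
Qed.

Hypothesis hirr : irreducible_rep pi.

(** On [M] every [P \o pi g] is a polynomial in [S] and [t], by induction on the distance from [o]
    to [g o]. If the edge of [g] points towards [o], flipping it by [t] shortens the distance; any
    other edge is reduced to one that does. *)
Lemma edge_hecke_closed (L : set H) : ksubspace L -> L `<=` M ->
  (forall v, L v -> L (S v)) -> (forall v, L v -> L (pi t v)) ->
  forall g v, L v -> L (P (pi g v)).
Proof.
move=> hL LM LS Lt g v Lv; have [n] := ubnP (dist hT o (g o)).
elim: n g v Lv => // n IH g v Lv gn; have Mv := LM v Lv.
have [go|go] := eqVneq (g o) o.
  have [i gi] : exists i, nb o i = g y by apply: (nb_surj hnb); rewrite -{1}go aut_adj (nb_adj hnb).
  have -> : pi g v = pi (kk i) v by apply: edge_coset; rewrite ?go ?kko // -gi kky.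
  have [->|ic0] := eqVneq i c0.
    rewrite (edge_coset (h := 1%g)) ?kko ?kky // (rep1 hpi) Pid //.
  rewrite edge_avg_swap // edge_avg_step //; apply: ksubB => //; first exact: LS.
  by apply: ksubZ => //; apply: ksubB => //; exact: LS.
have flip v' g' : L v' -> g' o = g o -> toward hT o (g o) = g' y -> L (P (pi g' v')).
  move=> Lv' g'o tg; rewrite -[v']tK -(repM hpi); apply: IH; first exact: Lt.
  change (dist hT o (g' (t o)) < n)%N; rewrite to -tg.
  by have [_ dg] := towardP hT go; rewrite dg ltnS in gn.
have [tg|tg] := eqVneq (toward hT o (g o)) (g y); first exact: flip.
have [i0 gi0] : exists i, g (nb o i) = toward hT o (g o).
  have [adjt _] := towardP hT go.
  have : adj o (aut_inv g (toward hT o (g o))).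
    by rewrite -(aut_adj g) aut_invK.
  by move=> /(nb_surj hnb)[i ii]; exists i; rewrite ii aut_invK.
have gkk i : i != i0 -> P (pi g (pi (kk i) v)) = P (pi g v).
  move=> ii0; have oy : adj o y := nb_adj hnb _ _.
  have gadj j : adj (g o) (g (nb o j)) by rewrite aut_adj (nb_adj hnb).
  have ti : toward hT o (g o) != g (nb o i).
    by rewrite -gi0 (inj_eq (@aut_inj _ _ g)) (inj_eq (nb_inj hnb (v := o))) eq_sym.
  have [h [ho hy hg hh]] := edge_fixing_move hnb oy go (gadj c0) (gadj i) tg ti.
  rewrite -[RHS](Pshift _ (conj ho hy : edge_stab h)) -!(repM hpi); congr P.
  apply: edge_coset => //; first by change (g (kk i o) = h (g o)); rewrite kko hg.
  by change (g (kk i y) = h (g y)); rewrite kky hh.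
(* Of the [d] edges at [g o] only [i0] points to [o]; automorphisms fixing [o] and [y] carry the
   edge of [g] to each other one, so these [q] edges give equal averages and [P (pi g v)] can be
   solved for. *)
have key : P (pi g (S v)) = d%:R^-1 *: (P (pi g (pi (kk i0) v)) + q *: P (pi g v)).
  rewrite {1}/S /vertex_avg (klinZ (pl g)) (klinZ Plin) (klin_sum (pl g)) (klin_sum Plin).
  rewrite (bigD1 i0) //= (eq_bigr (fun=> P (pi g v))); last by move=> i; exact: gkk.
  by rewrite sumr_const cardC1 card_ord -(scaler_nat _ (P _)).
have L1 : L (P (pi g (S v))).
  rewrite -(vertex_avg_fixed Mv (kko i0)) -(repM hpi); apply: flip; first exact: LS.
    by change (g (kk i0 o) = g o); rewrite kko.
  by change (toward hT o (g o) = g (kk i0 y)); rewrite kky gi0.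
have L2 : L (P (pi g (pi (kk i0) v))).
  rewrite -(repM hpi); apply: flip => //.
    by change (g (kk i0 o) = g o); rewrite kko.
  by change (toward hT o (g o) = g (kk i0 y)); rewrite kky gi0.
have -> : P (pi g v) = q^-1 *: (d%:R *: P (pi g (S v)) - P (pi g (pi (kk i0) v))).
  rewrite key scalerA mulfV ?gt_eqF // scale1r addrAC subrr add0r scalerA mulVf ?gt_eqF //.
  by rewrite scale1r.
by apply: ksubZ => //; apply: ksubB => //; exact: ksubZ.
Qed.

(** The vectors all of whose translates project into [L] form a closed subrepresentation [X]. It
    contains [L] by [edge_hecke_closed], so it is everything, and [P] is the identity on [M]. *)
Lemma edge_module_irreducible (L : set H) : ksubspace L -> closed L -> L `<=` M ->
  (forall v, L v -> L (S v)) -> (forall v, L v -> L (pi t v)) ->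
  (exists2 v, L v & v != 0) -> M `<=` L.
Proof.
move=> hL cL LM LS Lt [v0 Lv0 v00].
pose X := [set v | forall g, L (P (pi g v))].
have [_ irr] := hirr.
have [||| X0|XT] := irr X.
- split=> [g|u v Xu Xv g|v c Xv g].
  + by rewrite (klin0 (pl g)) (klin0 Plin); exact: ksub0.
  + by rewrite (klinD (pl g)) (klinD Plin); exact: ksubD.
  by rewrite (klinM (pl g)) (klinM Plin); exact: ksubM.
- apply: closed_approx => v app g; apply: cL; apply/closure_approx => e e0.
  have [[C1 hC1] [C2 hC2]] := (Pbnd, rep_bounded hpi g).
  have C0 : 0 < `|C1| * `|C2| + 1 by rewrite ltr_wpDl // mulr_ge0.
  have [w Xw vw] := app _ (divr_gt0 e0 C0); exists (P (pi g w)); first exact: Xw.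
  rewrite -(klinB Plin) -(klinB (pl g)); move: vw; rewrite ltr_pdivlMr //.
  apply: le_lt_trans; rewrite (le_trans (hC1 _)) //.
  rewrite (le_trans (ler_wpM2r (normr_ge0 _) (ler_norm C1))) //.
  have h1 : `|pi g (v - w)| <= `|C2| * `|v - w|.
    by rewrite (le_trans (hC2 _)) // ler_wpM2r // ler_norm.
  rewrite (le_trans (ler_wpM2l (normr_ge0 C1) h1)) //.
  have -> : `|v - w| * (`|C1| * `|C2| + 1) = `|C1| * (`|C2| * `|v - w|) + `|v - w| by ring.
  by rewrite lerDl.
- by move=> g v Xv g'; rewrite -(repM hpi); exact: Xv.
- have : X v0 by move=> g; exact: edge_hecke_closed.
  by rewrite X0 /= => e; rewrite e eqxx in v00.
move=> v Mv; have : X v by rewrite XT.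
by move=> /(_ 1%g); rewrite (rep1 hpi) Pid.
Qed.

(** * Half-tree fixators and matrix coefficients of the translation *)

Let fr := front hT nb c0 o.

Definition front_fixed : set H :=
  [set u | forall g, (forall x, fr x -> g x = x) -> pi g u = u].
Definition back_fixed : set H :=
  [set u | forall g, (forall x, ~~ fr x -> g x = x) -> pi g u = u].
Definition ball_fixed n : set H :=
  [set u | forall g, (forall x, (dist hT o x <= n)%N -> g x = x) -> pi g u = u].

Let edge_stab_split g : edge_stab g -> exists g1 g2, [/\ g = (g2 * g1)%g,
  forall x, fr x -> g1 x = x & forall x, ~~ fr x -> g2 x = x].
Proof.
move=> [go gy]; have [g1 [g2 [e h1 h2]]] := edge_split hT (nb_adj hnb o c0) go gy.
exists g1, g2; split=> // x; rewrite frontN //; exact: h2.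
Qed.

(** An element of the edge stabilizer splits into a factor absorbed by [u] and one that is moved
    across the form and absorbed by [w]. *)
Lemma front_back_form u w : front_fixed u -> back_fixed w -> b (P u) w = b u w.
Proof.
move=> fu bw; rewrite (symC bs (P u)) (symC bs u).
apply/eqP; rewrite -subr_eq0 -(symBr bs); apply/eqP.
apply: (@average_sub _ _ hT _ _ hnb _ _ _ _ _ hpi _ edge_stab1 edge_stabM edge_stabo
  [set v | b w v = 0]).
- exact: closed_form_null.
- exact: sym0r.
- by move=> v v' /= vu vu'; rewrite (symDr bs) vu vu' addr0.
- by move=> r v /= vu; rewrite (symZr bs) vu mulr0.
move=> g /edge_stab_split[g1 [g2 [-> h1 h2]]] /=.
by rewrite (symBr bs) (repM hpi) (fu _ h1) -{1}(bw _ h2) binv subrr.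
Qed.

Let ay : a y = o.
Proof. by change (kk c1 (t y) = o); rewrite ty kko. Qed.

(** In [g = g2 * g1] the factor [g1] is absorbed by [u]. The conjugate of [g2] by [a] fixes the
    translate of the back half-tree, which contains both ends of the edge, so the outer [P] absorbs
    it. *)
Lemma edge_avg_translate u : front_fixed u -> P (pi a (P u)) = P (pi a u).
Proof.
move=> fu; apply/eqP; rewrite -subr_eq0 -(klinB Plin) -(klinB (pl a)); apply/eqP.
have Flin : klinear (P \o pi a).
  by split=> [v w|v c] /=; rewrite ?(klinD (pl a)) ?(klinM (pl a)) ?(klinD Plin) ?(klinM Plin).
apply: (@average_sub _ _ hT _ _ hnb _ _ _ _ _ hpi _ edge_stab1 edge_stabM edge_stabo
  [set v | P (pi a v) = 0]).
- have [[C1 hC1] [C2 hC2]] := (Pbnd, rep_bounded hpi a).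
  have -> : [set v | P (pi a v) = 0] = [set v | setT v /\ (P \o pi a) v = 0].
    by apply/seteqP; split=> v //= [].
  apply: (@closed_zero _ _ _ _ (`|C1| * C2)); first exact: closedT.
    by move=> v w; exact: (klinB Flin).
  move=> v; rewrite /= (le_trans (hC1 _)) //.
  rewrite (le_trans (ler_wpM2r (normr_ge0 _) (ler_norm C1))) // -mulrA.
  by rewrite ler_wpM2l.
- by rewrite /= (klin0 (pl a)) (klin0 Plin).
- by move=> v w /= v0 w0; rewrite (klinD (pl a)) (klinD Plin) v0 w0 addr0.
- by move=> r v /= v0; rewrite (klinZ (pl a)) (klinZ Plin) v0 scaler0.
move=> g /edge_stab_split[g1 [g2 [-> h1 h2]]] /=.
rewrite (repM hpi) (fu _ h1) (klinB (pl a)) (klinB Plin).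
have fixa x : ~~ fr (aut_inv a x) -> (a * g2 * a^-1)%g x = x.
  by move=> nx; change (a (g2 (aut_inv a x)) = x); rewrite h2 // aut_invK.
have Qc : edge_stab (a * g2 * a^-1)%g.
  split; apply: fixa.
    by rewrite -{1}ay aut_funK /fr frontN // distxx lt0n dist_eq0 eq_sym (adj_neq hT (nb_adj hnb _ _)).
  by have := @ex_back _ _ hT _ _ hnb _ _ _ c01 _ _ (hkk c1) ht y 1%N; rewrite /= distxx; exact.
rewrite -[X in _ - X](Pshift _ Qc) -!(repM hpi) mulgVK.
by rewrite subrr.
Qed.

Let front_fixed_a u : front_fixed u -> front_fixed (pi a u).
Proof.
move=> fu g gf; apply: conj_fix; apply: fu => x fx.
change (aut_inv a (g (a x)) = x); rewrite gf ?aut_funK //.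
exact: (front_translate hnb c01 (hkk c1) ht).
Qed.

Lemma ball_fixed_front n u : ball_fixed n u -> front_fixed (iter n (pi a) u).
Proof.
move=> bu g gf; have [h [hx ->]] := rep_iter a n.
apply: conj_fix; apply: bu => x xn; change (aut_inv h (g (h x)) = x).
rewrite gf ?aut_funK // hx /fr.
by apply: (ex_front hnb c01 (hkk c1) ht); rewrite dist_sym.
Qed.

(** The ball of radius [n] about [o] lies in the ball of radius [n.+1] about [y], hence one step
    more than forwards. *)
Lemma ball_fixed_back n u : ball_fixed n u -> back_fixed (iter n.+1 (pi a^-1%g) u).
Proof.
move=> bu g gf; have [h [hx ->]] := rep_iter a^-1%g n.+1.
apply: conj_fix; apply: bu => x xn; change (aut_inv h (g (h x)) = x).
rewrite gf ?aut_funK // hx /fr.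
apply: (ex_back hnb c01 (hkk c1) ht).
have oy : adj o y := nb_adj hnb _ _.
have ox : (dist hT x o <= n)%N by rewrite dist_sym.
exact: leq_trans (dist_adjS hT x oy) _.
Qed.

Let U := hecke S (pi t) q.

Lemma edge_avg_iter u n : front_fixed u -> P (iter n (pi a) u) = iter n U (P u).
Proof.
move=> fu; have fn m : front_fixed (iter m (pi a) u).
  by elim: m => //= m; exact: front_fixed_a.
elim: n => //= n IH; rewrite -edge_avg_translate // IH (repM hpi).
have Mn : M (iter n U (P u)) by rewrite -IH; exact: PM.
by rewrite edge_avg_step //; exact: tM.
Qed.

(** Of the exponent, [n] steps bring [u] to the front and [n.+1], moved to the other argument, bring
    it to the back; the remaining [m] steps act as [U] iterated on [M]. *)
Lemma matrix_coefficient_decay n u : ball_fixed n u ->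
  (forall w, M w -> b (iter m U (P (iter n (pi a) u))) w @[m --> \oo] --> (0 : R)) ->
  b (iter m (pi a) u) u @[m --> \oo] --> (0 : R).
Proof.
move=> bu dec; rewrite -(cvg_shiftn (n + n.+1)).
have iterb m v w : b (iter m (pi a) v) w = b v (iter m (pi a^-1%g) w).
  by elim: m w => //= m IH w; rewrite binvV IH -iterSr.
pose w' := iter n.+1 (pi a^-1%g) u.
have -> : [sequence b (iter (m + (n + n.+1)) (pi a) u) u]_m =
    (fun m => b (iter m U (P (iter n (pi a) u))) (P w')).
  apply/funext => m /=; have fu := ball_fixed_front bu.
  rewrite addnA addnC iterD iterb iterD -/w'.
  have fm : front_fixed (iter m (pi a) (iter n (pi a) u)).
    by elim: (m) => //= l; exact: front_fixed_a.
  rewrite -(front_back_form fm (ball_fixed_back bu)) edge_avg_iter //.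
  by rewrite edge_avg_form // -edge_avg_iter //; exact: PM.
exact: dec (PM _).
Qed.

Lemma edge_module_decay : (2 < d)%N -> exists (f : H) (L : H -> H), [/\ klinear L,
  forall v, M v -> exists c : kscalar R k, L v = f *> c &
  forall v, M v -> L v = 0 -> forall w, M w -> b (iter n U v) w @[n --> \oo] --> (0 : R)].
Proof.
move=> d2; have q1 : 1 < q by rewrite ltr1n -subn1 ltn_subRL.
apply: (hecke_decay bs bb FI q1 edge_fixed_sub edge_fixed_closed PM edge_avg_form).
- exact: vertex_avg_linear.
- exact: vertex_avg_bounded.
- exact: SM.
- exact: pl.
- exact: rep_bounded.
- exact: tM.
- exact: SS.
- by move=> v _; exact: tK.
- by move=> v w _ _; exact: bS.
- by move=> v w _ _; exact: bt.
- exact: vertex_kernel_nonneg.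
exact: edge_module_irreducible.
Qed.

Lemma edge_avg_iter_linear n : klinear (fun v => P (iter n (pi a) v)).
Proof.
have lin : klinear (iter n (pi a)).
  elim: n => [|n [IHD IHM]]; first by split.
  by split=> [u v|v c] /=; rewrite ?IHD ?IHM ?(klinD (pl a)) ?(klinM (pl a)).
by split=> [u v|v c]; rewrite ?(klinD lin) ?(klinM lin) ?(klinD Plin) ?(klinM Plin).
Qed.

(* The functional L of edge_module_decay kills a combination of any two
   vectors, so at most one negative direction can survive. *)
Lemma ball_fixed_pair n u0 u1 : (2 < d)%N -> ball_fixed n u0 -> ball_fixed n u1 ->
  exists a0 a1 : kscalar R k, 0 < kabs a0 + kabs a1 /\
    0 <= b (u0 *> a0 + u1 *> a1) (u0 *> a0 + u1 *> a1).
Proof.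
move=> d2 bu0 bu1; have [f [L [Llin Lf Ldec]]] := edge_module_decay d2.
have Alin := edge_avg_iter_linear n.
have [x0 Lx0] := Lf _ (PM (iter n (pi a) u0)).
have [x1 Lx1] := Lf _ (PM (iter n (pi a) u1)).
have [a0 [a1 [a01 x01]]] : exists a0 a1 : kscalar R k,
    0 < kabs a0 + kabs a1 /\ x0 * a0 + x1 * a1 = 0.
  have kabs_gt0 (x : kscalar R k) : x != 0 -> 0 < kabs x.
    by move=> xn; rewrite lt_def kabs_ge0 andbT; apply: contra_neq xn => /kabs_eq0.
  have one : 0 < kabs (1 : kscalar R k) by rewrite kabs_gt0 // oner_neq0.
  have [->|x0n] := eqVneq x0 0.
    by exists 1, 0; rewrite mul0r mulr0 addr0 ltr_wpDr ?kabs_ge0.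
  have [z xz] := kinv x0n; exists (- (z * x1)), 1.
  by rewrite mulrN mulrA xz mul1r mulr1 addNr ltr_wpDl ?kabs_ge0.
exists a0, a1; split=> //; rewrite leNgt; apply/negP => uneg.
apply: (no_decay_of_neg bs FI (binv a) uneg).
apply: (matrix_coefficient_decay (n := n)).
  move=> g gfix; rewrite (klinD (pl g)) !(klinM (pl g)).
  by rewrite (bu0 g gfix) (bu1 g gfix).
apply: Ldec; first exact: PM.
rewrite (klinD Alin) !(klinM Alin) (klinD Llin) !(klinM Llin) Lx0 Lx1.
by rewrite -!rmulM -rmulDr x01 rmul0.
Qed.

End EdgeModule.

Theorem theorem1p1 (V : choiceType) (adj : rel V) (d : nat)
    (hd : (3 <= d)%N) (hT : is_tree adj) (hreg : regular_graph adj d)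
    (R : realType) (k : scalar_kind) (H : hilbertType R k)
    (pi : tree_aut adj -> H -> H)
    (hpi : continuous_rep pi) (hirr : irreducible_rep pi)
    (B : H -> H -> kscalar R k)
    (hBs : sesquilinear_form B) (hBh : hermitian_form B) (hBc : continuous_form B)
    (hBn : strongly_nondegenerate B) (hBpi : preserves_form pi B)
    (p : nat) (hp : form_index B p) :
  p = 0%N \/ p = 1%N.
Proof.
have [nb hnb] := ex_coloring hT (ltnW (ltnW hd)) hreg.
have [_ _ [ o ] _ _] := hT.
pose c0 : 'I_d := Ordinal (ltnW (ltnW hd)); pose c1 : 'I_d := Ordinal (ltnW hd).
pose c2 : 'I_d := Ordinal hd.
have /choice[kk hkk] : forall i, exists h, swapping hT nb o c0 i h.
  by move=> i; exact: ex_swap.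
have [t ht] := ex_flip hT hnb c0 o.
have [s hs] : exists h, swapping hT nb o c1 c2 h by exact: ex_swap.
have bs := re_form_sym hBs hBh; have bb := re_form_bounded hBs hBh hBc.
have FI := re_form_finite_index hBs hBh hBn hp.
have binv g v w : re_form B (pi g v) (pi g w) = re_form B v w by rewrite /re_form hBpi.
case: p hp => [|[|p]] hp; [by left|by right|exfalso].
have [e0 [e1 [n0 n1 o01]]] := negative_orthogonal_pair hBs hBh hp isT.
have [eps eps0 neg] := negative_pair_perturbation hBs hBh bb n0 n1 o01.
have [F0 F0P] := rep_near hpi e0 1%g eps0; have [F1 F1P] := rep_near hpi e1 1%g eps0.
have [n nF] := seq_in_ball hT o (F0 ++ F1).
(* The fixator of a ball so large that it moves [e0] and [e1] by less than [eps]; averaging over it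
   gives vectors that it fixes, within [eps] of them. *)
pose Q := [set g : tree_aut adj | agree hT o n g 1%g].
have Q1 : Q 1%g by [].
have QM g h : Q g -> Q h -> Q (g * h)%g.
  by move=> Qg Qh x xn; change (g (h x) = x); rewrite (Qh x xn); exact: Qg.
have Qo g : Q g -> g o = o by move=> /(_ o); rewrite distxx => /(_ isT).
pose A := average nb o pi Q.
have Afix v : ball_fixed hT o pi n (A v).
  by move=> g gfix; apply: (average_fixed hT hnb hpi Q1 QM Qo).
have A0 : `|A e0 - e0| <= eps.
  apply: (average_near hT hnb hpi Q1 QM Qo) => g Qg; rewrite -[X in _ - X](rep1 hpi) ltW //.
  by apply: F0P => x xF; apply/Qg/nF; rewrite mem_cat xF.
have A1 : `|A e1 - e1| <= eps.
  apply: (average_near hT hnb hpi Q1 QM Qo) => g Qg; rewrite -[X in _ - X](rep1 hpi) ltW //.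
  by apply: F1P => x xF; apply/Qg/nF; rewrite mem_cat xF orbT.
have [a0 [a1 [a01]]] := ball_fixed_pair hnb (isT : c0 != c1) (isT : c0 != c2) (isT : c1 != c2)
  hkk ht hs hpi bs bb FI binv hirr hd (Afix e0) (Afix e1).
by rewrite leNgt (neg _ _ A0 A1 _ _ a01).
Qed.
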